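(* Let $\mu$ be the Gibbs measure on $\Sigma_A$ of a Hölder continuous potential $f:\Sigma_A\to\mathbb{R}$ that is not cohomologous to a constant. Let $\psi:\mathbb{N}\to\mathbb{N}$ be such that there exists $\varepsilon>0$ for which $$\sum_{n=1}^\infty e^{-h_\mu\psi(n)+(1+\varepsilon)\sqrt{2\rho_\mu\psi(n)\log\log\psi(n)}}<\infty.$$ Then $\mu(R_\psi)=0$.
   Context: Let $K\ge 2$ be an integer and $\Sigma=\{1,\dots,K\}^{\mathbb N}$. For sequences $\mathbf i,\mathbf j$ let $|\mathbf i\wedge\mathbf j|=\inf\{n\ge 0: i_{n+1}\neq j_{n+1}\}$, and equip $\Sigma$ with the metric $d(\mathbf i,\mathbf j)=K^{-|\mathbf i\wedge\mathbf j|}$. Let $A$ be a $K\times K$ matrix with entries in $\{0,1\}$ such that for some $M\in\mathbb N$ all entries of $A^M$ are strictly positive, let $\Sigma_A=\{\mathbf i\in\Sigma: A_{i_l,i_{l+1}}=1\text{ for all } l\in\mathbb N\}$, and let $\sigma:\Sigma_A\to\Sigma_A$ be the left shift $\sigma(i_1,i_2,\dots)=(i_2,i_3,\dots)$. Let $\Sigma_{A,n}$ be the set of words $i_1\dots i_n$ with $A_{i_l,i_{l+1}}=1$ for $1\le l\le n-1$, and for such a word $w$ let $[w]=\{\mathbf j\in\Sigma_A: j_1\dots j_n=w\}$; for $\mathbf i\in\Sigma_A$ write $\mathbf i|_1^n=i_1\dots i_n$. A function $f:\Sigma_A\to\mathbb R$ is Hölder continuous if there are $b>0$, $0<\alpha<1$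 with $|f(\mathbf i)-f(\mathbf j)|\le b\alpha^{|\mathbf i\wedge\mathbf j|}$ for all $\mathbf i,\mathbf j$. Its pressure is $P(f)=\lim_{n\to\infty}\frac1n\log\sum_{w\in\Sigma_{A,n}}\sup_{\mathbf j\in[w]}\exp(\sum_{k=0}^{n-1}f(\sigma^k\mathbf j))$. The Gibbs measure of $f$ is the unique $\sigma$-invariant ergodic Borel probability measure $\mu$ on $\Sigma_A$ for which there is $C>1$ with $C^{-1}\le \mu([\mathbf i|_1^n])\big/\exp(-nP(f)+\sum_{k=0}^{n-1}f(\sigma^k\mathbf i))\le C$ for all $\mathbf i\in\Sigma_A$, $n\in\mathbb N$. Its entropy is $h_\mu=\lim_{n\to\infty}-\frac1n\sum_{w\in\Sigma_{A,n}}\mu([w])\log\mu([w])$ and its variance is $\rho_\mu=\lim_{n\to\infty}\frac1n\int\big(\sum_{k=0}^{n-1}f(\sigma^k\mathbf i)-n\int f\,d\mu\big)^2d\mu(\mathbf i)$. The potential $f$ is cohomologous to a constant if $f=g\circ\sigma-g+c$ for some continuous $g:\Sigma_A\to\mathbb R$ and $c\in\mathbb R$. For $\psi:\mathbb N\to\mathbb N$, $R_\psi=\{\mathbf i\in\Sigma_A: d(\sigma^n\mathbf i,\mathbf i)\le K^{-\psi(n)}\text{ for infinitely many }n\in\mathbb N\}$. Convention: $\log x=0$ whenever $x\le 1$. *)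

(* Defs.v *)
From HB Require Import structures.
From mathcomp Require Import all_boot all_order all_algebra.
From mathcomp Require Import all_classical all_reals all_analysis.
Unset Printing Implicit Defensive.
Import Order.TTheory GRing.Theory Num.Theory numFieldNormedType.Exports.
Local Open Scope classical_set_scope.
Local Open Scope ring_scope.

(* Points of the sequence space: sequences of natural numbers, indexed from 0
   (x 0 is the paper's i_1).  The alphabet is {1,...,K}. *)
Definition Seq := nat -> nat.

Definition Sigma (K : nat) : set Seq := [set x | forall n, (1 <= x n <= K)%N].

(* A : K x K matrix indexed by {1..K}; only entries with indices in 1..K matter. *)
Definition Sigma_A (K : nat) (A : nat -> nat -> nat) : set Seq :=
  [set x | Sigma K x /\ forall l, A (x l) (x l.+1) = 1%N].

Fixpoint mxpow (K : nat) (A : nat -> nat -> nat) (m : nat) (a b : nat) : nat :=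
  match m with
  | 0 => (a == b : nat)
  | m'.+1 => (\sum_(1 <= c < K.+1) A a c * mxpow K A m' c b)%N
  end.

Definition primitive01 (K : nat) (A : nat -> nat -> nat) : Prop :=
  (forall a b, (1 <= a <= K)%N -> (1 <= b <= K)%N -> A a b = 0%N \/ A a b = 1%N)
  /\ exists M : nat, forall a b, (1 <= a <= K)%N -> (1 <= b <= K)%N ->
       (0 < mxpow K A M a b)%N.

Definition shift (x : Seq) : Seq := fun n => x n.+1.

(* cylinders of the full space; they generate the Borel sigma-algebra *)
Definition cylinders : set (set Seq) :=
  [set C | exists (n : nat) (w : Seq), C = [set x | forall k, (k < n)%N -> x k = w k]].

Definition SeqSpace := g_sigma_algebraType cylinders.

(* |x ^ y| : None stands for +infinity (x = y) *)
Definition wedge (x y : Seq) : option nat :=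
  match pselect (exists n, x n != y n) with
  | left H => Some (ex_minn H)
  | right _ => None
  end.

(* a ^ |x ^ y| with a^(+oo) = 0 (for 0 < a < 1) *)
Definition apow {R : realType} (a : R) (o : option nat) : R :=
  if o is Some n then a ^+ n else 0.

Definition dist {R : realType} (K : nat) (x y : Seq) : R :=
  apow (K%:R^-1) (wedge x y).

Definition holder {R : realType} (K : nat) (A : nat -> nat -> nat) (f : Seq -> R) :=
  exists (b alpha : R), 0 < b /\ 0 < alpha < 1 /\
    forall x y, Sigma_A K A x -> Sigma_A K A y ->
      `|f x - f y| <= b * apow alpha (wedge x y).

Definition continuous_on_SA {R : realType} (K : nat) (A : nat -> nat -> nat)
  (g : Seq -> R) :=
  forall x, Sigma_A K A x -> forall eps : R, 0 < eps -> exists2 delta : R, 0 < delta &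
    forall y, Sigma_A K A y -> dist K x y < delta -> `|g x - g y| < eps.

Definition cohomologous_to_const {R : realType} (K : nat) (A : nat -> nat -> nat)
  (f : Seq -> R) :=
  exists (g : Seq -> R) (c : R), continuous_on_SA K A g /\
    forall x, Sigma_A K A x -> f x = g (shift x) - g x + c.

Definition birkhoff {R : realType} (f : Seq -> R) (n : nat) (x : Seq) : R :=
  \sum_(k < n) f (iter k shift x).

(* words of length n over {1..K}: a tuple over 'I_K, letter a denotes a+1 *)
Definition word_seq (K n : nat) (w : n.-tuple 'I_K) : seq nat :=
  map (fun a : 'I_K => (nat_of_ord a).+1) w.

Definition adm_word (K : nat) (A : nat -> nat -> nat) (n : nat) (w : n.-tuple 'I_K) : bool :=
  all (fun l => A (nth 0%N (word_seq K n w) l) (nth 0%N (word_seq K n w) l.+1) == 1%N)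
      (iota 0 n.-1).

Definition cylw (K : nat) (A : nat -> nat -> nat) (n : nat) (w : n.-tuple 'I_K) : set Seq :=
  [set x | Sigma_A K A x /\ forall k, (k < n)%N -> x k = nth 0%N (word_seq K n w) k].

Definition cylx (K : nat) (A : nat -> nat -> nat) (x : Seq) (n : nat) : set Seq :=
  [set y | Sigma_A K A y /\ forall k, (k < n)%N -> y k = x k].

Definition pressure {R : realType} (K : nat) (A : nat -> nat -> nat) (f : Seq -> R) : R :=
  limn (fun n : nat => n%:R^-1 *
    ln (\sum_(w : n.-tuple 'I_K | adm_word K A n w)
          sup [set expR (birkhoff f n y) | y in cylw K A n w])).

Definition mu_real {R : realType} (mu : probability SeqSpace R) (B : set Seq) : R :=
  fine (mu B).

Definition is_gibbs {R : realType} (K : nat) (A : nat -> nat -> nat) (f : Seq -> R)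
  (mu : probability SeqSpace R) : Prop :=
  exists C : R, 1 < C /\
    forall x n, Sigma_A K A x -> (0 < n)%N ->
      C^-1 <= mu_real mu (cylx K A x n) /
                expR (- n%:R * pressure K A f + birkhoff f n x) <= C.

Definition shift_invariant {R : realType} (mu : probability SeqSpace R) : Prop :=
  forall B : set SeqSpace, measurable B -> mu (shift @^-1` B) = mu B.

Definition ergodic_on {R : realType} (K : nat) (A : nat -> nat -> nat)
  (mu : probability SeqSpace R) : Prop :=
  forall B : set SeqSpace, measurable B ->
    shift @^-1` B `&` Sigma_A K A = B `&` Sigma_A K A ->
    mu B = 0%E \/ mu B = 1%E.

Definition mu_entropy {R : realType} (K : nat) (A : nat -> nat -> nat)
  (mu : probability SeqSpace R) : R :=
  limn (fun n : nat => - (n%:R^-1 *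
    \sum_(w : n.-tuple 'I_K | adm_word K A n w)
       mu_real mu (cylw K A n w) * ln (mu_real mu (cylw K A n w)))).

Definition integral_SA {R : realType} (K : nat) (A : nat -> nat -> nat)
  (mu : probability SeqSpace R) (g : Seq -> R) : R :=
  fine (\int[mu]_(x in (Sigma_A K A : set SeqSpace)) (g x)%:E).

Definition mu_variance {R : realType} (K : nat) (A : nat -> nat -> nat)
  (mu : probability SeqSpace R) (f : Seq -> R) : R :=
  limn (fun n : nat => n%:R^-1 *
    integral_SA K A mu (fun x => (birkhoff f n x - n%:R * integral_SA K A mu f) ^+ 2)).

Definition R_psi {R : realType} (K : nat) (A : nat -> nat -> nat) (psi : nat -> nat) : set Seq :=
  [set x | Sigma_A K A x /\
     forall N : nat, exists n : nat, (N < n)%N /\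
       dist K (iter n shift x) x <= (K%:R : R) ^- psi n].

(* log with the convention log x = 0 for x <= 1 (used for log log) *)
Definition logc {R : realType} (x : R) : R := if x <= 1 then 0 else ln x.

(* Main.v *)
(* If x and its n-th shift agree on psi(n) letters, then x on its first n + psi(n) letters is
   determined by its first n letters, and quasi-independence of the Gibbs measure gives
   mu(returns at n) <= C sup mu([x|psi(n)]), the supremum being over the points kept in play.
   Since -log mu([x|n]) = n h - S_n(f - int f) + O(1), the upper half of the law of the iterated
   logarithm for S_n f keeps almost every point in play with exactly the exponent of the summable
   series, and Borel-Cantelli concludes.

   The law of the iterated logarithm rests on the normalised transfer operator N of f.  Birkhoff's
   cone contraction yields its eigenfunction and solves Poisson's equation for Hoelder functions,
   hence Gordin's decomposition f = c + m + u o s - u with N m = 0.  The Gibbs bounds compare mu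
   with the iterates of N, so that moment generating functions of S_n m become estimates on N^n:
   a second-order corrector gives E exp(t S_n m) <= 3 exp(n (rho t^2 / 2 + O(t^3))), with the
   sharp variance rho, and Doob's stopping argument controls the tail sums S_N - S_n inside
   blocks growing geometrically with a ratio close to 1. *)
Require Import Defs.
From HB Require Import structures.
From mathcomp Require Import all_boot all_order all_algebra.
From mathcomp Require Import all_classical all_reals all_analysis.
From mathcomp Require Import measurable_realfun.
From mathcomp Require Import ring lra.
Import Order.TTheory GRing.Theory Num.Theory numFieldNormedType.Exports.
Local Open Scope classical_set_scope.
Local Open Scope ring_scope.
(* MathComp-Analysis has a [shift] too. *)
Local Notation shift := Defs.shift.
Set Implicit Arguments.
Unset Strict Implicit.

(** Neither a dual eigenmeasure nor a spectral decomposition is constructed. In the probabilistic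
    estimates [mu] meets the operator only through an inequality: [pr mu B <= C' * q] as soon as the
    iterated operator, applied to a majorant of [B], stays below [q]. The lost factor [C'] is
    harmless for summable or exponentially small probabilities but useless for exact identities, so
    [N m = 0] does not give a vanishing integral of [m] by duality. That identity, on which the
    values of the entropy and of the variance rest, is drawn from exponential large deviations of
    the sums of [m] and of [-m], together with shift invariance. The operator averages over the
    first letter while the later ones are fixed. Its natural martingale therefore grows at the front
    and consists of tail sums, which is why a block is controlled from its right end. The cone
    argument runs on the iterate of order [M], since [M] steps lead from any letter to any point;
    the eigenfunction and Poisson's equation are carried back to one step afterwards. The exclusion
    of coboundaries enters as [0 < rho], by which the optimal parameter [t] divides. *)

Definition agree (n : nat) (x y : Seq) := forall i, (i < n)%N -> x i = y i.

Definition scons (a : nat) (x : Seq) : Seq :=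
  fun n => if n is n'.+1 then x n' else a.

Section Sequences.
Implicit Types x y : Seq.

Lemma scons_shift x : scons (x 0%N) (shift x) = x.
Proof. by apply/funext => -[]. Qed.

Lemma agree_sym n x y : agree n x y -> agree n y x.
Proof. by move=> h i /h. Qed.

Lemma agree_trans n y x z : agree n x y -> agree n y z -> agree n x z.
Proof. by move=> h1 h2 i ni; rewrite h1 // h2. Qed.

Lemma agree_scons n a x y : agree n x y -> agree n.+1 (scons a x) (scons a y).
Proof. by move=> h [|i] //= /h. Qed.

Lemma agree_shift n x y : agree n.+1 x y -> agree n (shift x) (shift y).
Proof. by move=> h i ni; apply: h. Qed.

Lemma iter_shiftE n x i : iter n shift x i = x (n + i)%N.
Proof. by elim: n i => [|n IH] i //=; rewrite /shift IH addnS. Qed.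

Lemma agree_iter_shift m n x y :
  agree (m + n) x y -> agree n (iter m shift x) (iter m shift y).
Proof. by move=> h i ni; rewrite !iter_shiftE h // ltn_add2l. Qed.

End Sequences.

(** * Sums over preimages and transfer operators *)

Section Operators.
Context {R : realType}.
Variables (K : nat) (A : nat -> nat -> nat).
Notation SA := (Sigma_A K A).
Implicit Types phi psi g : Seq -> R.

Lemma SA_shift x : SA x -> SA (shift x).
Proof. by case=> h1 h2; split=> n; [exact: h1|exact: h2]. Qed.

Lemma SA_iter_shift n x : SA x -> SA (iter n shift x).
Proof. by elim: n => //= n IH /IH /SA_shift. Qed.

Lemma SA_scons a x :
  SA x -> (a < K)%N -> A a.+1 (x 0%N) == 1%N -> SA (scons a.+1 x).
Proof.
move=> [h1 h2] aK /eqP h; split; first by case=> [|n] //=.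
by case.
Qed.

Definition presum phi x : R :=
  \sum_(a < K | A a.+1 (x 0%N) == 1%N) phi (scons a.+1 x).

Lemma le_presum phi psi x : (forall y, SA y -> phi y <= psi y) ->
  SA x -> presum phi x <= presum psi x.
Proof. by move=> h sx; apply: ler_sum => a aa; apply/h/SA_scons. Qed.

Lemma eq_presum phi psi x : (forall y, SA y -> phi y = psi y) ->
  SA x -> presum phi x = presum psi x.
Proof. by move=> h sx; apply: eq_bigr => a aa; apply/h/SA_scons. Qed.

Lemma presumD phi psi x :
  presum (fun y => phi y + psi y) x = presum phi x + presum psi x.
Proof. exact: big_split. Qed.

Lemma presum_shift psi phi x :
  presum (fun y => psi (shift y) * phi y) x = psi x * presum phi x.
Proof. by rewrite /presum mulr_sumr. Qed.

Lemma presumZ c phi x : presum (fun y => c * phi y) x = c * presum phi x.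
Proof. exact: (presum_shift (fun=> c)). Qed.

Lemma presum_ge0 phi x : (forall y, SA y -> 0 <= phi y) -> SA x -> 0 <= presum phi x.
Proof. by move=> h sx; apply: sumr_ge0 => a aa; apply/h/SA_scons. Qed.

Lemma presum_ge_term phi z : (forall y, SA y -> 0 <= phi y) -> SA z ->
  phi z <= presum phi (shift z).
Proof.
move=> h sz; have [sz1 sz2] := sz.
have zK : ((z 0%N).-1 < K)%N.
  by have /andP[] := sz1 0%N; case: (z 0%N).
have zE : (z 0%N).-1.+1 = z 0%N by have /andP[] := sz1 0%N; case: (z 0%N).
rewrite /presum (bigD1 (Ordinal zK)) /= ?zE; last exact/eqP/(sz2 0%N).
rewrite scons_shift lerDl; apply: sumr_ge0 => a /andP[aa _].
by apply/h/SA_scons => //; exact: SA_shift.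
Qed.

Lemma presum_le_max phi B x : 0 <= B -> (forall y, SA y -> phi y <= B) -> SA x ->
  presum phi x <= K%:R * B.
Proof.
move=> B0 h sx; rewrite mulr_natl -[X in _ *+ X](card_ord K) -sumr_const.
rewrite /presum big_mkcond /=; apply: ler_sum => a _; case: ifP => // aa.
exact/h/SA_scons.
Qed.

Lemma cvg_presum (u : nat -> Seq -> R) phi x :
  (forall y, SA y -> u n y @[n --> \oo] --> phi y) -> SA x ->
  presum (u n) x @[n --> \oo] --> presum phi x.
Proof.
move=> h sx; rewrite /presum; apply: cvg_big => [|a aa]; first exact: add_continuous.
exact/h/SA_scons.
Qed.

Definition tr g phi : Seq -> R := presum (fun y => g y * phi y).

End Operators.

(** * Hoelder functions *)

Section Hoelder.
Context {R : realType}.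
Variables (K : nat) (A : nat -> nat -> nat) (th : R).
Notation SA := (Sigma_A K A).
Implicit Types (x y z : Seq) (phi psi g : Seq -> R).
Hypothesis th01 : 0 < th < 1.

(** A single constant bounds both the supremum and the modulus, so that controlling one number is
    enough for limits of functions. Speaking of [agree] avoids the infinite value of [wedge]. *)
Definition hol_by C phi := (forall x, SA x -> `|phi x| <= C) /\
  forall k x y, SA x -> SA y -> agree k x y -> `|phi x - phi y| <= C * th ^+ k.

Definition hol phi := exists C, hol_by C phi.

Let th0 k : 0 <= th ^+ k.
Proof. by rewrite exprn_ge0//; case/andP: th01 => /ltW. Qed.

Lemma hol_by_le C D phi : C <= D -> hol_by C phi -> hol_by D phi.
Proof.
move=> CD [h1 h2]; split=> [x sx|k x y sx sy a].
  exact: le_trans (h1 x sx) CD.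
by apply: le_trans (h2 _ _ _ sx sy a) _; apply: ler_wpM2r.
Qed.

Lemma hol_pos phi : hol phi -> exists2 C, 0 < C & hol_by C phi.
Proof.
move=> [C h]; exists (`|C| + 1); first by rewrite ltr_wpDl.
by apply: hol_by_le h; rewrite (le_trans (ler_norm C))// lerDl.
Qed.

Lemma eq_hol phi psi : (forall x, SA x -> phi x = psi x) -> hol phi -> hol psi.
Proof.
move=> e [C [h1 h2]]; exists C; split=> [x sx|k x y sx sy a].
  by rewrite -e ?h1.
by rewrite -!e ?h2.
Qed.

Lemma hol_cst c : hol (fun=> c).
Proof.
exists `|c|; split=> // k x y _ _ _; rewrite subrr normr0.
by rewrite mulr_ge0.
Qed.

Lemma holD phi psi : hol phi -> hol psi -> hol (fun x => phi x + psi x).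
Proof.
move=> [C [h1 h2]] [D [h3 h4]]; exists (C + D); split=> [x sx|k x y sx sy a].
  by rewrite (le_trans (ler_normD _ _))// lerD ?h1 ?h3.
have -> : phi x + psi x - (phi y + psi y) = (phi x - phi y) + (psi x - psi y) by ring.
by rewrite (le_trans (ler_normD _ _))// mulrDl lerD ?h2 ?h4.
Qed.

Lemma holM phi psi : hol phi -> hol psi -> hol (fun x => phi x * psi x).
Proof.
move=> /hol_pos[C C0 [h1 h2]] /hol_pos[D D0 [h3 h4]].
exists (C * D + C * D); split=> [x sx|k x y sx sy a].
  by rewrite normrM ler_wpDl ?mulr_ge0 ?(ltW C0) ?(ltW D0)// ler_pM ?h1 ?h3.
have -> : phi x * psi x - phi y * psi y =
  phi x * (psi x - psi y) + psi y * (phi x - phi y) by ring.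
rewrite (le_trans (ler_normD _ _))// !normrM mulrDl lerD//.
  by rewrite -mulrA ler_pM ?h1 ?h4.
by rewrite [C * D]mulrC -mulrA ler_pM ?h3// h2.
Qed.

Lemma holZ c phi : hol phi -> hol (fun x => c * phi x).
Proof. by move=> h; apply: holM => //; exact: hol_cst. Qed.

Lemma holN phi : hol phi -> hol (fun x => - phi x).
Proof. by move=> /(holZ (-1)); apply: eq_hol => x _; rewrite mulN1r. Qed.

Lemma holB phi psi : hol phi -> hol psi -> hol (fun x => phi x - psi x).
Proof. by move=> h /holN; exact: holD. Qed.

Lemma hol_sum (I : Type) (r : seq I) (P : pred I) (F : I -> Seq -> R) :
  (forall i, P i -> hol (F i)) -> hol (fun x => \sum_(i <- r | P i) F i x).
Proof.
move=> h; elim: r => [|i r IH].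
  by apply: eq_hol (hol_cst 0) => x _; rewrite big_nil.
case Pi : (P i); last by apply: eq_hol IH => x _; rewrite big_cons Pi.
by apply: eq_hol (holD (h i Pi) IH) => x _; rewrite big_cons Pi.
Qed.

Lemma hol_shift phi : hol phi -> hol (fun x => phi (shift x)).
Proof.
move=> /hol_pos[C C0 [h1 h2]]; case/andP: (th01) => th0' th1.
exists (2 * C / th); split=> [x sx|[|k] x y sx sy a].
- apply: le_trans (h1 _ (SA_shift sx)) _.
  rewrite ler_pdivlMr//; have := th1; have := C0; nra.
- apply: (@le_trans _ _ (2 * C)).
    have := h1 _ (SA_shift sx); have := h1 _ (SA_shift sy).
    have := ler_normB (phi (shift x)) (phi (shift y)); lra.
  by rewrite expr0 mulr1 ler_pdivlMr//; have := th1; have := C0; nra.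
- apply: le_trans (h2 k _ _ (SA_shift sx) (SA_shift sy) (agree_shift a)) _.
  rewrite exprS mulrA divfK ?gt_eqF// ler_wpM2r// ler_peMl ?(ltW C0)//; lra.
Qed.

Lemma hol_iter_shift n phi : hol phi -> hol (fun x => phi (iter n shift x)).
Proof.
move=> h; elim: n => [|n IH] //=.
have := hol_shift IH; apply: eq_hol => x _; by rewrite -iterSr.
Qed.

Lemma hol_birkhoff n phi : hol phi -> hol (birkhoff phi n).
Proof. by move=> h; apply: hol_sum => i _; exact: hol_iter_shift. Qed.

Lemma hol_inv (c : R) phi : 0 < c -> (forall x, SA x -> c <= phi x) -> hol phi ->
  hol (fun x => (phi x)^-1).
Proof.
move=> c0 cphi /hol_pos[C C0 [h1 h2]].
have p0 x : SA x -> 0 < phi x by move=> sx; apply: lt_le_trans (cphi x sx).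
have pc x : SA x -> (phi x)^-1 <= c^-1.
  by move=> sx; rewrite lef_pV2 ?posrE ?p0// cphi.
exists (c^-1 + c^-1 * c^-1 * C); split=> [x sx|k x y sx sy a].
  rewrite gtr0_norm ?invr_gt0 ?p0// ler_wpDr ?pc//.
  by rewrite !mulr_ge0 ?invr_ge0 ?(ltW c0) ?(ltW C0).
have -> : (phi x)^-1 - (phi y)^-1 = (phi x)^-1 * (phi y)^-1 * (phi y - phi x).
  by field; rewrite !gt_eqF ?p0.
rewrite normrM mulrDl ler_wpDl ?mulr_ge0 ?invr_ge0 ?(ltW c0)//.
rewrite -[leRHS]mulrA ler_pM//; last by rewrite distrC h2.
by rewrite gtr0_norm ?mulr_gt0 ?invr_gt0 ?p0// ler_pM ?pc// invr_ge0 ltW ?p0.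
Qed.

Lemma hol_presum phi : hol phi -> hol (presum K A phi).
Proof.
move=> /hol_pos[C C0 [h1 h2]]; case/andP: (th01) => th0' th1.
have KC : 0 <= K%:R * C by rewrite mulr_ge0 ?(ltW C0).
have b x : SA x -> `|presum K A phi x| <= K%:R * C.
  move=> sx; apply: le_trans (ler_norm_sum _ _ _) _.
  exact: (presum_le_max (phi := fun y => `|phi y|) (ltW C0) h1 sx).
exists (2 * (K%:R * C)); split=> [x sx|[|k] x y sx sy a].
- by apply: le_trans (b _ sx) _; lra.
(* Without a common first letter the points may have different admissible preimages; only the
   supremum bound is left, which costs the factor 2. *)
- rewrite expr0 mulr1; have := b _ sx; have := b _ sy.
  by have := ler_normB (presum K A phi x) (presum K A phi y); lra.
- rewrite /presum -(a 0%N)// -sumrB.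
  apply: le_trans (ler_norm_sum _ _ _) _.
  apply: (@le_trans _ _ (K%:R * (C * th ^+ k.+1))).
    rewrite mulr_natl -[X in _ *+ X](card_ord K) -sumr_const big_mkcond.
    apply: ler_sum => i _; case: ifP => [ai|_]; last by rewrite mulr_ge0 ?ltW// exprn_gt0.
    apply: (le_trans (h2 k.+2 _ _ _ _ _)).
    + exact: SA_scons.
    + by apply: SA_scons => //; rewrite -(a 0%N).
    + exact: agree_scons.
    + by rewrite ler_wpM2l ?(ltW C0)// ler_wiXn2l// ltW.
  by rewrite mulrA ler_wpM2r//; lra.
Qed.

Lemma hol_tr g phi : hol g -> hol phi -> hol (tr K A g phi).
Proof. by move=> hg hp; apply/hol_presum/holM. Qed.

Lemma hol_iter_tr g phi n : hol g -> hol phi -> hol (iter n (tr K A g) phi).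
Proof. by move=> hg hp; elim: n => //= n; exact: hol_tr. Qed.

End Hoelder.

(** * Cones of log-Hoelder functions *)

Lemma expRB1_le {R : realType} (v : R) : expR v - 1 <= v * expR v.
Proof.
have := expR_ge1Dx (- v); rewrite expRN -(ler_pM2r (expR_gt0 v)) mulVf ?gt_eqF ?expR_gt0//.
lra.
Qed.

Section Cone.
Context {R : realType}.
Variables (K : nat) (A : nat -> nat -> nat) (th : R).
Notation SA := (Sigma_A K A).
Implicit Types (x y z : Seq) (phi psi g : Seq -> R).
Hypothesis th01 : 0 < th < 1.

(* [0 < k] because only points with the same first letter have the same admissible preimages. *)
Definition cone (B : R) phi := (forall x, SA x -> 0 <= phi x) /\
  forall k x y, (0 < k)%N -> SA x -> SA y -> agree k x y ->
    phi x <= expR (B * th ^+ k) * phi y.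

Let thk k : 0 <= th ^+ k <= 1.
Proof.
case/andP: th01 => h0 h1; rewrite exprn_ge0 ?(ltW h0)//=.
by rewrite exprn_ile1// ltW.
Qed.

Lemma eq_cone B phi psi : (forall x, SA x -> phi x = psi x) -> cone B phi -> cone B psi.
Proof.
move=> e [h1 h2]; split=> [x sx|k x y k0 sx sy a]; first by rewrite -e// h1.
by rewrite -!e//; exact: h2.
Qed.

Lemma coneD B phi psi : cone B phi -> cone B psi -> cone B (fun x => phi x + psi x).
Proof.
move=> [h1 h2] [h3 h4]; split=> [x sx|k x y k0 sx sy a]; first by rewrite addr_ge0 ?h1 ?h3.
by rewrite mulrDr lerD ?h2 ?h4.
Qed.

Lemma coneZ B c phi : 0 <= c -> cone B phi -> cone B (fun x => c * phi x).
Proof.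
move=> c0 [h1 h2]; split=> [x sx|k x y k0 sx sy a]; first by rewrite mulr_ge0 ?h1.
by rewrite mulrCA ler_wpM2l// h2.
Qed.

Lemma cone_cst B c : 0 <= B -> 0 <= c -> cone B (fun=> c).
Proof.
move=> B0 c0; split=> // k x y _ _ _ _; rewrite ler_peMl// -expR0 ler_expR.
by rewrite mulr_ge0//; case/andP: (thk k).
Qed.

Lemma cone_le B B' phi : B <= B' -> cone B phi -> cone B' phi.
Proof.
move=> BB [h1 h2]; split=> // k x y k0 sx sy a; apply: le_trans (h2 _ _ _ k0 sx sy a) _.
by rewrite ler_wpM2r ?h1// ler_expR ler_wpM2r//; case/andP: (thk k).
Qed.

(** Prepending a letter lengthens the agreement by one: the exponent of [phi] becomes B th^(k+1) and
    the weight adds b th^(k+1). The aperture thus follows the contracting map B -> (b + B) th. *)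
Lemma cone_tr b B g phi :
  (forall x, SA x -> 0 <= g x) ->
  (forall k x y, SA x -> SA y -> agree k x y -> g x <= expR (b * th ^+ k) * g y) ->
  cone B phi -> cone ((b + B) * th) (tr K A g phi).
Proof.
move=> g0 gb [h1 h2]; split=> [x sx|k x y k0 sx sy a].
  by apply: presum_ge0 => // y sy; rewrite mulr_ge0 ?g0 ?h1.
rewrite /tr /presum (a 0%N)// mulr_sumr; apply: ler_sum => i ai.
have sx' : SA (scons i.+1 x) by apply: SA_scons => //; rewrite (a 0%N).
have sy' : SA (scons i.+1 y) by apply: SA_scons.
have a' := agree_scons i.+1 a.
apply: (@le_trans _ _ ((expR (b * th ^+ k.+1) * g (scons i.+1 y)) *
   (expR (B * th ^+ k.+1) * phi (scons i.+1 y)))).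
  by rewrite ler_pM ?g0 ?h1 ?gb// h2.
rewrite mulrACA -expRD -mulrDl -[(b + B) * th * _]mulrA -exprS.
by rewrite lexx.
Qed.

Lemma cone_cvg B (u : nat -> Seq -> R) phi : (forall n, cone B (u n)) ->
  (forall x, SA x -> u n x @[n --> \oo] --> phi x) -> cone B phi.
Proof.
move=> cu u_phi; split=> [x sx|k x y k0 sx sy a].
  by apply: (cvgr_to_ge (u_phi x sx)); apply: nearW => n; case: (cu n) => + _; exact.
apply: (ler_cvg_to (u_phi x sx) (cvgM (cvg_cst (expR (B * th ^+ k))) (u_phi y sy))); apply: nearW => n.
by case: (cu n) => _; exact.
Qed.

(** The added constant keeps the function above C/B. With v = B th^k the variation C th^k equals v
    C/B, which is absorbed by e^v >= 1 + v. *)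
Lemma hol_cone B C phi : 0 < B -> hol_by K A th C phi ->
  cone B (fun x => phi x + (C + C / B)).
Proof.
move=> B0 [h1 h2].
have pb x : SA x -> C / B <= phi x + (C + C / B).
  by move=> sx; have := h1 _ sx; rewrite ler_norml => /andP[+ _]; lra.
have CB x : SA x -> 0 <= C / B.
  by move=> sx; rewrite divr_ge0 ?(ltW B0)// (le_trans _ (h1 _ sx)).
split=> [x sx|k x y k0 sx sy a]; first exact: le_trans (CB _ sx) (pb _ sx).
have := h2 _ _ _ sx sy a; have := ler_norm (phi x - phi y).
set v := B * _; have v0 : 0 <= v by rewrite mulr_ge0 ?(ltW B0)//; case/andP: (thk k).
have -> : C * th ^+ k = v * (C / B) by rewrite /v; field; lra.
have := pb _ sy; have := CB _ sx; have := expR_ge1Dx v; nra.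
Qed.

Lemma cone_hol B s phi : 0 <= B -> (forall x, SA x -> phi x <= s) -> cone B phi ->
  hol_by K A th ((1 + B * expR B) * s) phi.
Proof.
move=> B0 ps [h1 h2].
have e1 := expR_gt0 B.
have s0 x : SA x -> 0 <= s by move=> sx; exact: le_trans (h1 _ sx) (ps _ sx).
have p k x y : SA x -> SA y -> agree k x y ->
    phi x - phi y <= (1 + B * expR B) * s * th ^+ k.
  move=> sx sy; case: k => [|k] a.
    rewrite expr0 mulr1; have := ps _ sx; have := h1 _ sy; have := s0 _ sx.
    have : 0 <= B * expR B by rewrite mulr_ge0// ltW.
    nra.
  have := h2 _ _ _ (ltn0Sn k) sx sy a.
  have [t0 t1] := andP (thk k.+1); set t := th ^+ k.+1 in t0 t1 *.
  have := expRB1_le (B * t).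
  have : B * t * expR (B * t) <= B * t * expR B.
    by rewrite ler_wpM2l ?mulr_ge0// ler_expR ler_piMr.
  move=> le1 le2 le3.
  have : (B * t * expR B) * phi y <= (B * t * expR B) * s.
    by rewrite ler_wpM2l ?ps// !mulr_ge0// ltW.
  have := h1 _ sy; have := s0 _ sx => s00 py le4.
  have le5 : (expR (B * t) - 1) * phi y <= (B * t * expR B) * phi y.
    by rewrite ler_wpM2r//; exact: le_trans le2 le1.
  have : 0 <= s * t by rewrite mulr_ge0.
  lra.
split=> [x sx|k x y sx sy a].
  rewrite ger0_norm ?h1// (le_trans (ps _ sx))// ler_peMl ?(s0 _ sx)//.
  by rewrite lerDl mulr_ge0// ltW.
by rewrite ler_norml p// lerNl opprB p//; exact: agree_sym.
Qed.

(** With E = exp(B th^k) one has phi x >= phi y / E, and the claim reduces to (E - 1/E) phi y <= 2 s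
    (E - 1). It holds since phi y <= s and E - 1/E <= 2 (E - 1), which explains the factor 2. *)
Lemma cone_supB B s phi : (forall x, SA x -> phi x <= s) -> 0 <= B ->
  cone B phi -> cone B (fun x => 2 * s - phi x).
Proof.
move=> ps B0 [h1 h2]; split=> [x sx|k x y k0 sx sy a].
  by have := ps _ sx; have := h1 _ sx; lra.
have := h2 _ _ _ k0 sy sx (agree_sym a); have := ps _ sy; have := h1 _ sx.
have := h1 _ sy.
set E := expR _; have E1 : 1 <= E.
  by rewrite /E -expR0 ler_expR mulr_ge0//; case/andP: (thk k).
move=> y0 x0 ys yx.
have : E * (E * phi y - phi x) <= E * (2 * (E - 1) * phi y).
  by have := mulr_ge0 (sqr_ge0 (E - 1)) y0; rewrite expr2; lra.
rewrite ler_pM2l; last by lra.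
have : 0 <= (E - 1) * (s - phi y) by rewrite mulr_ge0; lra.
lra.
Qed.

(** With t = th^k the narrower cone leaves the slack (e^(Bt) - e^(B1 t)) phi y >= (B - B1) t phi y,
    while subtracting s costs (e^(Bt) - 1) s <= B t e^B s. The smallness of s compares the two. *)
Lemma cone_subB B B1 s phi : 0 <= B1 -> B1 < B -> 0 <= s ->
  (forall x, SA x -> s <= (B - B1) / (B * expR B) * phi x) ->
  cone B1 phi -> cone B (fun x => phi x - s).
Proof.
move=> B10 B1B s0 ps [h1 h2].
have B0 : 0 < B by lra.
have eB : 1 <= expR B by rewrite -expR0 ler_expR ltW.
have eta1 : (B - B1) / (B * expR B) <= 1.
  by rewrite ler_pdivrMr ?mulr_gt0 ?expR_gt0//; nra.
split=> [x sx|k x y k0 sx sy a].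
  have := ps _ sx; have := h1 _ sx; nra.
have := h2 _ _ _ k0 sx sy a; have := ps _ sy; have := h1 _ sy.
have [t0 t1] := andP (thk k); set t := th ^+ k in t0 t1 *.
move=> y0 ys xy.
have i1 : (expR (B * t) - 1) * s <= (B - B1) * t * phi y.
  apply: (@le_trans _ _ (B * t * expR B * s)).
    rewrite ler_wpM2r// (le_trans (expRB1_le _))// ler_wpM2l ?mulr_ge0 ?(ltW B0)//.
    by rewrite ler_expR ler_piMr// ltW.
  apply: (@le_trans _ _ (B * t * expR B * ((B - B1) / (B * expR B) * phi y))).
    by rewrite ler_wpM2l// !mulr_ge0 ?(ltW B0) ?(ltW (expR_gt0 _)).
  by rewrite le_eqVlt; apply/orP; left; apply/eqP; field; rewrite !gt_eqF ?expR_gt0.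
have i2 : (B - B1) * t <= expR (B * t) - expR (B1 * t).
  have -> : expR (B * t) = expR (B1 * t) * expR ((B - B1) * t).
    by rewrite -expRD; congr expR; ring.
  have := expR_ge1Dx ((B - B1) * t).
  have : 1 <= expR (B1 * t) by rewrite -expR0 ler_expR mulr_ge0.
  have : 0 <= (B - B1) * t by rewrite mulr_ge0//; lra.
  nra.
have : (B - B1) * t * phi y <= (expR (B * t) - expR (B1 * t)) * phi y.
  by rewrite ler_wpM2r.
lra.
Qed.

End Cone.

(** * Birkhoff's contraction for an abstract cone-preserving operator *)

Section Contraction.
Context {R : realType}.
Variables (K : nat) (A : nat -> nat -> nat) (th : R).
Notation SA := (Sigma_A K A).
Implicit Types (x y z : Seq) (phi psi g : Seq -> R).
Hypothesis th01 : 0 < th < 1.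
Variables (B B1 C0 : R) (T : (Seq -> R) -> Seq -> R) (x0 : Seq).
Hypothesis B10 : 0 <= B1.
Hypothesis B1B : B1 < B.
Hypothesis C01 : 1 <= C0.
Hypothesis T_lin : forall phi psi c,
  T (fun x => phi x + c * psi x) = fun x => T phi x + c * T psi x.
Hypothesis T_cone : forall phi, cone K A th B phi -> cone K A th B1 (T phi).
Hypothesis T_harnack : forall phi, cone K A th B phi ->
  forall x y, SA x -> SA y -> T phi x <= C0 * T phi y.
Hypothesis Sx0 : SA x0.

Notation cn := (cone K A th B).
Let eta := (B - B1) / (B * expR B).
Let kappa := eta / (2 * C0 ^+ 2).

Let eta0 : 0 < eta.
Proof.
have B0 : 0 < B by move: B10 B1B; lra.
by rewrite divr_gt0 ?subr_gt0 ?mulr_gt0 ?expR_gt0.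
Qed.

Let kappa01 : 0 < kappa < 1.
Proof.
have B0 : 0 < B by move: B10 B1B; lra.
have eB : 1 <= expR B by rewrite -expR0 ler_expR ltW.
have eta1 : eta <= 1 by rewrite ler_pdivrMr ?mulr_gt0 ?expR_gt0//; move: B10; nra.
have C00 : 0 < C0 by move: C01; lra.
have C02 : 1 <= C0 ^+ 2 by rewrite exprn_ege1.
have C02' : 0 < 2 * C0 ^+ 2 by lra.
by rewrite divr_gt0//= ltr_pdivrMr//; lra.
Qed.

(** [cone_subB] and the Harnack bound let T phi give up the constant (eta / C0) T phi x0, and
    [cone_supB] puts 2 C0 T psi x0 - T psi into the cone. With kappa = eta / (2 C0^2) the constants
    cancel in the combination of the two, and a fixed share of the ratio at x0 has been
    subtracted. *)
Lemma cone_ratio phi psi : cn phi -> cn psi -> 0 < T psi x0 ->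
  cn (fun x => T phi x - kappa * (T phi x0 / T psi x0) * T psi x).
Proof.
move=> cp cs s0; have B0 : 0 <= B by move: B10 B1B; lra.
have C00 : 0 < C0 by move: C01; lra.
have [p0 _] := T_cone cp.
set r := T phi x0 / T psi x0.
have r0 : 0 <= r by rewrite divr_ge0 ?p0// ltW.
have h1 : cn (fun x => T phi x - eta / C0 * T phi x0).
  apply: (@cone_subB _ _ _ _ th01 B B1) => //.
  - by rewrite mulr_ge0 ?p0// divr_ge0 ?ltW.
  - move=> x sx; rewrite -/eta -mulrA ler_pM2l// mulrC ler_pdivrMr// mulrC.
    exact: T_harnack.
  - exact: T_cone.
have h2 : cn (fun x => 2 * (C0 * T psi x0) - T psi x).
  apply: cone_supB => //; first by move=> x sx; exact: T_harnack.
  exact: (cone_le th01 (ltW B1B) (T_cone cs)).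
have kr : 0 <= kappa * r by rewrite mulr_ge0 ?r0//; case/andP: kappa01 => /ltW.
apply: eq_cone (coneD h1 (coneZ kr h2)) => x sx.
rewrite /kappa /r; field; rewrite !gt_eqF//.
Qed.

Lemma iter_T_cone n phi : cn phi -> cn (iter n T phi).
Proof. by move=> h; elim: n => //= n /T_cone; apply: cone_le => //; exact: ltW. Qed.

Lemma T_subr phi psi c :
  T (fun x => phi x - c * psi x) = fun x => T phi x - c * T psi x.
Proof.
transitivity (T (fun x => phi x + (- c) * psi x)).
  by congr T; apply/funext => x; rewrite mulNr.
by rewrite T_lin; apply/funext => x; rewrite mulNr.
Qed.

Lemma T_subl phi psi c :
  T (fun x => c * psi x - phi x) = fun x => c * T psi x - T phi x.
Proof.
have T0 : T (fun=> 0) = fun=> 0.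
  transitivity (T (fun x => phi x + (- 1) * phi x)).
    by congr T; apply/funext => x; rewrite mulN1r subrr.
  by rewrite T_lin; apply/funext => x; rewrite mulN1r subrr.
have Tc : T (fun x => c * psi x) = fun x => c * T psi x.
  transitivity (T (fun x => 0 + c * psi x)).
    by congr T; apply/funext => x; rewrite add0r.
  by rewrite T_lin T0; apply/funext => x; rewrite add0r.
transitivity (T (fun x => c * psi x - 1 * phi x)).
  by congr T; apply/funext => x; rewrite mul1r.
by rewrite T_subr Tc; apply/funext => x; rewrite mul1r.
Qed.

(* Birkhoff's contraction: applying [cone_ratio] to [phi - a psi] and to [b psi - phi] moves both
   [a] and [b] towards the ratio at [x0], so that [b - a] shrinks by the factor [1 - kappa]. *)
Lemma cone_contraction phi psi al be : cn psi ->
  (forall k, 0 < iter k T psi x0) ->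
  cn (fun x => phi x - al * psi x) -> cn (fun x => be * psi x - phi x) ->
  exists c, forall k, exists a b, [/\ a <= c <= b,
    b - a <= (1 - kappa) ^+ k * (be - al),
    cn (fun x => iter k T phi x - a * iter k T psi x) &
    cn (fun x => b * iter k T psi x - iter k T phi x)].
Proof.
move=> cs s0 ca cb; have [k0 k1] := andP kappa01.
pose r k := iter k.+1 T phi x0 / iter k.+1 T psi x0.
pose fix ab k := if k is k'.+1 then
  ((ab k').1 + kappa * (r k' - (ab k').1), (ab k').2 - kappa * ((ab k').2 - r k'))
  else (al, be).
have abP k : [/\ (ab k).2 - (ab k).1 = (1 - kappa) ^+ k * (be - al),
    cn (fun x => iter k T phi x - (ab k).1 * iter k T psi x) &
    cn (fun x => (ab k).2 * iter k T psi x - iter k T phi x)].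
  elim: k => [|k [IH1 IH2 IH3]]; first by rewrite /= expr0 mul1r.
  have cs' := iter_T_cone k cs.
  have := s0 k.+1 => /= s0'.
  have := @cone_ratio _ _ IH2 cs' s0'; have := @cone_ratio _ _ IH3 cs' s0'.
  have -> : T (fun x => (ab k).2 * iter k T psi x - iter k T phi x) =
    fun x => (ab k).2 * T (iter k T psi) x - T (iter k T phi) x.
    exact: T_subl.
  have -> : T (fun x => iter k T phi x - (ab k).1 * iter k T psi x) =
    fun x => T (iter k T phi) x - (ab k).1 * T (iter k T psi) x.
    exact: T_subr.
  move=> h3 h2; split=> /=.
  - by rewrite exprS -mulrA -IH1; ring.
  - apply: eq_cone h2 => x sx; rewrite /r/=; field; lra.
  - apply: eq_cone h3 => x sx; rewrite /r/=; field; lra.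
have ab_le k : (ab k).1 <= (ab k).2.
  have [h _ _] := abP k; rewrite -subr_ge0 h mulr_ge0 ?exprn_ge0 ?subr_ge0 ?(ltW k1)//.
  have := proj1 ca _ Sx0; have := proj1 cb _ Sx0; have := s0 0%N => /= s00 i1 i2.
  have : 0 <= (be - al) * psi x0 by lra.
  by rewrite pmulr_lge0// subr_ge0.
have mono k : (ab k).1 <= (ab k.+1).1 /\ (ab k.+1).2 <= (ab k).2.
  have [_ h2 h3] := abP k; have s0' := s0 k.+1.
  have := proj1 (T_cone h2) _ Sx0; have := proj1 (T_cone h3) _ Sx0.
  rewrite T_subr T_subl => i1 i2 /=; rewrite /= in s0'.
  have j1 : (ab k).1 <= r k by rewrite /r ler_pdivlMr//=; lra.
  have j2 : r k <= (ab k).2 by rewrite /r ler_pdivrMr//=; lra.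
  by split; [rewrite lerDl|rewrite gerBl]; rewrite mulr_ge0 ?(ltW k0)// subr_ge0.
have mono1 k n : (ab k).1 <= (ab (n + k)%N).1.
  by elim: n => // n IH; apply: (le_trans IH); case: (mono (n + k)%N).
have mono2 k n : (ab (n + k)%N).2 <= (ab k).2.
  by elim: n => // n IH; apply: le_trans IH; case: (mono (n + k)%N).
have le12 j k : (ab j).1 <= (ab k).2.
  by rewrite (le_trans (mono1 j k))// (le_trans (ab_le _))// addnC mono2.
(* The intervals are nested, so the supremum of the left ends lies in all of them. *)
pose S := [set (ab k).1 | k in setT].
have S0 : S !=set0 by exists (ab 0%N).1, 0%N.
exists (sup S) => k; exists (ab k).1, (ab k).2; have [h1 h2 h3] := abP k.
split=> //; last by rewrite h1.
apply/andP; split.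
  by apply: ub_le_sup; [exists (ab 0%N).2 => _ [j _ <-]|exists k].
by apply: ge_sup => // _ [j _ <-].
Qed.

(** The rate is quantified before the functions: one [zeta] serves every later application, and its
    explicit value is forgotten. *)
Lemma ex_cone_contraction : exists2 zeta : R, 0 < zeta < 1 &
  forall phi psi al be, cn psi -> (forall k, 0 < iter k T psi x0) ->
  cn (fun x => phi x - al * psi x) -> cn (fun x => be * psi x - phi x) ->
  exists c, forall k, exists a b, [/\ a <= c <= b,
    b - a <= zeta ^+ k * (be - al),
    cn (fun x => iter k T phi x - a * iter k T psi x) &
    cn (fun x => b * iter k T psi x - iter k T phi x)].
Proof.
exists (1 - kappa); last exact: cone_contraction.
by have [k0 k1] := andP kappa01; rewrite subr_gt0 k1 gtrBl.
Qed.

End Contraction.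

(** * Geometric convergence *)

Section Geometric.
Context {R : realType}.
Variables (E zeta : R).
Hypothesis zeta01 : 0 < zeta < 1.

Lemma sum_geo_le n : 0 <= E -> \sum_(0 <= k < n) E * zeta ^+ k <= E / (1 - zeta).
Proof.
case/andP: zeta01 => z0 z1 E0.
rewrite -mulr_sumr ler_wpM2l// -[leRHS]mul1r ler_pdivlMr ?subr_gt0//.
have := subrX1 zeta n; rewrite -(big_mkord predT (fun i => zeta ^+ i)) => e.
have : 0 <= zeta ^+ n by rewrite exprn_ge0// ltW.
lra.
Qed.

Lemma cvgn_geo_series (d : nat -> R) :
  (forall k, `|d k| <= E * zeta ^+ k) -> cvgn (series d).
Proof.
case/andP: zeta01 => z0 z1 h.
apply: normed_cvg; apply: (@series_le_cvg _ _ (geometric E zeta)) => //.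
- by move=> n; exact: normr_ge0.
- by move=> n; exact: le_trans (normr_ge0 _) (h n).
by apply: is_cvg_geometric_series; rewrite gtr0_norm.
Qed.

Lemma cvgn_geo_step (u : nat -> R) :
  (forall k, `|u k.+1 - u k| <= E * zeta ^+ k) -> cvgn u.
Proof.
move=> h; have := cvgn_geo_series (d := telescope u) h.
rewrite telescopeK => /cvg_ex[l hl].
apply/cvg_ex; exists (l + u 0%N).
have e : u = (fun n => (u n - u 0%N) + u 0%N) by apply/funext => n; rewrite subrK.
by rewrite {1}e; apply: cvgD hl (cvg_cst _).
Qed.

Lemma geo_le0 (c : R) : (forall k, c <= E * zeta ^+ k) -> c <= 0.
Proof.
case/andP: zeta01 => z0 z1 h.
have z : `|zeta| < 1 by rewrite gtr0_norm.
by apply: (ler_cvg_to (cvg_cst c) (cvg_geometric E z)); exact: nearW.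
Qed.

End Geometric.

Section HoelderLimit.
Context {R : realType}.
Variables (K : nat) (A : nat -> nat -> nat) (th : R).
Notation SA := (Sigma_A K A).
Implicit Types (x y z : Seq) (phi psi g : Seq -> R).

Lemma hol_by_sum (C : nat -> R) (d : nat -> Seq -> R) n :
  (forall k, hol_by K A th (C k) (d k)) ->
  hol_by K A th (\sum_(0 <= k < n) C k) (fun x => \sum_(0 <= k < n) d k x).
Proof.
move=> h; split=> [x sx|k x y sx sy a].
  apply: le_trans (ler_norm_sum _ _ _) _; apply: ler_sum => i _.
  by case: (h i) => + _; exact.
rewrite -sumrB mulr_suml; apply: le_trans (ler_norm_sum _ _ _) _.
by apply: ler_sum => i _; case: (h i) => _; exact.
Qed.

Lemma hol_by_cvg C (u : nat -> Seq -> R) phi : (forall n, hol_by K A th C (u n)) ->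
  (forall x, SA x -> u n x @[n --> \oo] --> phi x) -> hol_by K A th C phi.
Proof.
move=> hu h; split=> [x sx|k x y sx sy a].
  apply: (cvgr_to_le (cvg_norm (h x sx))); apply: nearW => n.
  by case: (hu n) => + _; exact.
apply: (cvgr_to_le (cvg_norm (cvgB (h x sx) (h y sy)))); apply: nearW => n.
by case: (hu n) => _; exact.
Qed.

Lemma hol_geo_sum E zeta (d : nat -> Seq -> R) : 0 < zeta < 1 -> 0 <= E -> 0 < th < 1 ->
  (forall k, hol_by K A th (E * zeta ^+ k) (d k)) ->
  exists a, hol K A th a /\
    forall x, SA x -> (\sum_(0 <= k < n) d k x) @[n --> \oo] --> a x.
Proof.
move=> z01 E0 th01 h; exists (fun x => limn (series (fun k => d k x))).
have c x : SA x -> (\sum_(0 <= k < n) d k x) @[n --> \oo] --> limn (series (fun k => d k x)).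
  by move=> sx; apply: (cvgn_geo_series (E := E) z01) => k; case: (h k) => + _; exact.
split=> //; exists (E / (1 - zeta)); apply: hol_by_cvg c => n.
exact: (hol_by_le th01 (sum_geo_le z01 n E0) (hol_by_sum n h)).
Qed.

End HoelderLimit.

Section Iterates.
Context {R : realType}.
Variables (K : nat) (A : nat -> nat -> nat) (g : Seq -> R).
Notation SA := (Sigma_A K A).
Implicit Types (x y z : Seq) (phi psi : Seq -> R).
Notation L := (tr K A g).

Lemma tr_lin phi psi c : L (fun x => phi x + c * psi x) = fun x => L phi x + c * L psi x.
Proof.
apply/funext => x; rewrite /tr -presumZ -presumD; congr (presum _ _ _ x).
by apply/funext => y; ring.
Qed.

Lemma iter_tr_lin n phi psi c :
  iter n L (fun x => phi x + c * psi x) = fun x => iter n L phi x + c * iter n L psi x.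
Proof. by elim: n => //= n ->; rewrite tr_lin. Qed.

Lemma iter_trZ n c phi :
  iter n L (fun x => c * phi x) = fun x => c * iter n L phi x.
Proof.
elim: n => //= n ->; apply/funext => x; rewrite /tr -presumZ.
by congr (presum _ _ _ x); apply/funext => y; ring.
Qed.

Lemma eq_tr phi psi : (forall x, SA x -> phi x = psi x) ->
  forall x, SA x -> L phi x = L psi x.
Proof. by move=> h x sx; apply: eq_presum => // y sy; rewrite h. Qed.

Lemma eq_iter_tr n phi psi : (forall x, SA x -> phi x = psi x) ->
  forall x, SA x -> iter n L phi x = iter n L psi x.
Proof. by elim: n => //= n IH h; apply: eq_tr; exact: IH. Qed.

Lemma cvg_iter_tr n (u : nat -> Seq -> R) phi :
  (forall x, SA x -> u k x @[k --> \oo] --> phi x) ->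
  forall x, SA x -> iter n L (u k) x @[k --> \oo] --> iter n L phi x.
Proof.
elim: n => //= n IH h x sx.
apply: (@cvg_presum _ K A (fun k y => g y * iter n L (u k) y)) => // y sy.
by apply: cvgM (IH h y sy); exact: cvg_cst.
Qed.

Lemma iter_tr_sum n (d : nat -> Seq -> R) m x : 
  iter n L (fun x => \sum_(0 <= k < m) d k x) x = \sum_(0 <= k < m) iter n L (d k) x.
Proof.
elim: m x => [|m IH] x.
  under eq_fun do rewrite big_nil; rewrite big_nil.
  have -> : (fun=> 0 : R) = (fun y => (d 0%N y) + (-1) * (d 0%N y)) :> (Seq -> R).
    by apply/funext => y; rewrite mulN1r subrr.
  by rewrite iter_tr_lin mulN1r subrr.
rewrite big_nat_recr//= -IH.
transitivity (iter n L (fun x => \sum_(0 <= k < m) d k x + 1 * d m x) x).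
  by congr (iter n L _ x); apply/funext => y; rewrite big_nat_recr//= mul1r.
by rewrite iter_tr_lin mul1r.
Qed.

Hypothesis g0 : forall x, SA x -> 0 <= g x.

Lemma le_tr phi psi : (forall x, SA x -> phi x <= psi x) ->
  forall x, SA x -> L phi x <= L psi x.
Proof. by move=> h x sx; apply: le_presum => // y sy; rewrite ler_wpM2l ?g0 ?h. Qed.

Lemma le_iter_tr n phi psi : (forall x, SA x -> phi x <= psi x) ->
  forall x, SA x -> iter n L phi x <= iter n L psi x.
Proof. by elim: n => //= n IH h; apply: le_tr; exact: IH. Qed.

Lemma iter_tr_ge0 n phi : (forall x, SA x -> 0 <= phi x) ->
  forall x, SA x -> 0 <= iter n L phi x.
Proof.
elim: n => //= n IH h x sx; apply: presum_ge0 => // y sy.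
by rewrite mulr_ge0 ?g0//; exact: IH.
Qed.

(** Of all branches over the n-th shift of z only the one through z is kept; the others are
    non-negative. *)
Lemma iter_tr_ge_term n phi (c : R) z : 0 <= c -> (forall x, SA x -> c <= g x) ->
  (forall x, SA x -> 0 <= phi x) -> SA z ->
  c ^+ n * phi z <= iter n L phi (iter n shift z).
Proof.
move=> c0 cg p0 sz; elim: n => [|n IH]; first by rewrite mul1r.
have sz' : SA (iter n shift z) by exact: SA_iter_shift.
have p1 y : SA y -> 0 <= g y * iter n L phi y.
  by move=> sy; rewrite mulr_ge0 ?g0// iter_tr_ge0.
apply: le_trans (presum_ge_term p1 sz').
by rewrite exprS -mulrA ler_pM ?cg// mulr_ge0 ?exprn_ge0 ?p0.
Qed.

Lemma iter_tr_le_max n phi (C D : R) : 0 <= C -> 0 <= D -> (forall x, SA x -> g x <= C) ->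
  (forall x, SA x -> 0 <= phi x) -> (forall x, SA x -> phi x <= D) ->
  forall x, SA x -> iter n L phi x <= (K%:R * C) ^+ n * D.
Proof.
move=> C0 D0 gC p0 pD; elim: n => [|n IH] x sx; first by rewrite mul1r pD.
rewrite exprS -mulrA -(mulrA K%:R) [iter _ _ _ _]/=; apply: presum_le_max => //.
  by rewrite !mulr_ge0 ?exprn_ge0 ?mulr_ge0.
by move=> y sy; rewrite ler_pM ?g0 ?gC ?IH// iter_tr_ge0.
Qed.

End Iterates.

(** * Eigenfunction and Poisson equation of the transfer operator *)

Section Ruelle.
Context {R : realType}.
Variables (K : nat) (A : nat -> nat -> nat) (th b : R) (g : Seq -> R).
Variables (M : nat) (D : R) (x0 : Seq).
Notation SA := (Sigma_A K A).
Implicit Types (x y z : Seq) (phi psi : Seq -> R).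
Notation L := (tr K A g).
Hypothesis th01 : 0 < th < 1.
Hypothesis b0 : 0 < b.
Hypothesis g0 : forall x, SA x -> 0 < g x.
Hypothesis gb : forall k x y, SA x -> SA y -> agree k x y -> g x <= expR (b * th ^+ k) * g y.
Hypothesis M0 : (0 < M)%N.
Hypothesis conn : forall y z, SA y -> SA z ->
  exists w, [/\ SA w, w 0%N = z 0%N & iter M shift w = y].
Hypothesis Sx0 : SA x0.
Hypothesis D0 : 0 < D.
Hypothesis L1_le : forall n x, SA x -> iter n L (fun=> 1) x <= D.
Hypothesis L1_ge : forall k x, SA x -> D^-1 <= iter (k * M) L (fun=> 1) x.

(** The aperture map B -> (b + B) th of [cone_tr] has the fixed point b th / (1 - th). Twice this
    value is mapped strictly inside, with the margin B - B1 = b th. *)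
Let B := 2 * b * th / (1 - th).
Let B1 := (b + B) * th.
Let T := iter M L.

Let B0 : 0 < B.
Proof. by case/andP: th01 => h1 h2; rewrite divr_gt0 ?mulr_gt0 ?subr_gt0. Qed.

Let B10 : 0 <= B1.
Proof. by case/andP: th01 => h1 h2; rewrite mulr_ge0 ?(ltW h1)// addr_ge0 ?ltW. Qed.

Let B1B : B1 < B.
Proof.
case/andP: th01 => h1 h2; rewrite -subr_gt0.
have -> : B - B1 = b * th by rewrite /B1 /B; field; lra.
by rewrite mulr_gt0.
Qed.

Let g0' x : SA x -> 0 <= g x.
Proof. by move/g0/ltW. Qed.

Lemma cone_iter_tr n phi : cone K A th B phi -> cone K A th B (iter n L phi).
Proof.
move=> h; elim: n => //= n IH; apply: (cone_le th01 (ltW B1B)).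
exact: (cone_tr g0' gb IH).
Qed.

Lemma hol_weight : hol K A th g.
Proof.
have cg : cone K A th b g by split=> // k x y _; exact: gb.
eexists; apply: (cone_hol th01 (ltW b0) _ cg) => x sx.
by have := @gb 0 x x0 sx Sx0 (fun i h => ltac:(by [])); rewrite mulr1; exact.
Qed.

Lemma cone_trM phi : cone K A th B phi -> cone K A th B1 (T phi).
Proof.
move=> h; rewrite /T -(prednK M0) iterS; apply: (cone_tr g0' gb).
exact: cone_iter_tr.
Qed.

(** For every z some M-step preimage w of y starts with the letter of z. The cone condition compares
    phi z with phi w, and the branch through w bounds phi w by a multiple of T phi y. Hence T phi y
    controls the supremum of phi, and so T phi x. *)
Lemma trM_harnack : exists2 C0 : R, 1 <= C0 & forall phi, cone K A th B phi ->
  forall x y, SA x -> SA y -> T phi x <= C0 * T phi y.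
Proof.
have [h1 h2] := andP th01.
pose gm := expR (- b) * g x0; pose gM := expR b * g x0.
have gm0 : 0 < gm by rewrite mulr_gt0 ?expR_gt0 ?g0.
have gM0 : 0 < gM by rewrite mulr_gt0 ?expR_gt0 ?g0.
have gmP x : SA x -> gm <= g x.
  move=> sx; have := @gb 0 x0 x Sx0 sx (fun i => fun h => ltac:(by [])).
  by rewrite mulr1 /gm expRN ler_pdivrMl ?expR_gt0.
have gMP x : SA x -> g x <= gM.
  move=> sx; have := @gb 0 x x0 sx Sx0 (fun i => fun h => ltac:(by [])).
  by rewrite mulr1.
pose E := expR B / gm ^+ M.
have E0 : 0 < E by rewrite divr_gt0 ?expR_gt0 ?exprn_gt0.
exists (1 + (K%:R * gM) ^+ M * E).
  by rewrite lerDl mulr_ge0 ?(ltW E0)// exprn_ge0// mulr_ge0// ltW.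
move=> phi cp x y sx sy; have [p0 pc] := cp.
have Ty : 0 <= T phi y by apply: iter_tr_ge0.
have le z : SA z -> phi z <= E * T phi y.
  move=> sz; have [w [sw w0 wy]] := conn sy sz.
  have := iter_tr_ge_term g0' M (ltW gm0) gmP p0 sw; rewrite wy -/T => le1.
  have a1 : agree 1 z w by case.
  apply: le_trans (pc 1%N z w _ sz sw a1) _ => //.
  apply: (@le_trans _ _ (expR B * phi w)).
    by rewrite ler_wpM2r ?p0// ler_expR expr1 ler_piMr// ltW.
  rewrite /E -mulrA ler_wpM2l ?(ltW (expR_gt0 _))// mulrC ler_pdivlMr ?exprn_gt0//.
  by rewrite mulrC.
rewrite mulrDl mul1r ler_wpDl// -mulrA.
apply: (iter_tr_le_max g0' M (ltW gM0)) => //.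
by rewrite mulr_ge0// ltW.
Qed.

Lemma trM_contraction : exists2 zeta : R, 0 < zeta < 1 &
  forall phi psi al be, cone K A th B psi -> (forall k, 0 < iter k T psi x0) ->
  cone K A th B (fun x => phi x - al * psi x) ->
  cone K A th B (fun x => be * psi x - phi x) ->
  exists c, forall k, exists a b, [/\ a <= c <= b,
    b - a <= zeta ^+ k * (be - al),
    cone K A th B (fun x => iter k T phi x - a * iter k T psi x) &
    cone K A th B (fun x => b * iter k T psi x - iter k T phi x)].
Proof.
have [C0 C01 hC] := trM_harnack.
exact: (ex_cone_contraction th01 B10 B1B C01 (iter_tr_lin K A g M) cone_trM hC Sx0).
Qed.

Lemma iter_T k phi : iter k T phi = iter (k * M) L phi.
Proof. by elim: k => //= k ->; rewrite mulSn iterD. Qed.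

Lemma cone_ball phi : hol K A th phi -> exists C, [/\ 0 <= C,
   cone K A th B (fun x => phi x + C) & cone K A th B (fun x => C - phi x)].
Proof.
move=> /(hol_pos th01)[C C0 h]; exists (C + C / B); split.
- by apply: addr_ge0; [exact: ltW|apply: divr_ge0; exact: ltW].
- exact: (hol_cone th01 B0 h).
- have h' : hol_by K A th C (fun x => - phi x).
    case: h => h1 h2; split=> [x sx|k x y sx sy a]; first by rewrite normrN h1.
    by rewrite -opprD normrN h2.
  by apply: eq_cone (hol_cone th01 B0 h') => x _; rewrite addrC.
Qed.

(** The contraction is applied to T 1 against 1 and bounds [v k.+1 - c * v k] geometrically. Once c
    = 1 is known, the iterates [v k] converge, and their limit is fixed by T. *)
Lemma ex_trM_eigen : exists2 h, cone K A th B h &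
  (forall x, SA x -> D^-1 <= h x <= D) /\ forall x, SA x -> T h x = h x.
Proof.
have [zeta z01 hz] := trM_contraction; have [z0 z1] := andP z01.
have c1 : cone K A th B (fun=> 1) by apply: cone_cst => //; exact: ltW.
pose v k := iter k T (fun=> 1 : R).
have vE k x : SA x -> D^-1 <= v k x <= D by move=> sx; rewrite /v iter_T L1_ge// L1_le.
have v0 k : 0 < v k x0.
  by have /andP[+ _] := vE k _ Sx0; apply: lt_le_trans; rewrite invr_gt0.
have coA : cone K A th B (fun x => T (fun=> 1) x - 0 * 1).
  by apply: eq_cone (cone_iter_tr M c1) => x _; rewrite mul0r subr0.
have coB : cone K A th B (fun x => 2 * D * 1 - T (fun=> 1) x).
  rewrite mulr1; apply: (cone_supB th01) (cone_iter_tr M c1); last exact: ltW.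
  exact: L1_le.
have [c hc] := hz _ _ _ _ c1 v0 coA coB.
pose E := 2 * D * D.
have step k x : SA x -> `|v k.+1 x - c * v k x| <= E * zeta ^+ k.
  move=> sx; have [a' [b' [/andP[ac cb] ba [ca _] [cb' _]]]] := hc k.
  have := ca _ sx; have := cb' _ sx; rewrite -!iterSr -/(v k) -/(v k.+1).
  have /andP[vx1 vx2] := vE k _ sx.
  have vx0 : 0 <= v k x by apply: le_trans vx1; rewrite invr_ge0 ltW.
  move=> i1 i2.
  have ba0 : 0 <= b' - a' by lra.
  apply: (@le_trans _ _ ((b' - a') * v k x)).
    by rewrite ler_norml; apply/andP; split; nra.
  apply: (@le_trans _ _ ((b' - a') * D)); first by rewrite ler_wpM2l.
  by move: ba; rewrite subr0 -(ler_pM2r D0) /E => ba; apply: le_trans ba _; lra.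
have E0 : 0 <= E by rewrite !mulr_ge0// ltW.
(* [v k] would not stay between [D^-1] and [D] if the limit ratio [c] were not [1]. *)
have c1' : c = 1.
  have key n : `|c - 1| * D^-1 * n%:R <= 2 * D + E / (1 - zeta).
    have e : (c - 1) * \sum_(0 <= k < n) v k x0 =
      (v n x0 - v 0%N x0) - \sum_(0 <= k < n) (v k.+1 x0 - c * v k x0).
      rewrite -(telescope_sumr (fun k => v k x0) (leq0n n)) -sumrB mulr_sumr.
      by apply: eq_bigr => i _; ring.
    apply: (@le_trans _ _ `|(c - 1) * \sum_(0 <= k < n) v k x0|).
      rewrite normrM -mulrA ler_wpM2l//.
      apply: le_trans (ler_norm _).
      rewrite mulr_natr -[n in _ *+ n]subn0 -sumr_const_nat; apply: ler_sum => i _.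
      by have /andP[] := vE i _ Sx0.
    rewrite e (le_trans (ler_normB _ _))// lerD//.
      rewrite (le_trans (ler_normB _ _))//.
      have /andP[_ h1] := vE n _ Sx0; have /andP[_ h2] := vE 0%N _ Sx0.
      by rewrite !gtr0_norm//; lra.
    apply: le_trans (ler_norm_sum _ _ _) _; apply: le_trans (sum_geo_le z01 n E0).
    by apply: ler_sum => i _; exact: step.
  apply/eqP; rewrite -subr_eq0 -normr_eq0 eq_le normr_ge0 andbT leNgt.
  apply/negP => cpos.
  have q0 : 0 < `|c - 1| * D^-1 by rewrite mulr_gt0 ?invr_gt0.
  pose Q := (2 * D + E / (1 - zeta)) / (`|c - 1| * D^-1).
  have := key (Num.trunc Q).+1; rewrite mulrC -ler_pdivlMr// -/Q.
  by rewrite leNgt truncnS_gt.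
have cv x : SA x -> v k x @[k --> \oo] --> limn (fun k => v k x).
  move=> sx; apply: (cvgn_geo_step (E := E) z01) => k.
  by have := step k x sx; rewrite c1' mul1r.
exists (fun x => limn (fun k => v k x)).
  by apply: cone_cvg cv => n; rewrite /v iter_T; exact: cone_iter_tr.
split=> x sx.
  apply/andP; split.
    by apply: (cvgr_to_ge (cv x sx)); apply: nearW => n; case/andP: (vE n x sx).
  by apply: (cvgr_to_le (cv x sx)); apply: nearW => n; case/andP: (vE n x sx).
have t1 := cvg_iter_tr (g := g) (n := M) cv sx.
have t2 : v k.+1 x @[k --> \oo] --> limn (fun k => v k x).
  by have := cv x sx; rewrite -(cvg_shiftS (fun k => v k x)).
exact: (cvg_unique _ t1 t2).
Qed.

(** Being its own image, h lies in the narrower cone, so h - s stays in the cone for a small s > 0.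
    The multiple C/s of h - s then supplies, up to C/s times h, the constant that phi lacks. *)
Lemma eigen_dominates h phi : (forall x, SA x -> D^-1 <= h x) ->
  cone K A th B h -> (forall x, SA x -> T h x = h x) -> hol K A th phi ->
  exists be, cone K A th B (fun x => phi x - (- be) * h x) /\
             cone K A th B (fun x => be * h x - phi x).
Proof.
move=> hD ch Th /cone_ball[C [C0 c1 c2]].
have ch1 : cone K A th B1 h by exact: eq_cone Th (cone_trM ch).
pose s := (B - B1) / (B * expR B) * D^-1.
have q0 : 0 < (B - B1) / (B * expR B).
  apply: divr_gt0; first by rewrite subr_gt0.
  by apply: mulr_gt0 => //; exact: expR_gt0.
have s0 : 0 < s by rewrite /s mulr_gt0// invr_gt0.
have chs : cone K A th B (fun x => h x - s).
  apply: (cone_subB th01 B10 B1B (ltW s0) _ ch1) => x sx.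
  by rewrite /s ler_wpM2l ?hD// ltW.
have Cs : 0 <= C / s by rewrite divr_ge0// ltW.
exists (C / s); split.
  by apply: eq_cone (coneD (coneZ Cs chs) c1) => x _; field; rewrite gt_eqF.
by apply: eq_cone (coneD (coneZ Cs chs) c2) => x _; field; rewrite gt_eqF.
Qed.

(** L commutes with T, so L h is also fixed by T. Contraction of L h against h moves neither
    function and forces L h = c h; then c^M = 1 with c >= 0. *)
Lemma ex_eigen : exists2 h, cone K A th B h &
  (forall x, SA x -> D^-1 <= h x <= D) /\ forall x, SA x -> L h x = h x.
Proof.
have [h ch [hD Th]] := ex_trM_eigen.
have hD1 x : SA x -> D^-1 <= h x by move/hD => /andP[].
have h0 x : SA x -> 0 < h x by move/hD1; apply: lt_le_trans; rewrite invr_gt0.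
have [zeta z01 hz] := trM_contraction; have [z0 z1] := andP z01.
have iT k phi x : (forall y, SA y -> T phi y = phi y) -> SA x -> iter k T phi x = phi x.
  move=> Tp; elim: k x => //= k IH x sx; rewrite -[RHS]Tp//.
  by rewrite /T; apply: eq_iter_tr.
have TL phi x : T (L phi) x = L (T phi) x by rewrite /T -iterSr.
have TLh x : SA x -> T (L h) x = L h x by move=> sx; rewrite TL; apply: eq_tr.
have cLh : cone K A th B (L h) by exact: (cone_iter_tr 1).
have LhD x : SA x -> L h x <= D * D.
  move=> sx; apply: (@le_trans _ _ (D * L (fun=> 1) x)).
    rewrite /tr -presumZ; apply: le_presum => // y sy; rewrite mulr1 mulrC.
    by rewrite ler_wpM2r ?g0'//; case/andP: (hD y sy).
  by rewrite ler_wpM2l ?(ltW D0)//; exact: (L1_le 1 sx).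
have hLh : hol K A th (L h) by eexists; apply: (cone_hol th01 (ltW B0) LhD).
have [be [c1 c2]] := eigen_dominates hD1 ch Th hLh.
have v0 k : 0 < iter k T h x0 by rewrite iT// h0.
have [c hc] := hz _ _ _ _ ch v0 c1 c2.
have Lh x : SA x -> L h x = c * h x.
  move=> sx; apply/eqP; rewrite -subr_eq0 -normr_le0.
  apply: (geo_le0 (E := (be - (- be)) * h x) z01) => k.
  have [a' [b' [/andP[ac cb] ba [ca _] [cb' _]]]] := hc k.
  have := ca _ sx; have := cb' _ sx; rewrite !iT// => i1 i2.
  have hx := h0 _ sx.
  apply: (@le_trans _ _ ((b' - a') * h x)).
    by rewrite ler_norml; apply/andP; split; nra.
  by rewrite mulrAC ler_wpM2r ?(ltW hx)// mulrC.
have iL k x : SA x -> iter k L h x = c ^+ k * h x.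
  elim: k x => [|k IH] x sx; first by rewrite mul1r.
  rewrite iterS exprSr -mulrA -Lh//.
  have -> : L (iter k L h) x = L (fun x => c ^+ k * h x) x by exact: eq_tr.
  rewrite /tr -presumZ.
  by apply: eq_presum => // y sy; ring.
have c0 : 0 <= c.
  have := h0 _ Sx0 => hx; rewrite -(pmulr_lge0 _ hx) -Lh//.
  by case: cLh => + _; exact.
have c1' : c = 1.
  apply/eqP; rewrite -(pexpr_eq1 M0 c0); apply/eqP.
  by apply: (mulIf (lt0r_neq0 (h0 _ Sx0))); rewrite -iL// mul1r -[RHS]Th.
by exists h => //; split=> // x sx; rewrite Lh// c1' mul1r.
Qed.

(** The contraction makes T^k phi - c h decay geometrically in the norm of [hol_by]: both pieces T^k
    phi - a' h and (c - a') h are of the order of b' - a'. Summing over k inverts 1 - T on phi - c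
    h. *)
Lemma poisson_transfer : exists h, [/\ hol K A th h,
  forall x, SA x -> D^-1 <= h x <= D, forall x, SA x -> L h x = h x &
  forall phi, hol K A th phi -> exists c a, hol K A th a /\
    forall x, SA x -> phi x = c * h x + a x - L a x].
Proof.
have [h ch [hD Lh]] := ex_eigen.
have hD1 x : SA x -> D^-1 <= h x by move/hD => /andP[].
have hD2 x : SA x -> h x <= D by move/hD => /andP[].
have h0 x : SA x -> 0 < h x by move/hD1; apply: lt_le_trans; rewrite invr_gt0.
have [zeta z01 hz] := trM_contraction; have [z0 z1] := andP z01.
have iL k x : SA x -> iter k L h x = h x.
  elim: k x => //= k IH x sx; rewrite -[RHS]Lh//.
  exact: eq_tr.
have iT k x : SA x -> iter k T h x = h x by rewrite iter_T; exact: iL.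
have Th x : SA x -> T h x = h x by exact: iL.
have hh := cone_hol th01 (ltW B0) hD2 ch.
exists h; split=> //; first by eexists; exact: hh.
move=> phi hp.
have [be [c1 c2]] := eigen_dominates hD1 ch Th hp.
have v0 k : 0 < iter k T h x0 by rewrite iT// h0.
have [c hc] := hz _ _ _ _ ch v0 c1 c2.
pose Dh := (1 + B * expR B) * D.
have Dh0 : 0 <= Dh.
  by rewrite mulr_ge0 ?(ltW D0)// addr_ge0// mulr_ge0 ?(ltW B0)// ltW ?expR_gt0.
pose d k x := iter k T phi x - c * h x.
have dH k : hol_by K A th (2 * Dh * (be - - be) * zeta ^+ k) (d k).
  have [a' [b' [/andP[ac cb] ba ca [cb' _]]]] := hc k.
  have ca' : cone K A th B (fun x => iter k T phi x - a' * h x).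
    by apply: eq_cone ca => x sx; rewrite iT.
  have le1 x : SA x -> iter k T phi x - a' * h x <= (b' - a') * D.
    move=> sx; apply: (@le_trans _ _ ((b' - a') * h x)); last first.
      by rewrite ler_wpM2l ?hD2//; lra.
    by have := cb' _ sx; rewrite iT//; lra.
  have [e1 e2] := cone_hol th01 (ltW B0) le1 ca'.
  have [f1 f2] := hh.
  have dE x : d k x = (iter k T phi x - a' * h x) - (c - a') * h x by rewrite /d; ring.
  have ba0 : b' - a' <= (be - - be) * zeta ^+ k by rewrite mulrC.
  have le2 : (1 + B * expR B) * ((b' - a') * D) + (c - a') * Dh <=
      2 * Dh * (be - - be) * zeta ^+ k.
    have -> : (1 + B * expR B) * ((b' - a') * D) = (b' - a') * Dh by rewrite /Dh; ring.
    have i1 : (c - a') * Dh <= (b' - a') * Dh by rewrite ler_wpM2r//; lra.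
    have i2 : (b' - a') * Dh <= (be - - be) * zeta ^+ k * Dh by rewrite ler_wpM2r.
    by apply: (le_trans (lerD (lexx _) i1)); apply: (le_trans (lerD i2 i2)); lra.
  apply: (hol_by_le th01 le2); split=> [x sx|n x y sx sy axy].
    rewrite dE (le_trans (ler_normB _ _))// lerD ?e1// normrM ger0_norm ?subr_ge0//.
    by rewrite ler_wpM2l ?subr_ge0// f1.
  have -> : d k x - d k y = ((iter k T phi x - a' * h x) - (iter k T phi y - a' * h y)) -
     (c - a') * (h x - h y) by rewrite !dE; ring.
  rewrite [leRHS]mulrDl (le_trans (ler_normB _ _))// lerD ?e2// normrM ger0_norm ?subr_ge0//.
  by rewrite -mulrA ler_wpM2l ?subr_ge0// f2.
have be0 : 0 <= be.
  have := proj1 c1 _ Sx0; have := proj1 c2 _ Sx0; have := h0 _ Sx0 => hx i1 i2.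
  have : 0 <= be * h x0 by lra.
  by rewrite pmulr_lge0.
have E0 : 0 <= 2 * Dh * (be - - be) by rewrite opprK; apply: mulr_ge0; [exact: mulr_ge0|exact: addr_ge0].
have [aT [haT aTc]] := hol_geo_sum z01 E0 th01 dH.
have TaT x : SA x -> aT x - T aT x = phi x - c * h x.
  move=> sx.
  have t1 := cvg_iter_tr (g := g) (n := M) aTc sx.
  have t2 : \sum_(0 <= k < n.+1) d k x @[n --> \oo] --> aT x.
    by have := aTc x sx; rewrite -(cvg_shiftS (fun n => \sum_(0 <= k < n) d k x)).
  have Td k : iter M L (d k) x = d k.+1 x.
    have -> : d k = (fun x => iter k T phi x + (- c) * h x).
      by apply/funext => y; rewrite /d mulNr.
    by rewrite iter_tr_lin -/T Th// mulNr.
  have e n : \sum_(0 <= k < n.+1) d k x -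
      iter M L (fun x => \sum_(0 <= k < n) d k x) x = d 0%N x.
    rewrite iter_tr_sum big_nat_recl//; under [X in _ - X]eq_bigr do rewrite Td.
    by rewrite addrK.
  have t3 : (fun=> d 0%N x) n @[n --> \oo] --> aT x - T aT x.
    rewrite (_ : (fun=> d 0%N x) = (fun n => \sum_(0 <= k < n.+1) d k x -
      iter M L (fun x => \sum_(0 <= k < n) d k x) x)); first exact: cvgB.
    by apply/funext => n; rewrite e.
  exact: (cvg_unique _ t3 (cvg_cst _)).
(* The sum of L^j over j < M turns a solution for T = L^M into one for L, because (1 - L) times this
   sum is 1 - T. *)
exists c, (fun x => \sum_(0 <= j < M) iter j L aT x); split.
  apply: (hol_sum th01) => j _; apply: (hol_iter_tr th01) => //.
  exact: hol_weight.
move=> x sx.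
have -> : L (fun x => \sum_(0 <= j < M) iter j L aT x) x =
    \sum_(0 <= j < M) iter j.+1 L aT x.
  exact: (iter_tr_sum K A g 1).
rewrite -addrA -sumrB.
under eq_bigr do rewrite -opprB.
rewrite sumrN (telescope_sumr (fun j => iter j L aT x))// -/T /= opprB TaT//; ring.
Qed.

End Ruelle.

(** * Measurable sets and cylinders *)

Section RealProbability.
Context {d : measure_display} {T : measurableType d} {R : realType}.
Variable P : probability T R.

Definition pr (B : set T) : R := fine (P B).

Lemma prE B : measurable B -> P B = (pr B)%:E.
Proof. by move=> mB; rewrite fineK// fin_num_measure. Qed.

Lemma pr_ge0 B : 0 <= pr B.
Proof. by rewrite fine_ge0// measure_ge0. Qed.

Lemma pr_le1 B : measurable B -> pr B <= 1.
Proof. by move=> mB; rewrite -lee_fin -prE// probability_le1. Qed.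

Lemma le_pr B C : measurable B -> measurable C -> B `<=` C -> pr B <= pr C.
Proof. by move=> mB mC BC; rewrite -lee_fin -!prE// le_measure ?inE. Qed.

Lemma prID B C : measurable B -> measurable C -> pr B = pr (B `&` C) + pr (B `\` C).
Proof.
move=> mB mC; apply: EFin_inj; rewrite EFinD -!prE//.
- by rewrite addeC -measureDI.
- exact: measurableD.
- exact: measurableI.
Qed.

Lemma pr_le_sum (I : eqType) (s : seq I) (F : I -> set T) B : measurable B ->
  (forall i, measurable (F i)) -> (forall x, B x -> exists2 i, i \in s & F i x) ->
  pr B <= \sum_(i <- s) pr (F i).
Proof.
elim: s B => [|i s IH] B mB mF BF.
  rewrite big_nil; have -> : B = set0.
    by rewrite -subset0 => x /BF[].
  by rewrite /pr measure0.
rewrite big_cons (prID mB (mF i)) lerD//.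
  by apply: le_pr; [exact: measurableI|exact: mF|move=> x []].
apply: IH => //; first exact: measurableD.
by move=> x [/BF[j]]; rewrite inE => /orP[/eqP->//|js] Fj _; exists j.
Qed.

Lemma sum_pr_le (I : eqType) (s : seq I) (F : I -> set T) B : measurable B ->
  (forall i, measurable (F i)) -> uniq s -> (forall i, F i `<=` B) ->
  (forall i j x, F i x -> F j x -> i = j) ->
  \sum_(i <- s) pr (F i) <= pr B.
Proof.
elim: s B F => [|i s IH] B F mB mF; first by rewrite big_nil pr_ge0.
rewrite cons_uniq => /andP[/negP si us] FB tF; rewrite big_cons (prID mB (mF i)) lerD//.
  by apply: le_pr; [exact: mF|exact: measurableI|move=> x Fx; split => //; exact: FB Fx].
rewrite big_seq_cond; apply: (@le_trans _ _ (\sum_(j <- s) pr (F j `\` F i))).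
  rewrite [leRHS]big_seq_cond; apply: ler_sum => j /andP[js _].
  apply: le_pr; [exact: mF|exact: measurableD|move=> x Fj; split=> // Fi].
  by apply: si; rewrite (tF _ _ _ Fi Fj).
apply: IH => //; first exact: measurableD.
- by move=> j; apply: measurableD.
- by move=> j x [Fj nFi]; split=> //; exact: FB Fj.
- by move=> j k x [Fj _] [Fk _]; exact: tF Fj Fk.
Qed.

End RealProbability.

Section Measurability.
Variables (K : nat) (A : nat -> nat -> nat).
Notation SA := (Sigma_A K A : set SeqSpace).
Implicit Types (x y : Seq).

Lemma measurable_agree n (w : Seq) : measurable ([set x | agree n x w] : set SeqSpace).
Proof. by apply: sub_sigma_algebra; exists n, w. Qed.

(** Cylinders are coded by finite words, a countable type, and an open set is the union of the
    cylinders it contains. *)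
Lemma measurable_open (U : set SeqSpace) :
  (forall x, U x -> exists n, forall y, agree n y x -> U y) -> measurable U.
Proof.
move=> oU.
pose cyl (s : seq nat) : set SeqSpace := [set x | agree (size s) x (nth 0%N s)].
pose F (s : seq nat) := if pselect (cyl s `<=` U) then cyl s else set0.
have -> : U = \bigcup_s F s.
  apply/seteqP; split=> [x Ux|x [s _]]; last first.
    by rewrite /F; case: pselect => // sU /sU.
  have [n hn] := oU x Ux; exists (mkseq x n) => //.
  have e y : agree (size (mkseq x n)) y (nth 0%N (mkseq x n)) <-> agree n y x.
    rewrite size_mkseq; split=> h i ni; first by rewrite h// nth_mkseq.
    by rewrite h// nth_mkseq.
  rewrite /F; case: pselect => [sU|[]]; first exact/e.
  by move=> y /e /hn.
apply: countable_bigcupT_measurable => [|s]; first exact: countableP.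
by rewrite /F; case: pselect => [sU|nsU]; [exact: measurable_agree|exact: measurable0].
Qed.

Lemma measurable_SA : measurable SA.
Proof.
rewrite -[SA]setCK; apply: measurableC; apply: measurable_open => x nx.
have [[n hn]|h1] := pselect (exists n, ~ (1 <= x n <= K)%N).
  by exists n.+1 => y yx [h _]; apply: hn; rewrite -yx.
have [[n hn]|h2] := pselect (exists n, A (x n) (x n.+1) != 1%N).
  exists n.+2 => y yx [_ h]; move/negP: hn; apply; apply/eqP.
  by rewrite -!yx.
exfalso; apply: nx; split=> n.
  by apply/negPn/negP => hn; apply: h1; exists n; exact/negP.
by apply/eqP/negPn/negP => hn; apply: h2; exists n.
Qed.

(** [V] collects the points having a cylinder whose trace on the subshift lies in U. It is open in
    the full space and cuts out U there. *)
Lemma measurable_relopen (U : set SeqSpace) : U `<=` SA ->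
  (forall x, U x -> exists n, forall y, SA y -> agree n y x -> U y) -> measurable U.
Proof.
move=> US oU.
pose V : set SeqSpace := [set x | exists n, forall y, SA y -> agree n y x -> U y].
have -> : U = SA `&` V.
  apply/seteqP; split=> [x Ux|x [sx [n hn]]]; first by split; [exact: US|exact: oU].
  exact: hn.
apply: measurableI; first exact: measurable_SA.
apply: measurable_open => x [n hn]; exists n => z zx; exists n => y sy yz.
by apply: hn => //; exact: agree_trans zx.
Qed.

Lemma measurable_loccst (p : Seq -> Prop) n :
  (forall x y, SA x -> SA y -> agree n y x -> p x -> p y) ->
  measurable ([set x | SA x /\ p x] : set SeqSpace).
Proof.
move=> h; apply: measurable_relopen => [x []//|x [sx px]].
by exists n => y sy yx; split=> //; exact: h px.
Qed.

Lemma measurable_cylx x n : measurable (cylx K A x n : set SeqSpace).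
Proof.
apply: (@measurable_loccst (fun y => forall k, (k < n)%N -> y k = x k) n).
by move=> y z sy sz yz h k kn; rewrite yz// h.
Qed.

Lemma measurable_cylw n (w : n.-tuple 'I_K) : measurable (cylw K A n w : set SeqSpace).
Proof.
apply: (@measurable_loccst (fun y => forall k, (k < n)%N ->
  y k = nth 0%N (word_seq K n w) k) n).
by move=> y z sy sz yz h k kn; rewrite yz// h.
Qed.

End Measurability.

(** * Words and iterates of the operator *)

Section Words.
Context {R : realType}.
Variables (K : nat) (A : nat -> nat -> nat).
Notation SA := (Sigma_A K A).
Implicit Types (x y z : Seq) (phi psi g : Seq -> R).

Definition wcat n (w : n.-tuple 'I_K) x : Seq :=
  fun i => if (i < n)%N then nth 0%N (word_seq K n w) i else x (i - n)%N.

Lemma wcat_nil (w : 0.-tuple 'I_K) x : wcat w x = x.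
Proof. by apply/funext => i; rewrite /wcat ltn0 subn0. Qed.

Lemma wcat_cons n a (w : n.-tuple 'I_K) x :
  wcat (cons_tuple a w) x = scons a.+1 (wcat w x).
Proof. by apply/funext => -[|i] //; rewrite /wcat /= ltnS subSS. Qed.

Lemma SA_scons_inv a x : SA (scons a.+1 x) -> SA x /\ A a.+1 (x 0%N) = 1%N.
Proof. by move=> s; split; [exact: (SA_shift s)|case: s => _ /(_ 0%N)]. Qed.

Definition gprod g n y : R := \prod_(k < n) g (iter k shift y).

Lemma gprodS g n y : gprod g n.+1 y = g y * gprod g n (shift y).
Proof.
rewrite /gprod big_ord_recl /=; congr (_ * _); apply: eq_bigr => i _.
by rewrite -iterSr.
Qed.

Lemma iter_trE g n phi x : SA x -> iter n (tr K A g) phi x =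
  \sum_(w : n.-tuple 'I_K | `[< SA (wcat w x) >])
     gprod g n (wcat w x) * phi (wcat w x).
Proof.
elim: n phi => [|n IH] phi sx.
  rewrite (big_pred1 [tuple]) => [|w]; first by rewrite wcat_nil /gprod big_ord0 mul1r.
  by rewrite wcat_nil asboolT//; apply/esym/eqP; exact: tuple0.
rewrite iterSr IH// /tr /presum.
under eq_bigr do rewrite mulr_sumr.
rewrite pair_big_dep/=.
rewrite [RHS](reindex (fun p : n.-tuple 'I_K * 'I_K => cons_tuple p.2 p.1)); last first.
  exists (fun t => (behead_tuple t, thead t)) => [[w a] _|t _] /=.
    by congr pair; exact/val_inj.
  by rewrite [RHS]tuple_eta; exact/val_inj.
apply: eq_big => [[w a]|[w a] _] /=; rewrite wcat_cons.
  apply/andP/asboolP => [[/asboolP s /eqP h]|/SA_scons_inv[s h]].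
    by apply: SA_scons => //; exact/eqP.
  by split; [exact/asboolP|exact/eqP].
by rewrite gprodS mulrA [gprod _ _ _ * g _]mulrC.
Qed.

Lemma ex_word n y : SA y -> exists w : n.-tuple 'I_K,
  forall k, (k < n)%N -> y k = nth 0%N (word_seq K n w) k.
Proof.
move=> [sy _].
have yK k : ((y k).-1 < K)%N by have /andP[] := sy k; case: (y k).
exists (mktuple (fun k : 'I_n => Ordinal (yK k))) => k kn.
rewrite /word_seq (nth_map (Ordinal (yK 0%N))) ?size_tuple//.
rewrite -(tnth_nth _ _ (Ordinal kn)) tnth_mktuple /=.
by have /andP[] := sy k; case: (y k).
Qed.

Lemma cylw_wcat n (w : n.-tuple 'I_K) x : cylw K A n w = cylx K A (wcat w x) n.
Proof.
apply/seteqP; split=> y [sy h]; split=> // k kn.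
  by rewrite h// /wcat kn.
by rewrite h// /wcat kn.
Qed.

Lemma cylw_disjoint n (w w' : n.-tuple 'I_K) x :
  cylw K A n w x -> cylw K A n w' x -> w = w'.
Proof.
move=> [_ h] [_ h']; apply/val_inj.
have S_inj : injective (fun a : 'I_K => (nat_of_ord a).+1).
  by move=> a b [] /val_inj.
apply: (inj_map S_inj); apply: (@eq_from_nth _ 0%N); first by rewrite !size_map !size_tuple.
by move=> i; rewrite size_map size_tuple => ni; rewrite -[LHS]h// -[RHS]h'.
Qed.

End Words.

(** * Comparison of the Gibbs measure with the iterated operator *)

Section Gibbs.
Context {R : realType}.
Variables (K : nat) (A : nat -> nat -> nat) (f : Seq -> R) (P C : R).
Variable mu : probability SeqSpace R.
Notation SA := (Sigma_A K A).
Implicit Types (x y z : Seq) (phi psi : Seq -> R).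
Hypothesis muSA : mu SA = 1%E.
Hypothesis C1 : 1 < C.
Hypothesis gibbs : forall x n, SA x -> (0 < n)%N ->
  C^-1 <= mu_real mu (cylx K A x n) / expR (- n%:R * P + birkhoff f n x) <= C.
Hypothesis letters : forall c : 'I_K, exists2 z, SA z & z 0%N = c.+1.

(** Subtracting the pressure makes [gprod weight n] the comparison term of the Gibbs property. *)
Definition weight x := expR (f x - P).
Notation L := (tr K A weight).

Lemma gprod_weight n x : gprod weight n x = expR (- n%:R * P + birkhoff f n x).
Proof.
rewrite /gprod /weight -expR_sum sumrB sumr_const card_ord -[P *+ n]mulr_natl.
by congr expR; rewrite /birkhoff; ring.
Qed.

Let C0 : 0 < C.
Proof. exact: lt_trans ltr01 C1. Qed.

Lemma pr_SA : pr mu SA = 1.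
Proof. by rewrite /pr muSA. Qed.

Lemma gibbs_cylx n x : SA x ->
  pr mu (cylx K A x n) <= C * gprod weight n x /\
  gprod weight n x <= C * pr mu (cylx K A x n).
Proof.
move=> sx; case: n => [|n].
  have -> : cylx K A x 0 = SA by apply/seteqP; split=> [y []|y sy].
  by rewrite pr_SA /gprod big_ord0 mulr1; split; exact: ltW.
have := gibbs sx (ltn0Sn n); rewrite -gprod_weight.
have g0 : 0 < gprod weight n.+1 x by rewrite gprod_weight expR_gt0.
rewrite -/(pr mu (cylx K A x n.+1)) ler_pdivrMr// ler_pdivlMr// => /andP[h1 h2].
by split=> //; rewrite -ler_pdivrMl.
Qed.

Lemma sum_cylw_le1 n : \sum_(w : n.-tuple 'I_K) pr mu (cylw K A n w) <= 1.
Proof.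
rewrite -pr_SA; apply: (@sum_pr_le _ _ _ mu _ _ (fun w => cylw K A n w) (Sigma_A K A)).
- exact: measurable_SA.
- exact: measurable_cylw.
- exact: index_enum_uniq.
- by move=> w x [].
- by move=> w w' x; exact: cylw_disjoint.
Qed.

Lemma transfer_one_le n x : SA x -> iter n L (fun=> 1) x <= C.
Proof.
move=> sx; rewrite iter_trE// -[leRHS]mulr1.
apply: le_trans (ler_wpM2l (ltW C0) (sum_cylw_le1 n)).
rewrite mulr_sumr big_mkcond; apply: ler_sum => w _.
case: ifPn => [/asboolP sw|_]; last by rewrite mulr_ge0 ?pr_ge0// ltW.
by rewrite mulr1 (cylw_wcat A w x); case: (gibbs_cylx n sw).
Qed.

(* If [Phi >= 1] on every point sharing its first [n] letters with a point of [B],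
   the operator [L^n] counts, with weights comparable to the measure, the cylinders
   that meet [B]. *)
Lemma pr_le_transfer n Phi q B : measurable (B : set SeqSpace) -> B `<=` SA ->
  (forall x, SA x -> 0 <= Phi x) ->
  (forall x y, B y -> SA x -> agree n x y -> 1 <= Phi x) ->
  (forall x, SA x -> iter n L Phi x <= q) -> pr mu B <= C * K%:R * q.
Proof.
move=> mB BS Phi0 BPhi Lq.
have [zz hz] : {zz : 'I_K -> Seq & forall c, SA (zz c) /\ zz c 0%N = c.+1}.
  apply: (@choice _ _ (fun (c : 'I_K) z => SA z /\ z 0%N = c.+1)) => c.
  by have [z] := letters c; exists z.
pose W := [seq w <- index_enum (n.-tuple 'I_K) | `[< exists y, B y /\ cylw K A n w y >]].
apply: (@le_trans _ _ (\sum_(w <- W) pr mu (cylw K A n w))).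
  apply: pr_le_sum => // [w|y By]; first exact: measurable_cylw.
  have [w hw] := ex_word n (BS _ By).
  have yw : cylw K A n w y by split; [exact: BS|].
  exists w => //; rewrite mem_filter mem_index_enum andbT.
  by apply/asboolP; exists y.
(* A word w met by B at y is continued by the representative of the letter [y n], admissible after w
   because y is. That letter varies with y, so the sum runs over all K letters; this is the origin
   of the factor K. *)
pose t (w : n.-tuple 'I_K) (c : 'I_K) := if `[< SA (wcat w (zz c)) >] then
  C * (gprod weight n (wcat w (zz c)) * Phi (wcat w (zz c))) else 0.
have t0 w c : 0 <= t w c.
  rewrite /t; case: ifPn => // /asboolP sw.
  by rewrite !mulr_ge0 ?Phi0 ?(ltW C0)// gprod_weight expR_ge0.
apply: (@le_trans _ _ (\sum_(w <- W) \sum_c t w c)).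
  rewrite big_seq [leRHS]big_seq; apply: ler_sum => w.
  rewrite mem_filter => /andP[/asboolP[y [By yw]] _].
  have sy := BS _ By; have [sy1 sy2] := sy.
  have yK : ((y n).-1 < K)%N by have /andP[] := sy1 n; case: (y n).
  pose c := Ordinal yK.
  have cE : c.+1 = y n by rewrite /c/=; have /andP[] := sy1 n; case: (y n).
  have [sz z0] := hz c.
  have wy i : (i < n)%N -> wcat w (zz c) i = y i.
    by move=> ni; rewrite /wcat ni; case: yw => _ ->.
  have wn i : (n <= i)%N -> wcat w (zz c) i = zz c (i - n)%N.
    by move=> ni; rewrite /wcat [(i < n)%N]ltnNge ni.
  have sw : SA (wcat w (zz c)).
    split=> i.
      have [ni|ni] := ltnP i n; first by rewrite wy.
      by rewrite wn//; case: sz.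
    have [ni|] := ltnP i.+1 n; first by rewrite !wy// ltnW.
    rewrite leq_eqVlt => /orP[/eqP e|ni].
      by rewrite wy -?e// wn -?e// subnn z0 cE -[RHS](sy2 i) -e.
    by rewrite !wn// ?(ltnW ni)// subSn//; case: sz.
  rewrite (bigD1 c)//= ler_wpDr ?sumr_ge0// /t asboolT//.
  rewrite (cylw_wcat A w (zz c)); have [h _] := gibbs_cylx n sw.
  apply: le_trans h _; rewrite ler_wpM2l ?(ltW C0)// ler_peMr//.
    by rewrite gprod_weight expR_ge0.
  exact: (BPhi _ y).
apply: (@le_trans _ _ (\sum_(w : n.-tuple 'I_K) \sum_c t w c)).
  rewrite big_filter [leLHS]big_mkcond; apply: ler_sum => w _.
  by case: ifP => // _; exact: sumr_ge0.
rewrite exchange_big /= -mulrA [K%:R * _]mulrC mulrA mulr_natr -[X in _ *+ X](card_ord K) -sumr_const.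
apply: ler_sum => c _; rewrite -big_mkcond -mulr_sumr ler_wpM2l ?(ltW C0)//.
have [sz _] := hz c.
by rewrite -iter_trE// Lq.
Qed.

End Gibbs.

(** * Admissible paths from positive matrix entries *)

Section Primitive.
Variables (K : nat) (A : nat -> nat -> nat).
Notation SA := (Sigma_A K A).
Implicit Types (x y z : Seq).
Hypothesis A01 : forall a b, (1 <= a <= K)%N -> (1 <= b <= K)%N ->
  A a b = 0%N \/ A a b = 1%N.

Lemma mxpow_path m a b y : (1 <= a <= K)%N -> (0 < mxpow K A m a b)%N ->
  SA y -> y 0%N = b -> exists w, [/\ SA w, w 0%N = a & iter m shift w = y].
Proof.
elim: m a => [|m IH] a aK /=.
  by case: eqP => // -> _ sy yb; exists y.
move=> h sy yb.
have [c] : exists c : nat, (1 <= c <= K)%N /\ (0 < A a c * mxpow K A m c b)%N.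
  apply: contrapT => nc; move: h.
  rewrite big_nat_cond big1 // => c; rewrite andbT => /andP[c1 cK].
  apply/eqP; rewrite -leqn0 leqNgt; apply/negP => c0.
  by apply: nc; exists c; split=> //; rewrite c1.
rewrite muln_gt0 => -[cK /andP[ac mc]].
have [w [sw w0 wy]] := IH c cK mc sy yb.
have ac1 : A a c = 1%N by case: (A01 aK cK) ac => ->.
have aE : a.-1.+1 = a by case/andP: aK; case: (a).
have aK' : (a.-1 < K)%N by rewrite aE; case/andP: aK.
exists (scons a.-1.+1 w); split.
- by apply: SA_scons => //; rewrite aE w0 ac1.
- by rewrite aE.
- by rewrite -iterS iterSr -wy.
Qed.

End Primitive.

(** * The normalised operator and Gordin's decomposition *)

Section Normalised.
Context {R : realType}.
Variables (K : nat) (A : nat -> nat -> nat) (f : Seq -> R) (b th P C : R).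
Variable mu : probability SeqSpace R.
Notation SA := (Sigma_A K A).
Implicit Types (x y z : Seq) (phi psi : Seq -> R).
Hypothesis K2 : (2 <= K)%N.
Hypothesis primA : primitive01 K A.
Hypothesis b0 : 0 < b.
Hypothesis th01 : 0 < th < 1.
Hypothesis fhol : forall x y, SA x -> SA y -> `|f x - f y| <= b * apow th (wedge x y).
Hypothesis muSA : mu SA = 1%E.
Hypothesis C1 : 1 < C.
Hypothesis gibbs : forall x n, SA x -> (0 < n)%N ->
  C^-1 <= mu_real mu (cylx K A x n) / expR (- n%:R * P + birkhoff f n x) <= C.

Lemma apow_wedge_le k x y : agree k x y -> apow th (wedge x y) <= th ^+ k.
Proof.
case/andP: th01 => t0 t1 a; rewrite /wedge; case: pselect => [H|_] /=.
  case: ex_minnP => m xm _.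
  apply: ler_wiXn2l; [exact: ltW|exact: ltW|].
  by rewrite leqNgt; apply/negP => mk; move: xm; rewrite a// eqxx.
by rewrite exprn_ge0// ltW.
Qed.

Lemma holder_agree k x y : SA x -> SA y -> agree k x y -> `|f x - f y| <= b * th ^+ k.
Proof.
move=> sx sy a; apply: le_trans (fhol sx sy) _.
by rewrite ler_wpM2l ?(ltW b0)// apow_wedge_le.
Qed.

Lemma SA_nonempty : exists x, SA x.
Proof.
apply: contrapT => ne; have e : SA = set0 by rewrite -subset0 => x sx; apply: ne; exists x.
by move: muSA; rewrite e measure0 => /eqP; rewrite eq_sym onee_eq0.
Qed.

Lemma primitive_conn : exists M, (0 < M)%N /\ forall a y, (1 <= a <= K)%N -> SA y ->
  exists w, [/\ SA w, w 0%N = a & iter M shift w = y].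
Proof.
have [A01 [M hM]] := primA; exists M; split.
  (* The zeroth power is the identity, whose entry (1, 2) vanishes; K >= 2 makes this entry
     available. *)
  rewrite lt0n; apply/eqP => M0; have := hM 1%N 2%N; rewrite M0 /=.
  by rewrite (ltnW K2) K2 => /(_ isT isT).
move=> a y aK sy; have [sy1 _] := sy.
exact: (mxpow_path A01 aK (hM _ _ aK (sy1 0%N)) sy).
Qed.

Lemma letters_SA (c : 'I_K) : exists2 z, SA z & z 0%N = c.+1.
Proof.
have [x0 sx0] := SA_nonempty; have [M [_ hM]] := primitive_conn.
have [|w [sw w0 _]] := hM c.+1 x0 _ sx0; first by rewrite ltn_ord.
by exists w.
Qed.

Notation g := (weight f P).
Notation L := (tr K A g).

Let C0 : 0 < C. Proof. exact: lt_trans ltr01 C1. Qed.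

(** Collects what the probabilistic estimates need to know about the operator. As the eigenfunction
    is bounded above and away from zero, conjugating by it changes the comparison with [mu] by a
    constant only. *)
Lemma ex_normalised : exists (G : Seq -> R) (C' : R), 0 < C' /\
  [/\ forall x, SA x -> 0 < G x,
      forall x, SA x -> tr K A G (fun=> 1) x = 1,
      forall phi, hol K A th phi -> exists c m u, [/\ hol K A th m, hol K A th u,
        forall x, SA x -> phi x = c + m x + u (shift x) - u x &
        forall x, SA x -> tr K A G m x = 0] &
      forall n Phi q (B : set SeqSpace), measurable B -> B `<=` SA ->
        (forall x, SA x -> 0 <= Phi x) ->
        (forall x y, B y -> SA x -> agree n x y -> 1 <= Phi x) ->
        (forall x, SA x -> iter n (tr K A G) Phi x <= q) -> pr mu B <= C' * q].
Proof.
have [x0 sx0] := SA_nonempty; have [M [M0 hM]] := primitive_conn.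
have g0 x : SA x -> 0 < g x by move=> _; exact: expR_gt0.
have gb k x y : SA x -> SA y -> agree k x y -> g x <= expR (b * th ^+ k) * g y.
  move=> sx sy a; rewrite /weight -expRD ler_expR.
  by have := holder_agree sx sy a; have := ler_norm (f x - f y); lra.
have conn y z : SA y -> SA z -> exists w, [/\ SA w, w 0%N = z 0%N & iter M shift w = y].
  by move=> sy [sz _]; exact: hM (sz 0%N) sy.
have transfer := pr_le_transfer muSA C1 gibbs letters_SA.
have L1_le0 := transfer_one_le muSA C1 gibbs.
have [H H1 hH] := trM_harnack th01 b0 g0 gb conn sx0.
have K0 : 0 < K%:R :> R by rewrite ltr0n; exact: ltn_trans K2.
pose D := C + C * K%:R * H.
have H0 : 0 < H by exact: lt_le_trans ltr01 H1.
have CKH : 0 < C * K%:R * H by rewrite !mulr_gt0.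
have D0 : 0 < D by rewrite addr_gt0.
have L1_le n x : SA x -> iter n L (fun=> 1) x <= D.
  by move=> sx; rewrite (le_trans (L1_le0 n x sx))// lerDl ltW.
(* The comparison for the whole subshift and Phi = 1 gives 1 <= C K sup L^n 1; the Harnack bound,
   available when T acts last, replaces the supremum by the value at x. *)
have L1_ge k x : SA x -> D^-1 <= iter (k * M) L (fun=> 1) x.
  move=> sx; case: k => [|k].
    by rewrite mul0n /= invf_le1// /D ler_wpDr ?(ltW CKH)// ltW.
  apply: (@le_trans _ _ (C * K%:R * H)^-1).
    by rewrite lef_pV2 ?posrE// lerDr ltW.
  rewrite -[leLHS]mulr1 ler_pdivrMl// -[leLHS](pr_SA muSA).
  have c1 : cone K A th (2 * b * th / (1 - th)) (fun=> 1).
    apply: cone_cst => //; case/andP: th01 => t0 t1.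
    by rewrite divr_ge0 ?subr_ge0 ?(ltW t1)// !mulr_ge0// ltW.
  have c2 := cone_iter_tr th01 b0 g0 gb (k * M) c1.
  rewrite -(mulrA (C * K%:R)); apply: (transfer (k.+1 * M)%N (fun=> 1)) => //.
    exact: measurable_SA.
  by move=> y sy; rewrite mulSn iterD; exact: hH.
have [h [hh hD Lh poisson]] := poisson_transfer th01 b0 g0 gb M0 conn sx0 D0 L1_le L1_ge.
have h0 x : SA x -> 0 < h x.
  by move=> /hD /andP[+ _]; apply: lt_le_trans; rewrite invr_gt0.
(* The conjugate of L by h, which fixes constants because L h = h. *)
pose G y := g y * h y / h (shift y).
have NE phi x : SA x -> tr K A G phi x = L (fun y => h y * phi y) x / h x.
  move=> sx; rewrite mulrC /tr -(presum_shift _ _ (fun y => (h y)^-1)).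
  by apply: eq_presum => // y sy; rewrite /G; ring.
have NnE n phi x : SA x -> h x * iter n (tr K A G) phi x = iter n L (fun y => h y * phi y) x.
  elim: n x => // n IH x sx; rewrite [in LHS]iterS NE// mulrC divfK ?gt_eqF ?h0//.
  exact: eq_tr.
exists G, (C * K%:R * (D * D)); split; first by rewrite !mulr_gt0.
split.
- by move=> x sx; rewrite divr_gt0 ?mulr_gt0 ?h0 ?g0//; exact: SA_shift.
- move=> x sx; rewrite NE// -[RHS](divff (lt0r_neq0 (h0 x sx))); congr (_ / _).
  by rewrite -[RHS]Lh//; apply: eq_tr => // y sy; rewrite mulr1.
- move=> phi hp.
  have [c [a [ha aE]]] := poisson _ (holM th01 hh hp).
  have hV : hol K A th (fun x => (h x)^-1).
    apply: (@hol_inv _ _ _ _ th01 D^-1) => //; first by rewrite invr_gt0.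
    by move=> x /hD /andP[].
  (* Gordin: [phi - c = a' - N a'] and [m := a' - (N a') o shift] is killed by [N]. *)
  pose a' x := a x / h x.
  have ha' : hol K A th a' by exact: holM.
  have hu : hol K A th (tr K A G a').
    have hg := hol_weight th01 b0 g0 gb sx0.
    apply: eq_hol (holM th01 (hol_tr th01 hg ha) hV) => x sx.
    rewrite NE//; congr (_ / _); apply: eq_tr => // y sy.
    by rewrite /a' mulrC divfK// gt_eqF ?h0.
  have N1 x : SA x -> tr K A G (fun=> 1) x = 1.
    move=> sx; rewrite NE// -[RHS](divff (lt0r_neq0 (h0 x sx))); congr (_ / _).
    by rewrite -[RHS]Lh//; apply: eq_tr => // y sy; rewrite mulr1.
  exists c, (fun x => a' x - tr K A G a' (shift x)), (tr K A G a'); split=> //.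
  + by apply: holB => //; exact: hol_shift.
  + move=> x sx; have hx := lt0r_neq0 (h0 x sx).
    have Na : tr K A G a' x = L a x / h x.
      rewrite NE//; congr (_ / _); apply: eq_tr => // y sy.
      by rewrite /a' mulrC divfK// gt_eqF ?h0.
    transitivity (c + a' x - L a x / h x); last by rewrite Na; ring.
    by apply: (mulfI hx); rewrite aE// /a'; field; exact: hx.
  + move=> x sx.
    have -> : (fun x0 => a' x0 - tr K A G a' (shift x0)) =
      (fun x0 => a' x0 + (-1) * (tr K A G a' (shift x0))).
      by apply/funext => y; rewrite mulN1r.
    rewrite tr_lin.
    have -> : tr K A G (fun y => tr K A G a' (shift y)) x = tr K A G a' x.
      rewrite -[RHS]mulr1 -[in RHS](N1 x sx) /tr -(presum_shift _ _ (presum K A _)).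
      by apply: eq_presum => // y sy; rewrite mulr1 mulrC.
    by rewrite mulN1r subrr.
(* One factor D comes from Phi <= D h Phi, the other from h <= D at the base point. *)
- move=> n Phi q B mB BS Phi0 BPhi Nq.
  rewrite -mulrA; apply: (transfer n Phi) => // x sx.
  have N0 : 0 <= iter n (tr K A G) Phi x.
    by apply: iter_tr_ge0 => // y sy; rewrite divr_ge0 ?mulr_ge0 ?ltW ?h0 ?g0//; exact: SA_shift.
  apply: (@le_trans _ _ (D * (h x * iter n (tr K A G) Phi x))).
    rewrite NnE//.
    have -> : D * iter n L (fun y => h y * Phi y) x = iter n L (fun y => D * (h y * Phi y)) x.
      by rewrite iter_trZ.
    apply: le_iter_tr => // [y sy|y sy]; first exact: ltW (g0 y sy).
    rewrite mulrA ler_peMl ?Phi0// -ler_pdivrMl// mulr1.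
    by case/andP: (hD y sy).
  rewrite -mulrA ler_wpM2l ?(ltW D0)// ler_pM ?Nq// ?(ltW (h0 x sx))//.
  by case/andP: (hD x sx).
Qed.

End Normalised.

(** * Integrals over the subshift *)

Section Integral.
Context {R : realType}.
Variables (K : nat) (A : nat -> nat -> nat) (th : R).
Variable mu : probability SeqSpace R.
Notation SA := (Sigma_A K A : set SeqSpace).
Implicit Types (x y : Seq) (phi psi : Seq -> R).
Hypothesis th01 : 0 < th < 1.
Hypothesis muSA : mu SA = 1%E.
Hypothesis mu_inv : shift_invariant mu.
Notation I := (integral_SA K A mu).

Definition bmeas phi := measurable_fun SA phi /\ exists C, forall x, SA x -> `|phi x| <= C.

Lemma hol_lt_open phi c x : hol K A th phi -> SA x -> c < phi x ->
  exists n, forall y, SA y -> agree n y x -> c < phi y.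
Proof.
move=> [C [_ h]] sx cx; have [t0 t1] := andP th01.
have C1 : 0 < `|C| + 1 by rewrite ltr_wpDl.
have e0 : 0 < (phi x - c) / (`|C| + 1) by rewrite divr_gt0 ?subr_gt0.
have /cvgrPdist_lt /(_ _ e0) [N _ hN] : th ^+ n @[n --> \oo] --> (0 : R).
  by apply: cvg_expr; rewrite gtr0_norm.
exists N => y sy yx; have := hN N (leqnn N) => /=.
rewrite sub0r normrN ger0_norm ?exprn_ge0 ?(ltW t0)// ltr_pdivlMr// => l1.
have := h N x y sx sy (agree_sym yx); have := ler_norm (phi x - phi y).
have : C * th ^+ N <= th ^+ N * (`|C| + 1).
  rewrite mulrC ler_wpM2l ?exprn_ge0 ?(ltW t0)// (le_trans (ler_norm C))// lerDl//.
lra.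
Qed.

Lemma measurable_hol_gt phi c : hol K A th phi ->
  measurable ([set x | SA x /\ c < phi x] : set SeqSpace).
Proof.
move=> hp; apply: (@measurable_relopen K A) => [x [sx _] //|x [sx cx]].
have [n hn] := hol_lt_open hp sx cx.
by exists n => y sy yx; split=> //; exact: hn.
Qed.

Lemma hol_bmeas phi : hol K A th phi -> bmeas phi.
Proof.
move=> hp; split; last by case: hp => C [h _]; exists C.
apply: (measurability _ (RGenOInfty.measurableE R)) => // _ [_ [c ->] <-].
have -> : SA `&` phi @^-1` `]c, +oo[%classic = [set x | SA x /\ c < phi x].
  by apply/seteqP; split=> x [sx]; rewrite /= in_itv /= andbT.
exact: measurable_hol_gt.
Qed.

Lemma indic_bmeas (B : set SeqSpace) : measurable B -> bmeas (\1_B).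
Proof.
move=> mB; split; first exact: measurable_indic.
by exists 1 => x _; rewrite indicE; case: (_ \in _); rewrite ?normr1 ?normr0.
Qed.

Lemma bmeasD phi psi : bmeas phi -> bmeas psi -> bmeas (fun x => phi x + psi x).
Proof.
move=> [m1 [C h1]] [m2 [D h2]]; split; first exact: measurable_funD.
by exists (C + D) => x sx; rewrite (le_trans (ler_normD _ _))// lerD ?h1 ?h2.
Qed.

Lemma bmeas_cst c : bmeas (fun=> c).
Proof. by split; [exact: measurable_cst|exists `|c|]. Qed.

Lemma bmeasZ c phi : bmeas phi -> bmeas (fun x => c * phi x).
Proof.
move=> [m1 [C h1]]; split; first by apply: measurable_funM => //; exact: measurable_cst.
by exists (`|c| * C) => x sx; rewrite normrM ler_wpM2l// h1.
Qed.

Lemma bounded_integrable (D : set SeqSpace) phi : measurable D ->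
  measurable_fun D phi -> (exists C, forall x, D x -> `|phi x| <= C) ->
  mu.-integrable D (EFin \o phi).
Proof.
move=> mD mp [C hC]; apply: measurable_bounded_integrable => //.
  by rewrite (le_lt_trans (probability_le1 mu mD))// ltry.
exists C; split; first exact: num_real.
by move=> M CM x Dx /=; exact: le_trans (hC x Dx) (ltW CM).
Qed.

Lemma bmeas_integrable phi : bmeas phi -> mu.-integrable SA (EFin \o phi).
Proof. by move=> [m1 h]; apply: bounded_integrable => //; exact: measurable_SA. Qed.

Lemma intD phi psi : bmeas phi -> bmeas psi -> I (fun x => phi x + psi x) = I phi + I psi.
Proof.
move=> /bmeas_integrable i1 /bmeas_integrable i2.
exact: (RintegralD (measurable_SA K A) i1 i2).
Qed.

Lemma intZ c phi : bmeas phi -> I (fun x => c * phi x) = c * I phi.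
Proof. by move=> /bmeas_integrable i1; exact: (RintegralZl c (measurable_SA K A) i1). Qed.

Lemma int_cst c : I (fun=> c) = c.
Proof.
transitivity (c * pr mu SA); first exact: (Rintegral_cst mu (measurable_SA K A) c).
by rewrite /pr muSA mulr1.
Qed.

Lemma le_int phi psi : bmeas phi -> bmeas psi -> (forall x, SA x -> phi x <= psi x) ->
  I phi <= I psi.
Proof.
move=> /bmeas_integrable i1 /bmeas_integrable i2 h.
exact: (le_Rintegral (measurable_SA K A) i1 i2 h).
Qed.

Lemma eq_int phi psi : (forall x, SA x -> phi x = psi x) -> I phi = I psi.
Proof. by move=> h; apply: (eq_Rintegral mu) => x /set_mem; exact: h. Qed.

Lemma int_indic (B : set SeqSpace) : measurable B -> B `<=` SA -> I (\1_B) = pr mu B.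
Proof.
move=> mB BS; rewrite /integral_SA integral_indic//; last exact: measurable_SA.
by rewrite (_ : B `&` SA = B)//; exact/setIidPl.
Qed.

Lemma int_sum (J : Type) (r : seq J) (F : J -> Seq -> R) : (forall j, bmeas (F j)) ->
  bmeas (fun x => \sum_(j <- r) F j x) /\
  I (fun x => \sum_(j <- r) F j x) = \sum_(j <- r) I (F j).
Proof.
move=> h; elim: r => [|j r [IH1 IH2]].
  have -> : (fun x => \sum_(j <- [::]) F j x) = (fun=> 0) by apply/funext => x; rewrite big_nil.
  by rewrite int_cst big_nil; split=> //; exact: bmeas_cst.
have -> : (fun x => \sum_(i <- j :: r) F i x) = (fun x => F j x + \sum_(i <- r) F i x).
  by apply/funext => x; rewrite big_cons.
by split; [exact: bmeasD|rewrite intD// IH2 big_cons].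
Qed.

Lemma measurable_shift : measurable_fun setT (shift : SeqSpace -> SeqSpace).
Proof.
apply: (@measurability _ _ SeqSpace SeqSpace setT _ cylinders) => // _ [_ [n [w ->]] <-]; rewrite setTI.
apply: measurable_open => x xw; exists n.+1 => y yx k kn.
by rewrite /Defs.shift yx// -(xw k kn).
Qed.

(** As [phi] is controlled on the subshift only, it is extended by zero. The preimage of the
    subshift may be larger than the subshift, but only by a null set. *)
Lemma int_shift phi : bmeas phi -> I (fun x => phi (shift x)) = I phi.
Proof.
move=> [mp [C hC]]; have mSA := measurable_SA K A.
pose D : set SeqSpace := shift @^-1` SA.
have mD : measurable D.
  by rewrite -[D]setTI; exact: measurable_shift.
have SD : SA `<=` D by move=> x; exact: SA_shift.
pose psi := phi \_ SA.
have mpsi : measurable_fun [set: SeqSpace] psi.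
  have [h _] := measurable_restrictT (phi : SeqSpace -> measurableTypeR R) mSA.
  exact: h.
have psiC x : `|psi x| <= `|C|.
  rewrite /psi patchE; case: ifPn => [/set_mem sx|_]; last by rewrite normr0.
  exact: le_trans (hC x sx) (ler_norm C).
have psiE x : SA x -> psi x = phi x by move=> sx; rewrite /psi patchE mem_set.
have iD : mu.-integrable D (EFin \o (psi \o shift)).
  apply: bounded_integrable => //; last by exists `|C| => x _; exact: psiC.
  apply: (measurableT_comp mpsi).
  exact: measurable_funTS measurable_shift.
have mE : measurable_fun [set: SeqSpace] (EFin \o psi) by exact/measurable_EFinP.
rewrite /integral_SA; congr fine.
transitivity (\int[mu]_(x in SA) (psi (shift x))%:E)%E.
  by apply: eq_integral => x /set_mem sx; rewrite psiE//; exact: SA_shift.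
transitivity (\int[mu]_(x in D) (psi (shift x))%:E)%E.
  have mN : measurable (D `\` SA) by exact: measurableD.
  have N0 : (mu (D `\` SA) = 0)%E.
    have h : (mu (~` SA) = 0)%E.
      by have := probability_setC mu mSA; rewrite muSA subee.
    apply/eqP; rewrite -measure_le0 -h le_measure ?inE//; exact: measurableC.
  rewrite [RHS](negligible_integral mN mD iD N0).
  congr (integral mu _ _); apply/seteqP; split=> [x sx|x [Dx nx]].
    by split; [exact: SD|move=> [_]; exact].
  by apply: contrapT => nsx; apply: nx.
transitivity (\int[pushforward mu (shift : SeqSpace -> SeqSpace)]_(x in SA) (psi x)%:E)%E.
  by rewrite (@integral_pushforward _ _ _ _ R _ measurable_shift mu SA (EFin \o psi)).
rewrite (eq_measure_integral mu); [|exact: measurable_shift|by move=> mh B mB _; exact: mu_inv].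
by apply: eq_integral => x /set_mem sx; rewrite psiE.
Qed.

End Integral.

(** * Moment generating functions and tail bounds *)

(** Since (n+3)! >= 2^(n+1) and |v| <= 1, the term of index n + 3 is at most |v|^3 2^-(n+1); these
    add up to at most |v|^3. *)
Lemma expR_le_taylor2 {R : realType} (v : R) : `|v| <= 1 ->
  expR v <= 1 + v + v ^+ 2 / 2 + `|v| ^+ 3.
Proof.
move=> v1.
have key n : series (exp_coeff v) n.+3 <= 1 + v + v ^+ 2 / 2 + `|v| ^+ 3 * (1 - 2^-1 ^+ n).
  elim: n => [|n IH].
    rewrite /series /= !big_nat_recr//= big_geq// /exp_coeff /=.
    rewrite !expr0 !expr1 !factS fact0 !muln1; lra.
  rewrite seriesSr; apply: le_trans (lerD IH (lexx _)) _.
  rewrite [leRHS](_ : _ = (1 + v + v ^+ 2 / 2 + `|v| ^+ 3 * (1 - 2^-1 ^+ n)) +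
    `|v| ^+ 3 * 2^-1 ^+ n.+1); last by rewrite [_ ^+ n.+1]exprS; field.
  rewrite lerD2l /exp_coeff /= (le_trans (ler_norm _))//.
  rewrite [leLHS](_ : _ = `|v| ^+ 3 * (`|v| ^+ n * ((n.+3)`!%:R)^-1)); last first.
    by rewrite normrM normrX normfV normr_nat -addn3 exprD; ring.
  rewrite ler_wpM2l ?exprn_ge0//.
  rewrite -[leRHS]mul1r ler_pM ?exprn_ge0 ?invr_ge0 ?exprn_ile1//.
  rewrite exprVn lef_pV2 ?posrE ?exprn_gt0 ?ltr0n ?fact_gt0//.
  rewrite -natrX ler_nat; elim: n {IH} => // n IH.
  by rewrite expnS factS leq_mul.
apply: (cvgr_to_le (is_cvg_series_exp_coeff v)); exists 3%N => // n /= n3.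
rewrite -(subnK n3) addn3; apply: le_trans (key _) _.
by rewrite lerD2l ler_piMr ?exprn_ge0// gerBl exprn_ge0.
Qed.

Lemma expR_le_quadratic {R : realType} (v : R) : `|v| <= 1 / 2 -> expR v <= 1 + v + v ^+ 2.
Proof.
move=> v1; have v1' : `|v| <= 1 by lra.
apply: le_trans (expR_le_taylor2 v1') _.
rewrite -[v ^+ 2]real_normK ?num_real//.
have := normr_ge0 v; set w := `|v| in v1 *; rewrite !exprS expr0; nra.
Qed.

Section Moments.
Context {R : realType}.
Variables (K : nat) (A : nat -> nat -> nat) (th : R) (G : Seq -> R).
Notation SA := (Sigma_A K A).
Notation N := (tr K A G).
Implicit Types (x y : Seq) (phi psi m : Seq -> R).
Hypothesis th01 : 0 < th < 1.
Hypothesis G0 : forall x, SA x -> 0 < G x.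
Hypothesis N1 : forall x, SA x -> N (fun=> 1) x = 1.

Let G0' x : SA x -> 0 <= G x. Proof. by move/G0/ltW. Qed.

Lemma tr_cst c x : SA x -> N (fun=> c) x = c.
Proof.
move=> sx; rewrite -[RHS]mulr1 -[in RHS](N1 sx) /tr -presumZ.
by apply: eq_presum => // y sy; ring.
Qed.

Lemma tr_koopman psi x : SA x -> N (fun y => psi (shift y)) x = psi x.
Proof.
move=> sx; rewrite -[RHS]mulr1 -[in RHS](N1 sx) /tr -(presum_shift K A psi).
by apply: eq_presum => // y sy; ring.
Qed.

Lemma birkhoffS m n y : birkhoff m n.+1 y = m y + birkhoff m n (shift y).
Proof.
rewrite /birkhoff big_ord_recl /=; congr (_ + _); apply: eq_bigr => i _.
by rewrite -iterSr.
Qed.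

Lemma birkhoffD m n k y : birkhoff m (n + k) y = birkhoff m n y + birkhoff m k (iter n shift y).
Proof.
elim: n y => [|n IH] y; first by rewrite /birkhoff big_ord0 add0r.
by rewrite addSn !birkhoffS IH addrA -iterSr.
Qed.

(** The function w is a supersolution of the twisted operator phi -> N (e^(tm) phi). In S_(n+1) m =
    m + S_n m o shift the second term leaves N as a factor, so each step costs one [lam]. *)
Lemma mgf_iter m w t lam n : 0 <= lam ->
  (forall x, SA x -> N (fun y => expR (t * m y) * w y) x <= lam * w x) ->
  forall x, SA x -> iter n N (fun y => expR (t * birkhoff m n y) * w y) x <= lam ^+ n * w x.
Proof.
move=> l0 h; elim: n => [|n IH] x sx.
  by rewrite /= /birkhoff big_ord0 mulr0 expR0 !mul1r.
rewrite iterSr exprS -mulrA.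
apply: (@le_trans _ _ (iter n N (fun y => lam * (expR (t * birkhoff m n y) * w y)) x)).
  apply: le_iter_tr => // y sy.
  rewrite [leRHS]mulrCA.
  apply: le_trans (ler_wpM2l (expR_ge0 _) (h y sy)).
  have e := presum_shift K A (fun y => expR (t * birkhoff m n y))
    (fun z => G z * (expR (t * m z) * w z)) y.
  apply: le_trans (_ : _ <= presum K A (fun z => expR (t * birkhoff m n (shift z)) *
    (G z * (expR (t * m z) * w z))) y) _; last by rewrite e.
  apply: le_presum => // z sz.
  by rewrite birkhoffS mulrDr expRD le_eqVlt; apply/orP; left; apply/eqP; ring.
by rewrite iter_trZ ler_wpM2l// IH.
Qed.

(** [N m = 0] removes the first-order term. The crude D^2 in place of the variance suffices for
    large deviations and for the tail sums inside a block. *)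
Lemma mgf_quadratic m D t : (forall x, SA x -> `|m x| <= D) ->
  (forall x, SA x -> N m x = 0) -> `|t| * D <= 1 / 2 ->
  forall x, SA x -> N (fun y => expR (t * m y)) x <= expR (t ^+ 2 * D ^+ 2).
Proof.
move=> mD Nm tD x sx; apply: le_trans (expR_ge1Dx _).
apply: (@le_trans _ _ (N (fun y => (1 + t ^+ 2 * D ^+ 2) + t * m y) x)).
  apply: le_tr => // y sy; have my := mD y sy.
  have tm : `|t * m y| <= `|t| * D by rewrite normrM ler_wpM2l.
  apply: le_trans (expR_le_quadratic (le_trans tm tD)) _.
  rewrite addrAC lerD2r lerD2l exprMn ler_wpM2l ?sqr_ge0//.
  by rewrite -[m y ^+ 2]real_normK ?num_real// lerXn2r ?nnegrE// (le_trans _ my).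
by rewrite tr_lin tr_cst// Nm// mulr0 addr0.
Qed.

(* The second-order corrector [t ^+ 2 * u2 / 2] turns [m ^+ 2] into its mean [rho]
   up to a coboundary and a term killed by the operator. *)
Lemma mgf_sharp m m2 u2 rho D : 0 <= rho ->
  (forall x, SA x -> `|m x| <= D) -> (forall x, SA x -> `|u2 x| <= D) ->
  (forall x, SA x -> m x ^+ 2 = rho + m2 x + u2 (shift x) - u2 x) ->
  (forall x, SA x -> N m x = 0) -> (forall x, SA x -> N m2 x = 0) ->
  exists E t0, [/\ 0 <= E, 0 < t0 & forall t, 0 <= t <= t0 -> forall n x, SA x ->
    iter n N (fun y => expR (t * birkhoff m n y)) x <=
      3 * expR (n%:R * (rho * t ^+ 2 / 2 + E * t ^+ 3))].
Proof.
move=> rho0 mD' uD' m2E Nm Nm2.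
pose B := `|D| + 1.
have B1 : 1 <= B by rewrite lerDr.
have mB x : SA x -> `|m x| <= B.
  by move=> /mD' h; rewrite (le_trans h)// (le_trans (ler_norm D))// lerDl.
have uB x : SA x -> `|u2 x| <= B.
  by move=> /uD' h; rewrite (le_trans h)// (le_trans (ler_norm D))// lerDl.
(* The cubic remainders are at most 3/2 B^3 from the exponential, as w <= 3/2, and 3/4 B^2 from
   products with the corrector. In [E] the factor 2 pays for w >= 1/2, and B rho for replacing rho
   t^2 / 2 by its product with w. *)
pose E0 := 3 * B ^+ 3.
pose E := 2 * E0 + B * rho.
have E00 : 0 <= E0 by rewrite mulr_ge0// exprn_ge0//; lra.
exists E, (1 / B); split.
- by rewrite addr_ge0 ?mulr_ge0//; lra.
- by rewrite divr_gt0//; lra.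
move=> t /andP[t0 tB] n x sx.
have tB1 : t * B <= 1 by rewrite -ler_pdivlMr//; lra.
have t1 : t <= 1 by rewrite (le_trans _ tB1)// ler_peMr.
pose w y := 1 + t ^+ 2 * u2 y / 2.
have tt : t ^+ 2 * B <= 1.
  by rewrite expr2 -mulrA mulr_ile1// mulr_ge0//; lra.
have wb y : SA y -> 1 / 2 <= w y <= 3 / 2.
  move=> sy; have := uB y sy; rewrite ler_norml => /andP[h1 h2].
  have t20 := sqr_ge0 t.
  have b1 : t ^+ 2 * u2 y <= t ^+ 2 * B by rewrite ler_wpM2l.
  have b2 : t ^+ 2 * (- B) <= t ^+ 2 * u2 y by rewrite ler_wpM2l.
  by rewrite /w; apply/andP; split; lra.
have t3 : 0 <= t ^+ 3 by rewrite exprn_ge0.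
have wN y : SA y -> N (fun y => expR (t * m y) * w y) y <=
    expR (rho * t ^+ 2 / 2 + E * t ^+ 3) * w y.
  move=> sy; have /andP[wy1 wy2] := wb y sy.
  apply: (@le_trans _ _ ((1 + (rho * t ^+ 2 / 2 + E * t ^+ 3)) * w y)); last first.
    by rewrite ler_wpM2r ?expR_ge1Dx//; lra.
  pose c := 1 + t ^+ 2 * rho / 2 + E0 * t ^+ 3.
  apply: (@le_trans _ _ (N (fun z => ((c + t * m z) + t ^+ 2 / 2 * m2 z)
      + t ^+ 2 / 2 * u2 (shift z)) y)).
    apply: le_tr => // z sz.
    have tm1 : `|t * m z| <= 1.
      by rewrite normrM ger0_norm// (le_trans _ tB1)// ler_wpM2l ?mB.
    have /andP[wz1 wz2] := wb z sz.
    have wz0 : 0 <= w z by lra.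
    apply: (le_trans (ler_wpM2r wz0 (expR_le_taylor2 tm1))).
    have -> : m2 z = m z ^+ 2 - rho - u2 (shift z) + u2 z by rewrite m2E//; ring.
    have -> : c + t * m z + t ^+ 2 / 2 * (m z ^+ 2 - rho - u2 (shift z) + u2 z) +
        t ^+ 2 / 2 * u2 (shift z) =
        (1 + t * m z + (t * m z) ^+ 2 / 2) * w z + `|t * m z| ^+ 3 * w z
        + (E0 * t ^+ 3 - (t * m z + (t * m z) ^+ 2 / 2) * (t ^+ 2 * u2 z / 2)
           - `|t * m z| ^+ 3 * w z).
      by rewrite /c /w; field.
    rewrite mulrDl lerDl.
    have a0 := normr_ge0 (t * m z).
    have aB : `|t * m z| <= t * B by rewrite normrM ger0_norm// ler_wpM2l// mB.
    have tB0 : 0 <= t * B by exact: le_trans aB.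
    set T := t * m z in a0 aB *; clearbody T.
    have i1 : `|T| ^+ 3 * w z <= (t * B) ^+ 3 * (3 / 2).
      by apply: ler_pM => //; rewrite lerXn2r ?nnegrE.
    have i2 : (T + T ^+ 2 / 2) * (t ^+ 2 * u2 z / 2) <=
        (3 / 2 * (t * B)) * (t ^+ 2 * B / 2).
      apply: le_trans (ler_norm _) _; rewrite normrM ler_pM//.
        rewrite (le_trans (ler_normD _ _))// normrM normrX (@ger0_norm _ 2^-1) ?invr_ge0//.
        have : `|T| * `|T| <= `|T| * 1 by rewrite ler_wpM2l//; lra.
        by rewrite expr2; lra.
      rewrite 2!normrM (ger0_norm (sqr_ge0 t)) (@ger0_norm _ 2^-1) ?invr_ge0//.
      rewrite ler_wpM2r ?invr_ge0//.
      by rewrite ler_wpM2l ?sqr_ge0// uB.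
    have i3 : t ^+ 3 * B ^+ 2 <= t ^+ 3 * B ^+ 3.
      by rewrite ler_wpM2l// [leRHS]exprS ler_peMl// exprn_ge0//; lra.
    have e1 : (t * B) ^+ 3 = t ^+ 3 * B ^+ 3 by rewrite exprMn.
    have e2 : (3 / 2 * (t * B)) * (t ^+ 2 * B / 2) = 3 / 4 * (t ^+ 3 * B ^+ 2) by field.
    have i4 : 0 <= t ^+ 3 * B ^+ 3 by rewrite mulr_ge0// exprn_ge0//; lra.
    by rewrite e1 in i1; rewrite e2 in i2; rewrite /E0; lra.
  rewrite (tr_lin K A G (fun z => c + t * m z + t ^+ 2 / 2 * m2 z) (fun z => u2 (shift z))).
  rewrite (tr_lin K A G (fun z => c + t * m z) m2) tr_lin.
  rewrite tr_cst// tr_koopman// Nm// Nm2// !mulr0 !addr0.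
  have j1 : 0 <= E * t ^+ 3 * (w y - 1 / 2).
    by rewrite mulr_ge0 ?mulr_ge0 ?subr_ge0// addr_ge0 ?mulr_ge0//; lra.
  have /andP[u1 u3] : - B <= u2 y <= B by rewrite -ler_norml uB.
  have j2 : 0 <= rho * t ^+ 2 / 2 * (t ^+ 2 * (u2 y + B) / 2).
    by rewrite !mulr_ge0 ?sqr_ge0//; lra.
  have j3 : 0 <= rho * B * t ^+ 3 * (1 - t).
    by rewrite !mulr_ge0 ?subr_ge0//; lra.
  have j4 : 0 <= rho * B * t ^+ 3 by rewrite !mulr_ge0//; lra.
  have -> : c + t ^+ 2 / 2 * u2 y = w y + (rho * t ^+ 2 / 2 + E0 * t ^+ 3).
    by rewrite /c /w; field.
  rewrite mulrDl mul1r lerD2l.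
  have e : (rho * t ^+ 2 / 2 + E * t ^+ 3) * w y - (rho * t ^+ 2 / 2 + E0 * t ^+ 3) =
    E * t ^+ 3 * (w y - 1 / 2) + rho * t ^+ 2 / 2 * (t ^+ 2 * (u2 y + B) / 2) +
    (rho * B * t ^+ 3 * (1 - t)) / 4 + rho * B * t ^+ 3 / 4.
    by rewrite /w /E; field.
  by rewrite -subr_ge0 e !addr_ge0 ?divr_ge0.
(* As w lies between 1/2 and 3/2, inserting it costs 2 and removing it 3/2. *)
have -> : 3 * expR (n%:R * (rho * t ^+ 2 / 2 + E * t ^+ 3)) =
  2 * (3 / 2 * expR (n%:R * (rho * t ^+ 2 / 2 + E * t ^+ 3))) by field.
apply: (@le_trans _ _ (2 * iter n N (fun y => expR (t * birkhoff m n y) * w y) x)).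
  have -> : 2 * iter n N (fun y => expR (t * birkhoff m n y) * w y) x =
    iter n N (fun y => 2 * (expR (t * birkhoff m n y) * w y)) x by rewrite iter_trZ.
  apply: le_iter_tr => // y sy.
  have /andP[wy1 wy2] := wb y sy; rewrite mulrCA ler_peMr ?expR_ge0//; lra.
rewrite ler_wpM2l//; apply: le_trans (mgf_iter n (expR_ge0 _) wN sx) _.
rewrite -expRM_natl mulrC ler_wpM2r ?expR_ge0//.
by have /andP[] := wb x sx.
Qed.

End Moments.

(** At time n - 1 - k the orbits still share k + 1 letters; the differences form a geometric sum
    whose bound does not depend on n. *)
Lemma birkhoff_distortion {R : realType} K A (th C : R) m n x y : 0 < th < 1 -> 0 <= C ->
  hol_by K A th C m -> Sigma_A K A x -> Sigma_A K A y -> agree n x y ->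
  `|birkhoff m n x - birkhoff m n y| <= C / (1 - th).
Proof.
move=> th01 C0 [_ h] sx sy a; have [t0 t1] := andP th01.
apply: le_trans (sum_geo_le th01 n C0).
apply: (@le_trans _ _ (\sum_(0 <= k < n) C * th ^+ k.+1)).
  elim: n x y sx sy a => [|n IH] x y sx sy a.
    by rewrite /birkhoff !big_ord0 subrr normr0 big_nil.
  rewrite !birkhoffS big_nat_recr//=.
  have -> : m x + birkhoff m n (shift x) - (m y + birkhoff m n (shift y)) =
    (birkhoff m n (shift x) - birkhoff m n (shift y)) + (m x - m y) by ring.
  rewrite (le_trans (ler_normD _ _))// lerD ?h//.
  by apply: IH; [exact: SA_shift|exact: SA_shift|exact: agree_shift].
apply: ler_sum => k _; rewrite ler_wpM2l// exprS ler_piMl ?(ltW t1)//.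
by rewrite exprn_ge0// ltW.
Qed.

(** * A maximal inequality for tail sums *)

Section Maximal.
Context {R : realType}.
Variables (K : nat) (A : nat -> nat -> nat) (G : Seq -> R).
Notation SA := (Sigma_A K A).
Notation N := (tr K A G).
Implicit Types (x y : Seq).
Hypothesis G0 : forall x, SA x -> 0 < G x.
Hypothesis N1 : forall x, SA x -> N (fun=> 1) x = 1.
Variables (m : Seq -> R) (D t lam : R).
Hypothesis mD : forall x, SA x -> `|m x| <= D.
Hypothesis Nm : forall x, SA x -> N m x = 0.
Hypothesis t0 : 0 <= t.
Hypothesis tD : t * D <= 1 / 2.
Hypothesis lam0 : 0 <= lam.

Definition hits n y := exists2 j, (j <= n)%N & lam < birkhoff m (n - j) (iter j shift y).

(* The exponential martingale of the tail sums [S_n - S_j], read for decreasing [j] and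
   stopped at the first one that exceeds [lam]. *)
Fixpoint stopped n y := if n is n'.+1 then
  if `[< hits n' (shift y) >] then stopped n' (shift y) else expR (t * birkhoff m n y)
  else 1.

Lemma hits_shift n y : hits n (shift y) -> hits n.+1 y.
Proof. by move=> [j jn h]; exists j.+1; rewrite ?subSS ?iterSr. Qed.

Lemma hits_stopped n y : hits n y -> expR (t * lam) <= stopped n y.
Proof.
elim: n y => [|n IH] y /=.
  move=> [j]; rewrite leqn0 => /eqP -> /=; rewrite /birkhoff big_ord0.
  by rewrite ltNge lam0.
case: asboolP => [/IH//|nh] [[|j] jn h]; first by rewrite ler_expR ler_wpM2l// ltW.
by exfalso; apply: nh; exists j => //; rewrite -iterSr.
Qed.

Lemma not_hits_stopped n y : ~ hits n y -> stopped n y = expR (t * birkhoff m n y).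
Proof.
case: n => [|n] nh /=; first by rewrite /birkhoff big_ord0 mulr0 expR0.
by case: asboolP => // /hits_shift.
Qed.

Lemma stopped_ge0 n y : 0 <= stopped n y.
Proof. by elim: n y => //= n IH y; case: asboolP => _; [exact: IH|exact: expR_ge0]. Qed.

(** All preimages of x share the same image under the shift, hence the same stopping decision.
    Either the value is frozen and N 1 = 1 applies, or it gains a factor e^(tm), averaged by
    [mgf_quadratic]. *)
Lemma tr_stopped n x : SA x -> N (stopped n.+1) x <= expR (t ^+ 2 * D ^+ 2) * stopped n x.
Proof.
move=> sx; have e1 : 1 <= expR (t ^+ 2 * D ^+ 2).
  by rewrite -expR0 ler_expR mulr_ge0 ?sqr_ge0.
have [h|h] := pselect (hits n x).
  have -> : N (stopped n.+1) x = stopped n x.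
    rewrite -[RHS]mulr1 -[in RHS](N1 sx).
    by apply: etrans (presum_shift _ _ (fun=> stopped n x) _ x); apply: eq_bigr => a aa /=;
       rewrite asboolT// mulr1 mulrC.
  by rewrite ler_peMl// stopped_ge0.
rewrite not_hits_stopped// mulrC.
have -> : N (stopped n.+1) x = expR (t * birkhoff m n x) * N (fun y => expR (t * m y)) x.
  apply: etrans (presum_shift _ _ (fun=> expR (t * birkhoff m n x)) _ x).
  apply: eq_bigr => a aa /=; rewrite asboolF// birkhoffS mulrDr expRD.
  by rewrite mulrA mulrC.
rewrite ler_wpM2l ?expR_ge0//; apply: (mgf_quadratic G0 N1 mD Nm) => //.
by rewrite ger0_norm.
Qed.

Lemma iter_tr_stopped n x : SA x ->
  iter n N (stopped n) x <= expR (n%:R * (t ^+ 2 * D ^+ 2)).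
Proof.
have G0' y : SA y -> 0 <= G y by move/G0/ltW.
elim: n x => [|n IH] x sx; first by rewrite mul0r expR0.
rewrite iterSr.
apply: (@le_trans _ _ (expR (t ^+ 2 * D ^+ 2) * iter n N (stopped n) x)).
  have -> : expR (t ^+ 2 * D ^+ 2) * iter n N (stopped n) x =
    iter n N (fun y => expR (t ^+ 2 * D ^+ 2) * stopped n y) x by rewrite iter_trZ.
  by apply: le_iter_tr => // y sy; exact: tr_stopped.
rewrite -[n.+1%:R]natr1 mulrDl mul1r addrC expRD.
by rewrite ler_wpM2l ?expR_ge0// IH.
Qed.

End Maximal.

(** * Tail probabilities and vanishing means *)

Section Tails.
Context {R : realType}.
Variables (K : nat) (A : nat -> nat -> nat) (th C' : R) (G : Seq -> R).
Variable mu : probability SeqSpace R.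
Notation SA := (Sigma_A K A).
Notation N := (tr K A G).
Implicit Types (x y : Seq) (m phi Phi : Seq -> R).
Hypothesis th01 : 0 < th < 1.
Hypothesis muSA : mu SA = 1%E.
Hypothesis mu_inv : shift_invariant mu.
Hypothesis C0 : 0 < C'.
Hypothesis G0 : forall x, SA x -> 0 < G x.
Hypothesis N1 : forall x, SA x -> N (fun=> 1) x = 1.
Hypothesis transfer : forall n Phi q (B : set SeqSpace), measurable B -> B `<=` SA ->
  (forall x, SA x -> 0 <= Phi x) ->
  (forall x y, B y -> SA x -> agree n x y -> 1 <= Phi x) ->
  (forall x, SA x -> iter n N Phi x <= q) -> pr mu B <= C' * q.

Lemma measurable_birkhoff_gt m n a : hol K A th m ->
  measurable ([set x | SA x /\ a < birkhoff m n x] : set SeqSpace).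
Proof. by move=> hm; apply: (measurable_hol_gt th01); exact: hol_birkhoff. Qed.

(** Markov's inequality for the operator. The comparison asks for a majorant on whole cylinders; the
    distortion constant V lowers the level accordingly. *)
Lemma pr_birkhoff_gt m : hol K A th m -> exists V, 0 <= V /\ forall n a t q, 0 <= t ->
  (forall x, SA x -> iter n N (fun y => expR (t * birkhoff m n y)) x <= q) ->
  pr mu [set x | SA x /\ a < birkhoff m n x] <= C' * (expR (t * (V - a)) * q).
Proof.
move=> hm; have [C C00 hC] := hol_pos th01 hm; have [t0 t1] := andP th01.
exists (C / (1 - th)); split; first by rewrite divr_ge0 ?subr_ge0 ?ltW.
move=> n a t q tt hq.
apply: (@transfer n (fun x => expR (t * (C / (1 - th) - a)) * expR (t * birkhoff m n x))).
- exact: measurable_birkhoff_gt.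
- by move=> x [].
- by move=> x sx; rewrite mulr_ge0 ?expR_ge0.
- move=> x y [sy ay] sx xy; rewrite -expRD -[leLHS]expR0 ler_expR -mulrDr mulr_ge0//.
  have := birkhoff_distortion th01 (ltW C00) hC sx sy xy.
  by rewrite ler_norml => /andP[h1 h2]; lra.
- by move=> x sx; rewrite iter_trZ ler_wpM2l ?expR_ge0// hq.
Qed.

Lemma measurable_hits m lam n : hol K A th m ->
  measurable ([set x | SA x /\ hits m lam n x] : set SeqSpace).
Proof.
move=> hm; apply: (@measurable_relopen K A) => [x [sx _] //|x [sx [j jn hj]]].
have [k hk] := hol_lt_open th01 (hol_iter_shift th01 j (hol_birkhoff th01 (n - j) hm)) sx hj.
by exists k => y sy yx; split=> //; exists j => //; exact: hk.
Qed.

(** Distortion lowers the level to lam - V, and V <= lam keeps it non-negative, so that the empty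
    sum is no hit. *)
Lemma pr_hits m D : hol K A th m -> (forall x, SA x -> `|m x| <= D) ->
  (forall x, SA x -> N m x = 0) ->
  exists V, 0 <= V /\ forall n lam t, 0 <= t -> t * D <= 1 / 2 -> V <= lam ->
  pr mu [set x | SA x /\ hits m lam n x] <=
    C' * (expR (t * (V - lam)) * expR (n%:R * (t ^+ 2 * D ^+ 2))).
Proof.
move=> hm mD Nm; have [C C00 hC] := hol_pos th01 hm; have [t0 t1] := andP th01.
pose V := C / (1 - th).
exists V; split; first by rewrite divr_ge0 ?subr_ge0 ?ltW.
move=> n lam t tt tD Vl.
apply: (@transfer n (fun x => expR (t * (V - lam)) * stopped m t (lam - V) n x)).
- exact: measurable_hits.
- by move=> x [].
- by move=> x sx; rewrite mulr_ge0 ?expR_ge0 ?stopped_ge0.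
- move=> x y [sy [j jn yj]] sx xy.
  have l0 : 0 <= lam - V by rewrite subr_ge0.
  have hx : hits m (lam - V) n x.
    exists j => //.
    have := birkhoff_distortion th01 (ltW C00) hC (SA_iter_shift j sx) (SA_iter_shift j sy).
    move=> /(_ (n - j)%N (agree_iter_shift _)); rewrite subnKC// => /(_ xy).
    by rewrite -/V ler_norml => /andP[]; lra.
  have e : expR (t * (V - lam)) * expR (t * (lam - V)) = 1.
    by rewrite -expRD -mulrDr -[V - lam]opprB addNr mulr0 expR0.
  rewrite -[leLHS]e ler_pM2l ?expR_gt0//; exact: hits_stopped.
- move=> x sx; rewrite iter_trZ ler_wpM2l ?expR_ge0//.
  by apply: iter_tr_stopped.
Qed.

Lemma mgf_birkhoff m D t n : (forall x, SA x -> `|m x| <= D) ->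
  (forall x, SA x -> N m x = 0) -> `|t| * D <= 1 / 2 -> forall x, SA x ->
  iter n N (fun y => expR (t * birkhoff m n y)) x <= expR (n%:R * (t ^+ 2 * D ^+ 2)).
Proof.
move=> mD Nm tD x sx; rewrite expRM_natl -[leRHS]mulr1.
apply: le_trans (mgf_iter (w := fun=> 1) G0 n (expR_ge0 _) _ sx).
  by apply: le_iter_tr => // y sy; [apply/ltW/G0|rewrite mulr1].
move=> y sy; rewrite mulr1; apply: le_trans (mgf_quadratic G0 N1 mD Nm tD sy).
by apply: le_tr => // z sz; [apply/ltW/G0|rewrite mulr1].
Qed.

Lemma le_birkhoff m D n x : (forall x, SA x -> `|m x| <= D) -> SA x ->
  `|birkhoff m n x| <= n%:R * D.
Proof.
move=> mD sx; apply: le_trans (ler_norm_sum _ _ _) _.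
rewrite mulr_natl -[X in _ *+ X](card_ord n) -sumr_const; apply: ler_sum => i _.
by apply: mD; exact: SA_iter_shift.
Qed.

Lemma int_birkhoff m n : hol K A th m ->
  integral_SA K A mu (birkhoff m n) = n%:R * integral_SA K A mu m.
Proof.
move=> hm.
have b k : bmeas K A (fun x => m (iter k shift x)).
  by apply: (hol_bmeas th01); exact: hol_iter_shift.
have e k : integral_SA K A mu (fun x => m (iter k shift x)) = integral_SA K A mu m.
  elim: k => // k IH; rewrite -IH -(int_shift muSA mu_inv (b k)).
  by apply: eq_int => x _; rewrite iterSr.
have [_ ->] := int_sum muSA (index_enum 'I_n) (fun k : 'I_n => b k).
by under eq_bigr do rewrite e; rewrite sumr_const card_ord mulr_natl.
Qed.

(* Large deviations: [S_n m / n] exceeds any positive level with exponentially small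
   probability. *)
Lemma mean_zero_le m : hol K A th m -> (forall x, SA x -> N m x = 0) ->
  integral_SA K A mu m <= 0.
Proof.
move=> hm Nm; have [V [V0 hV]] := pr_birkhoff_gt hm.
have [D D0 [mD _]] := hol_pos th01 hm.
apply/ler_addgt0Pl => delta d0; rewrite addr0.
(* The two bounds give t D <= 1/2 and t^2 D^2 - t delta <= - t delta / 2, the exponential rate per
   step. *)
pose t := Num.min (1 / (2 * D)) (delta / (2 * D ^+ 2)).
have t0 : 0 < t by rewrite lt_min !divr_gt0 ?mulr_gt0 ?exprn_gt0.
have t1 : t * D <= 1 / 2.
  have : t <= 1 / (2 * D) by rewrite ge_min lexx.
  by rewrite ler_pdivlMr ?mulr_gt0//; lra.
have t2 : t * D ^+ 2 <= delta / 2.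
  have : t <= delta / (2 * D ^+ 2) by rewrite ge_min lexx orbT.
  by rewrite ler_pdivlMr ?mulr_gt0 ?exprn_gt0//; lra.
pose E := C' * expR (t * V) * D.
pose z := expR (- (t * delta / 2)).
have z01 : 0 < z < 1.
  by rewrite /z expR_gt0/= -expR0 ltr_expR oppr_lt0 divr_gt0 ?mulr_gt0.
have key n : integral_SA K A mu m - delta <= E * z ^+ n.
  pose p := n.+1; have p0 : 0 < p%:R :> R by rewrite ltr0n.
  pose B : set SeqSpace := [set x | SA x /\ p%:R * delta < birkhoff m p x].
  have mB : measurable B by exact: measurable_birkhoff_gt.
  have prB : pr mu B <= C' * expR (t * V) * z ^+ p.
    have tD' : `|t| * D <= 1 / 2 by rewrite gtr0_norm.
    apply: le_trans (hV p (p%:R * delta) t _ (ltW t0) (mgf_birkhoff p mD Nm tD')) _.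
    rewrite -mulrA ler_wpM2l ?(ltW C0)// /z -expRM_natl -!expRD ler_expR.
    have : p%:R * (t * (t * D ^+ 2)) <= p%:R * (t * (delta / 2)).
      by rewrite !ler_wpM2l// ltW.
    rewrite expr2; lra.
  have bB : bmeas K A (fun x => p%:R * delta + p%:R * D * \1_B x).
    by apply: bmeasD; [exact: bmeas_cst|apply: bmeasZ; exact: indic_bmeas].
  have : integral_SA K A mu (birkhoff m p) <=
      integral_SA K A mu (fun x => p%:R * delta + p%:R * D * \1_B x).
    apply: le_int => //; first by apply: (hol_bmeas th01); exact: hol_birkhoff.
    move=> x sx; have := le_birkhoff p mD sx; rewrite ler_norml => /andP[_ h].
    rewrite indicE; case: (boolP (x \in B)) => [|/negP nB].
      by rewrite mulr1 => _; rewrite (le_trans h)// lerDr mulr_ge0// ltW.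
    rewrite mulr0 addr0 leNgt; apply/negP => lt; apply: nB.
    by rewrite inE.
  rewrite int_birkhoff// intD; [|exact: bmeas_cst|by apply: bmeasZ; exact: indic_bmeas].
  rewrite int_cst// intZ; last exact: indic_bmeas.
  rewrite int_indic//; last by move=> x [].
  rewrite -mulrA -mulrDr ler_pM2l// => le1; rewrite lerBlDl (le_trans le1)// lerD2l.
  rewrite mulrC; apply: (@le_trans _ _ (C' * expR (t * V) * z ^+ p * D)).
    by rewrite ler_wpM2r// ltW.
  rewrite /E -!mulrA !ler_wpM2l ?expR_ge0 ?(ltW C0)// mulrC ler_wpM2l ?(ltW D0)//.
  have /andP[z0 z1] := z01.
  by rewrite exprS ler_piMl ?exprn_ge0// ltW.
by have := geo_le0 z01 key; rewrite subr_le0.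
Qed.

Lemma mean_zero m : hol K A th m -> (forall x, SA x -> N m x = 0) ->
  integral_SA K A mu m = 0.
Proof.
move=> hm Nm; apply/eqP; rewrite eq_le mean_zero_le//=.
have hm' := holN th01 hm.
have e x : SA x -> N (fun y => - m y) x = 0.
  move=> sx; rewrite -(mulr0 (-1)) -(Nm _ sx) -[RHS]/((fun x => -1 * N m x) x).
  by rewrite /tr -presumZ; apply: eq_presum => // y _; ring.
have := mean_zero_le hm' e; rewrite -oppr_le0; apply: le_trans.
rewrite le_eqVlt; apply/orP; left; apply/eqP.
have -> : integral_SA K A mu (fun x => - m x) = integral_SA K A mu (fun x => -1 * m x).
  by apply: eq_int => x _; rewrite mulN1r.
by rewrite (intZ mu (-1) (hol_bmeas th01 hm)) mulN1r.
Qed.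

End Tails.

(** * Variance and entropy *)

Lemma cvg_div_nat {R : realType} (e : R) : e / n%:R @[n --> \oo] --> (0 : R).
Proof.
apply/cvgrPdist_le => d d0; exists (Num.trunc (`|e| / d)).+1 => // n /= hn.
have nR : 0 < n%:R :> R by rewrite ltr0n (leq_ltn_trans _ hn).
rewrite sub0r normrN normrM normfV (@ger0_norm _ n%:R) ?ler0n// ler_pdivrMr// mulrC.
rewrite -ler_pdivrMr// ltW// (lt_le_trans (truncnS_gt _))// ler_nat.
exact: hn.
Qed.

Section Limits.
Context {R : realType}.
Variables (K : nat) (A : nat -> nat -> nat) (th C' : R) (G : Seq -> R).
Variable mu : probability SeqSpace R.
Notation SA := (Sigma_A K A).
Notation N := (tr K A G).
Notation I := (integral_SA K A mu).
Implicit Types (x y : Seq) (m phi Phi : Seq -> R).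
Hypothesis th01 : 0 < th < 1.
Hypothesis muSA : mu SA = 1%E.
Hypothesis mu_inv : shift_invariant mu.
Hypothesis C0 : 0 < C'.
Hypothesis G0 : forall x, SA x -> 0 < G x.
Hypothesis N1 : forall x, SA x -> N (fun=> 1) x = 1.
Hypothesis transfer : forall n Phi q (B : set SeqSpace), measurable B -> B `<=` SA ->
  (forall x, SA x -> 0 <= Phi x) ->
  (forall x y, B y -> SA x -> agree n x y -> 1 <= Phi x) ->
  (forall x, SA x -> iter n N Phi x <= q) -> pr mu B <= C' * q.

Let mz := mean_zero th01 muSA mu_inv C0 G0 N1 transfer.
Let bm phi : hol K A th phi -> bmeas K A phi.
Proof. exact: hol_bmeas. Qed.

Lemma int_sqr_birkhoff m n : hol K A th m -> (forall x, SA x -> N m x = 0) ->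
  I (fun x => birkhoff m n x ^+ 2) = n%:R * I (fun x => m x ^+ 2).
Proof.
move=> hm Nm.
have hsq phi : hol K A th phi -> hol K A th (fun x => phi x ^+ 2).
  by move=> h; apply: eq_hol (holM th01 h h) => x _; rewrite expr2.
have hb k : hol K A th (birkhoff m k) by exact: hol_birkhoff.
elim: n => [|n IH].
  rewrite mul0r -(int_cst muSA 0); apply: eq_int => x _.
  by rewrite /birkhoff big_ord0 expr0n.
have hbs := hol_shift th01 (hb n).
have h1 : hol K A th (fun x => birkhoff m n (shift x) * m x) by exact: holM.
(* [m] is orthogonal to the functions of [shift x]. *)
have e1 : I (fun x => birkhoff m n (shift x) * m x) = 0.
  apply: mz => // x sx.
  rewrite -(mulr0 (birkhoff m n x)) -(Nm _ sx) /tr -(presum_shift _ _ (birkhoff m n)).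
  by apply: eq_presum => // y _; ring.
transitivity (I (fun x => (m x ^+ 2 + 2 * (birkhoff m n (shift x) * m x)) +
    birkhoff m n (shift x) ^+ 2)).
  by apply: eq_int => x _; rewrite birkhoffS; ring.
rewrite intD; last 2 first.
- by apply: bm; apply: holD => //; [exact: hsq|exact: holZ].
- by apply: bm; exact: hsq.
rewrite intD; last 2 first.
- by apply: bm; exact: hsq.
- by apply: bm; exact: holZ.
rewrite intZ ?e1; last exact: bm.
rewrite (int_shift muSA mu_inv (bm (hsq _ (hb n)))) IH -[n.+1%:R]natr1; ring.
Qed.

Variables (f m u : Seq -> R) (c : R).
Hypothesis hf : hol K A th f.
Hypothesis hm : hol K A th m.
Hypothesis hu : hol K A th u.
Hypothesis fE : forall x, SA x -> f x = c + m x + u (shift x) - u x.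
Hypothesis Nm : forall x, SA x -> N m x = 0.

Lemma birkhoff_gordin n x : SA x ->
  birkhoff f n x = n%:R * c + birkhoff m n x + u (iter n shift x) - u x.
Proof.
elim: n x => [|n IH] x sx; first by rewrite /birkhoff !big_ord0 /=; ring.
by rewrite !birkhoffS IH ?fE// ?iterSr -?[n.+1%:R]natr1; [ring|exact: SA_shift].
Qed.

Lemma int_gordin : I f = c.
Proof.
have hus := hol_shift th01 hu.
transitivity (I (fun x => (c + m x) + (u (shift x) + -1 * u x))).
  by apply: eq_int => x sx; rewrite fE//; ring.
have hcm : hol K A th (fun x => c + m x) by apply: holD => //; exact: hol_cst.
rewrite !intD ?intZ; try (by apply: bm => //; rewrite ?/bmeas; by [exact: hol_cst|exact: holZ|apply: holD => //; exact: holZ]).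
by rewrite int_cst// mz// (int_shift muSA mu_inv (bm hu)); ring.
Qed.

(** The centred sum of f differs from that of m by a coboundary of size at most 2 U. Young's
    inequality with a parameter d bounds the error by d n rho + (1 + 1/d) (2 U)^2, and d is taken
    small before n is taken large. *)
Lemma mu_variance_gordin : mu_variance K A mu f = I (fun x => m x ^+ 2).
Proof.
set rho := I _.
have hsq phi : hol K A th phi -> hol K A th (fun x => phi x ^+ 2).
  by move=> h; apply: eq_hol (holM th01 h h) => x _; rewrite expr2.
have rho0 : 0 <= rho.
  rewrite -(int_cst muSA 0); apply: le_int; [exact: bmeas_cst|exact/bm/hsq|].
  by move=> x _; exact: sqr_ge0.
have [U U0 [uU _]] := hol_pos th01 hu.
pose J n := I (fun x => (birkhoff f n x - n%:R * I f) ^+ 2).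
have hJ n : hol K A th (fun x => (birkhoff f n x - n%:R * I f) ^+ 2).
  by apply: hsq; apply: holB => //; [exact: hol_birkhoff|exact: hol_cst].
have hS n := hsq _ (hol_birkhoff th01 n hm).
pose E := (2 * U) ^+ 2.
have bound n (d : R) : 0 < d -> `|J n - n%:R * rho| <= d * (n%:R * rho) + (1 + d^-1) * E.
  move=> d0; have di : 0 < d^-1 by rewrite invr_gt0.
  have JE x : SA x -> exists D, `|D| <= 2 * U /\
      birkhoff f n x - n%:R * I f = birkhoff m n x + D.
    move=> sx; exists (u (iter n shift x) - u x); split.
      rewrite (le_trans (ler_normB _ _))// mulr_natl mulr2n lerD ?uU//.
      exact: SA_iter_shift.
    by rewrite birkhoff_gordin// int_gordin; ring.
  have D2 D : `|D| <= 2 * U -> 0 <= D ^+ 2 <= E.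
    by move=> DU; rewrite sqr_ge0/= /E -[D ^+ 2]real_normK ?num_real// lerXn2r ?nnegrE// (le_trans _ DU).
  have bS k e : bmeas K A (fun x => k * birkhoff m n x ^+ 2 + e).
    apply: bm; apply: holD => //; last exact: hol_cst.
    by apply: holZ.
  have IS k e : I (fun x => k * birkhoff m n x ^+ 2 + e) = k * (n%:R * rho) + e.
    rewrite intD; [|by apply: bm; exact: holZ|exact: bmeas_cst].
    by rewrite int_cst// intZ ?int_sqr_birkhoff//; exact: bm.
  have up : J n <= (1 + d) * (n%:R * rho) + (1 + d^-1) * E.
    rewrite -IS; apply: le_int => //; first exact: bm.
    move=> x /JE[D [/D2/andP[D20 DE] ->]]; set S := birkhoff m n x.
    have : (1 + d^-1) * D ^+ 2 <= (1 + d^-1) * E by rewrite ler_wpM2l//; lra.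
    have : 0 <= d^-1 * (d * S - D) ^+ 2 by rewrite mulr_ge0 ?sqr_ge0 ?ltW.
    have -> : d^-1 * (d * S - D) ^+ 2 = d * S ^+ 2 - 2 * S * D + d^-1 * D ^+ 2.
      by field; rewrite gt_eqF.
    by rewrite sqrrD -mulr_natr; lra.
  have lo : (1 - d) * (n%:R * rho) - d^-1 * E <= J n.
    rewrite -IS; apply: le_int => //; first exact: bm.
    move=> x /JE[D [/D2/andP[D20 DE] ->]]; set S := birkhoff m n x.
    have : d^-1 * D ^+ 2 <= d^-1 * E by rewrite ler_wpM2l// ltW.
    have : 0 <= d^-1 * (d * S + D) ^+ 2 by rewrite mulr_ge0 ?sqr_ge0 ?ltW.
    have -> : d^-1 * (d * S + D) ^+ 2 = d * S ^+ 2 + 2 * S * D + d^-1 * D ^+ 2.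
      by field; rewrite gt_eqF.
    by rewrite sqrrD -mulr_natr; lra.
  have E0 : 0 <= E by exact: sqr_ge0.
  by rewrite ler_norml; apply/andP; split; lra.
apply: cvg_lim => //; apply/cvgrPdist_le => e e0.
pose d := e / (2 * (rho + 1)).
have d0 : 0 < d by rewrite divr_gt0// mulr_gt0//; lra.
have := cvg_div_nat ((1 + d^-1) * E) => /cvgrPdist_le /(_ (e / 2)) h.
have e20 : 0 < e / 2 by rewrite divr_gt0.
have := h e20; apply: filterS2 (nbhs_infty_gt 0) => n n0.
have nR : 0 < n%:R :> R by rewrite ltr0n.
rewrite sub0r normrN => hn.
have -> : rho - n%:R^-1 * J n = - (n%:R^-1 * (J n - n%:R * rho)).
  by field; rewrite gt_eqF.
rewrite normrN normrM gtr0_norm ?invr_gt0// ler_pdivrMl//.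
apply: le_trans (bound n d d0) _.
have : d * rho <= e / 2.
  by rewrite /d mulrAC ler_pdivrMr ?mulr_gt0//; nra.
move: hn; rewrite normrM normfV (@ger0_norm _ n%:R) ?ler0n// ler_pdivrMr// => hn.
have := ler_norm ((1 + d^-1) * E) => le1 le2.
have := ler_wpM2l (ltW nR) le2; lra.
Qed.

(** The entropy sum is the integral of the step function [gs], the logarithm of the measure of the
    n-cylinder of x. By the Gibbs property it is S_n f - n P up to ln C, with mean n (c - P). *)
Lemma mu_entropy_gordin P C : 1 < C ->
  (forall x n, SA x -> (0 < n)%N ->
  C^-1 <= mu_real mu (cylx K A x n) / expR (- n%:R * P + birkhoff f n x) <= C) ->
  mu_entropy K A mu = P - c.
Proof.
move=> C1 gibbs.
have C00 : 0 < C by exact: lt_trans ltr01 C1.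
have lnC n x : SA x -> (0 < n)%N ->
   `|ln (pr mu (cylx K A x n)) - (- n%:R * P + birkhoff f n x)| <= ln C.
  move=> sx n0; have := gibbs x n sx n0; rewrite -/(pr mu (cylx K A x n)).
  set W := - n%:R * P + _; set q := pr mu _ / _ => /andP[q1 q2].
  have q0 : 0 < q by apply: lt_le_trans q1; rewrite invr_gt0.
  have -> : pr mu (cylx K A x n) = q * expR W by rewrite /q divfK// gt_eqF ?expR_gt0.
  rewrite lnM ?posrE ?expR_gt0// expRK addrK ler_norml -lnV ?posrE//.
  by rewrite !ler_ln ?posrE ?invr_gt0// q1.
pose H n := \sum_(w : n.-tuple 'I_K) pr mu (cylw K A n w) * ln (pr mu (cylw K A n w)).
have HE n : \sum_(w : n.-tuple 'I_K | adm_word K A n w)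
       mu_real mu (cylw K A n w) * ln (mu_real mu (cylw K A n w)) = H n.
  rewrite big_mkcond; apply: eq_bigr => w _; case: ifPn => // nadm.
  have -> : cylw K A n w = set0.
    rewrite -subset0 => x [[_ sx] xw]; move/negP: nadm; apply.
    apply/allP => l; rewrite mem_iota add0n => /andP[_ ln].
    have ln' : (l.+1 < n)%N by case: (n) ln.
    by rewrite -!xw ?sx// ltnW.
  by rewrite /pr measure0 mul0r.
have HI n : (0 < n)%N -> `|H n - n%:R * (c - P)| <= ln C.
  move=> n0.
  pose gs x := \sum_(w : n.-tuple 'I_K)
    ln (pr mu (cylw K A n w)) * \1_(cylw K A n w : set SeqSpace) x.
  have mw (w : n.-tuple 'I_K) : bmeas K A (fun x => ln (pr mu (cylw K A n w)) *
      \1_(cylw K A n w : set SeqSpace) x : R).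
    by apply: bmeasZ; apply: indic_bmeas; exact: measurable_cylw.
  have [bgs Igs] := int_sum muSA (index_enum (n.-tuple 'I_K)) mw.
  have gsE x : SA x -> gs x = ln (pr mu (cylx K A x n)).
    move=> sx; have [w hw] := ex_word n sx.
    have xw : cylw K A n w x by [].
    rewrite /gs (bigD1 w)//= indicE mem_set// mulr1 big1 ?addr0 => [|w' ww'].
      congr (ln (pr mu _)); apply/seteqP; split=> y [sy h]; split=> // k kn.
        by rewrite h// hw.
      by rewrite h// hw.
    rewrite indicE memNset ?mulr0// => xw'.
    by move/eqP: ww'; apply; exact: cylw_disjoint xw' xw.
  have Hgs : H n = I gs.
    rewrite Igs; apply: eq_bigr => w _.
    have mcw := measurable_cylw A w.
    have cS : cylw K A n w `<=` SA by move=> x [].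
    rewrite mulrC -(int_indic mu mcw cS).
    exact/esym/(intZ mu _ (indic_bmeas K A mcw)).
  have hW a : bmeas K A (fun x => birkhoff f n x + a).
    by apply: bm; apply: holD => //; [exact: hol_birkhoff|exact: hol_cst].
  have IW a : I (fun x => birkhoff f n x + a) = n%:R * c + a.
    rewrite intD; [|by apply: bm; exact: hol_birkhoff|exact: bmeas_cst].
    by rewrite int_cst// (int_birkhoff th01 muSA mu_inv)// int_gordin.
  have lo : I (fun x => birkhoff f n x + (- n%:R * P - ln C)) <= I gs.
    apply: le_int => // x sx; rewrite gsE//.
    by have := lnC n x sx n0; rewrite ler_norml => /andP[]; lra.
  have up : I gs <= I (fun x => birkhoff f n x + (- n%:R * P + ln C)).
    apply: le_int => // x sx; rewrite gsE//.
    by have := lnC n x sx n0; rewrite ler_norml => /andP[]; lra.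
  by move: lo up; rewrite !IW -Hgs => lo up; rewrite ler_norml; apply/andP; split; lra.
apply: cvg_lim => //; apply/cvgrPdist_le => e e0.
have := cvg_div_nat (ln C) => /cvgrPdist_le /(_ e e0).
apply: filterS2 (nbhs_infty_gt 0) => n n0.
have nR : 0 < n%:R :> R by rewrite ltr0n.
rewrite sub0r normrN => hn; rewrite HE.
have -> : P - c - - (n%:R^-1 * H n) = n%:R^-1 * (H n - n%:R * (c - P)).
  by field; rewrite gt_eqF.
rewrite normrM gtr0_norm ?invr_gt0// ler_pdivrMl//.
apply: le_trans (HI n n0) _; apply: le_trans (ler_norm _) _.
by move: hn; rewrite normrM normfV (@ger0_norm _ n%:R) ?ler0n// ler_pdivrMr// mulrC.
Qed.

End Limits.

(** * Law of the iterated logarithm *)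

Lemma measurable_lim_sup_set d (T : measurableType d) (F : nat -> set T) :
  (forall k, measurable (F k)) -> measurable (lim_sup_set F).
Proof. by move=> mF; apply: bigcapT_measurable => n; exact: bigcup_measurable. Qed.

Section Asymptotics.
Context {R : realType}.

Lemma nneseries_lt_pinfty (v : nat -> R) M : (forall k, 0 <= v k) ->
  (forall n, \sum_(0 <= k < n) v k <= M) -> (\sum_(0 <= k <oo) (v k)%:E < +oo)%E.
Proof.
move=> v0 vM; apply: (@le_lt_trans _ _ M%:E); last exact: ltry.
apply: lime_le; first by apply: is_cvg_nneseries => k _ _; rewrite lee_fin.
by apply: nearW => n; rewrite sumEFin lee_fin.
Qed.

(** The sum telescopes: delta (k+2)^-(1+delta) <= (k+1)^-delta - (k+2)^-delta, by ln ((k+1)/(k+2))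
    <= -1/(k+2) and e^v >= 1 + v. *)
Lemma sum_pseries_le (delta : R) n : 0 < delta ->
  \sum_(0 <= k < n) expR (- (1 + delta) * ln k.+1%:R) <= 1 + delta^-1.
Proof.
move=> d0; pose a k := expR (- delta * ln (k.+1%:R : R)).
have a0 : a 0%N = 1 by rewrite /a ln1 mulr0 expR0.
have key : forall n, \sum_(0 <= k < n) expR (- (1 + delta) * ln k.+2%:R) <=
    delta^-1 * (a 0%N - a n).
  elim=> [|k IH]; first by rewrite big_nil subrr mulr0.
  rewrite big_nat_recr//=.
  have -> : delta^-1 * (a 0%N - a k.+1) = delta^-1 * (a 0%N - a k) + delta^-1 * (a k - a k.+1).
    by ring.
  rewrite lerD// -ler_pdivrMl ?invr_gt0// invrK.
  have k1 : 0 < k.+1%:R :> R by rewrite ltr0n.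
  have k2 : 0 < k.+2%:R :> R by rewrite ltr0n.
  have e1 : a k = a k.+1 * expR (- delta * ln (k.+1%:R / k.+2%:R)).
    by rewrite /a -expRD -mulrDr ln_div ?posrE// addrC subrK.
  have e2 : expR (- (1 + delta) * ln k.+2%:R) = a k.+1 * k.+2%:R^-1.
    by rewrite /a -[X in _ * X^-1](lnK (x := k.+2%:R)) ?posrE// -expRN -expRD; congr expR; ring.
  rewrite e2 e1; have ak := expR_gt0 (- delta * ln (k.+2%:R : R)).
  have -> : a k.+1 * expR (- delta * ln (k.+1%:R / k.+2%:R)) - a k.+1 =
    a k.+1 * (expR (- delta * ln (k.+1%:R / k.+2%:R)) - 1) by ring.
  rewrite mulrCA ler_pM2l//.
  have l1 : ln (k.+1%:R / k.+2%:R : R) <= - k.+2%:R^-1.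
    have -> : k.+1%:R / k.+2%:R = 1 + (- k.+2%:R^-1) :> R.
      by rewrite -[k.+2]addn1 natrD -[in RHS](divff (lt0r_neq0 k2)); field; rewrite gt_eqF.
    apply: le_ln1Dx; rewrite ltrN2 invf_lt1// ltr1n //.
  have := expR_ge1Dx (- delta * ln (k.+1%:R / k.+2%:R)).
  have : delta * ln (k.+1%:R / k.+2%:R) <= delta * (- k.+2%:R^-1) by rewrite ler_wpM2l// ltW.
  by rewrite mulrN !mulNr; move: (delta * _) (delta * _) => X Y; lra.
case: n => [|n]; first by rewrite big_nil addr_ge0// invr_ge0 ltW.
rewrite big_nat_recl// ln1 mulr0 expR0 lerD2l (le_trans (key n))// a0.
by rewrite ler_piMr ?invr_ge0 ?(ltW d0)// gerBl expR_ge0.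
Qed.

(** Since ln ln s <= 2 sqrt s, the quotient under the root is at most 4 / (rho sqrt s), hence at
    most eta^2 once sqrt s >= q. The other summands of the threshold give the first and the last
    bound. *)
Lemma large_scale (rho eta L : R) : 0 < rho -> 0 < eta ->
  exists S0, 0 < S0 /\ forall s, S0 <= s ->
    [/\ 1 <= ln (ln s), Num.sqrt (2 * ln (ln s) / (rho * s)) <= eta &
        L <= Num.sqrt (2 * rho * s * ln (ln s))].
Proof.
move=> r0 e0.
pose q := 4 / (rho * eta ^+ 2).
have q0 : 0 < q by rewrite divr_gt0// mulr_gt0// exprn_gt0.
exists (expR (expR 1) + q ^+ 2 + L ^+ 2 / (2 * rho)).
have L0 : 0 <= L ^+ 2 / (2 * rho) by rewrite divr_ge0 ?sqr_ge0// mulr_ge0// ltW.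
have qq : 0 < q ^+ 2 by rewrite exprn_gt0.
have ee := expR_gt0 (expR 1 : R).
split=> [|s hs]; first by lra.
have s0 : 0 < s by lra.
have ls : expR 1 <= ln s by rewrite -[leLHS]expRK ler_ln ?posrE ?expR_gt0//; lra.
have ls0 : 0 < ln s by apply: lt_le_trans ls; exact: expR_gt0.
have l1 : 1 <= ln (ln s).
  by rewrite -[leLHS]expRK ler_ln ?posrE ?expR_gt0.
have ss0 : 0 < Num.sqrt s by rewrite sqrtr_gt0.
have lns : ln (ln s) <= 2 * Num.sqrt s.
  have i1 : ln (ln s) <= ln s.
    by have := ln_sublinear ls0; exact: ltW.
  have i2 : ln s = 2 * ln (Num.sqrt s).
    by rewrite -{1}[s](sqr_sqrtr (ltW s0)) lnXn// mulr_natl.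
  have := ln_sublinear ss0; lra.
split=> //.
  rewrite -[leRHS]ger0_norm ?(ltW e0)// -sqrtr_sqr ler_wsqrtr//.
  rewrite ler_pdivrMr ?mulr_gt0//.
  have qs : q <= Num.sqrt s.
    rewrite -[leLHS]ger0_norm ?(ltW q0)// -sqrtr_sqr ler_wsqrtr//; lra.
  have : q * Num.sqrt s <= s.
    by rewrite -[leRHS](sqr_sqrtr (ltW s0)) expr2 ler_wpM2r// ltW.
  rewrite /q mulrAC ler_pdivrMr ?mulr_gt0 ?exprn_gt0//; lra.
apply: le_trans (ler_norm L) _; rewrite -sqrtr_sqr ler_wsqrtr//.
have h : L ^+ 2 / (2 * rho) <= s by lra.
rewrite ler_pdivrMr ?mulr_gt0// in h.
have : 0 <= (2 * rho * s) * (ln (ln s) - 1) by rewrite mulr_ge0 ?mulr_ge0 ?subr_ge0// ltW.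
lra.
Qed.

(** Integer block ends with ratios between 1 + 1/r and 1 + 2/r. The initial value r makes every
    quotient by r at least 1, which absorbs the added 1 in the upper ratio. *)
Fixpoint block (r k : nat) : nat := if k is k'.+1 then
  (block r k' + block r k' %/ r + 1)%N else r.

Lemma block_ge r k : (r <= block r k)%N.
Proof. by elim: k => //= k IH; rewrite (leq_trans IH)// -addnA leq_addr. Qed.

Lemma block_mono r k : (block r k < block r k.+1)%N.
Proof. by rewrite /= addn1 ltnS leq_addr. Qed.

Lemma block_growth r k : (0 < r)%N -> (1 + r%:R^-1) ^+ k <= (block r k)%:R :> R.
Proof.
move=> r0; have rR : 0 < r%:R :> R by rewrite ltr0n.
elim: k => [|k IH] /=; first by rewrite expr0 ler1n.
rewrite exprSr mulrDr mulr1 -addnA natrD lerD//.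
apply: (@le_trans _ _ ((block r k)%:R * r%:R^-1)).
  by rewrite ler_wpM2r// invr_ge0 ltW.
rewrite ler_pdivrMr// -natrM ler_nat addn1 ltnW//.
exact: ltn_ceil.
Qed.

Lemma block_step r k : (0 < r)%N -> (block r k.+1)%:R <= (1 + 2 / r%:R) * (block r k)%:R :> R.
Proof.
move=> r0; have rR : 0 < r%:R :> R by rewrite ltr0n.
rewrite /= -addnA natrD mulrDl mul1r lerD2l natrD.
have i1 : (block r k %/ r)%:R <= (block r k)%:R / r%:R :> R.
  by rewrite ler_pdivlMr// -natrM ler_nat leq_trunc_div.
have i2 : 1 <= (block r k)%:R / r%:R :> R.
  by rewrite ler_pdivlMr// mul1r ler_nat block_ge.
lra.
Qed.

Lemma block_cover r n k0 : (block r k0 < n)%N -> exists k, [/\ (k0 <= k)%N,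
  (block r k < n)%N & (n <= block r k.+1)%N].
Proof.
move=> h.
have ex : exists k, (n <= block r (k0 + k))%N.
  exists n; elim: n {h} => // n IH; rewrite addnS.
  by rewrite (leq_trans _ (block_mono _ _)).
have [k hk kmin] := ex_minnP ex.
case: k hk kmin => [|k] hk kmin; first by move: hk; rewrite addn0 leqNgt h.
exists (k0 + k)%N; split; rewrite ?leq_addr -?addnS//.
by rewrite ltnNge; apply/negP => /kmin; rewrite ltnn.
Qed.

End Asymptotics.

(** * Exceedances in geometric blocks *)

Section IteratedLogarithm.
Context {R : realType}.
Variables (K : nat) (A : nat -> nat -> nat) (th C' : R) (G : Seq -> R).
Variable mu : probability SeqSpace R.
Notation SA := (Sigma_A K A).
Notation N := (tr K A G).
Implicit Types (x y : Seq) (phi Phi : Seq -> R).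
Hypothesis th01 : 0 < th < 1.
Hypothesis mu_inv : shift_invariant mu.
Hypothesis C0 : 0 < C'.
Hypothesis G0 : forall x, SA x -> 0 < G x.
Hypothesis N1 : forall x, SA x -> N (fun=> 1) x = 1.
Hypothesis transfer : forall n Phi q (B : set SeqSpace), measurable B -> B `<=` SA ->
  (forall x, SA x -> 0 <= Phi x) ->
  (forall x y, B y -> SA x -> agree n x y -> 1 <= Phi x) ->
  (forall x, SA x -> iter n N Phi x <= q) -> pr mu B <= C' * q.
Variables (m : Seq -> R) (D rho E t0 : R).
Hypothesis hm : hol K A th m.
Hypothesis mD : forall x, SA x -> `|m x| <= D.
Hypothesis Nm : forall x, SA x -> N m x = 0.
Hypothesis D0 : 0 < D.
Hypothesis rho0 : 0 < rho.
Hypothesis E0 : 0 <= E.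
Hypothesis t00 : 0 < t0.
Hypothesis sharp : forall t, 0 <= t <= t0 -> forall n x, SA x ->
    iter n N (fun y => expR (t * birkhoff m n y)) x <=
      3 * expR (n%:R * (rho * t ^+ 2 / 2 + E * t ^+ 3)).

Lemma pr_iter_shift n (H : set SeqSpace) (B : set SeqSpace) : measurable H -> measurable B ->
  (forall x, B x -> H (iter n shift x)) -> pr mu B <= pr mu H.
Proof.
move=> mH mB BH.
suff [mP e] : measurable ((iter n shift : SeqSpace -> SeqSpace) @^-1` H : set SeqSpace) /\
    mu ((iter n shift : SeqSpace -> SeqSpace) @^-1` H) = mu H.
  by rewrite [leRHS]/pr -e; apply: le_pr.
elim: n {BH} => [//|n [IH1 IH2]].
have -> : (iter n.+1 shift : SeqSpace -> SeqSpace) @^-1` H =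
  (shift : SeqSpace -> SeqSpace) @^-1` ((iter n shift : SeqSpace -> SeqSpace) @^-1` H).
  by apply/seteqP; split=> x; rewrite /preimage /= -iterSr.
split; last by rewrite mu_inv.
by rewrite -[X in measurable X]setTI; apply: measurable_shift.
Qed.

Definition lil s := Num.sqrt (2 * rho * s * ln (ln s)).

Definition exceeds e r k : set SeqSpace := [set x | SA x /\
  exists2 n, (block r k < n <= block r k.+1)%N & (1 + e) * lil n%:R < birkhoff m n x].

Lemma measurable_exceeds e r k : measurable (exceeds e r k).
Proof.
apply: (@measurable_relopen K A) => [x [sx _] //|x [sx [n nk hn]]].
have [j hj] := hol_lt_open th01 (hol_birkhoff th01 n hm) sx hn.
by exists j => y sy yx; split=> //; exists n => //; exact: hj.
Qed.

Lemma pr_exceeds e : 0 < e -> e <= 1 -> exists r k0 Q, [/\ (0 < r)%N, 0 <= Q &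
  forall k, (k0 <= k)%N ->
    [/\ 1 <= ln (ln ((block r k)%:R : R)) &
    pr mu (exceeds e r k) <= Q * expR (- (1 + e / 2) * ln (ln (block r k)%:R))]].
Proof.
move=> e0 e1.
(* With [l = ln (ln s)] at the left end [s] of a block, [t = sqrt (2 l / (rho s))] is optimal for
   the right end of the block and [r] keeps its length below [1 + e / 8]; the tail sums inside the
   block have at most [2 s / r] terms, so a large [r] makes the cruder bound with [q t] enough. *)
have [V1 [V10 hV1]] := pr_birkhoff_gt th01 transfer hm.
have hm' := holN th01 hm.
have mD' x : SA x -> `|- m x| <= D by move=> sx; rewrite normrN mD.
have Nm' x : SA x -> N (fun y => - m y) x = 0.
  move=> sx; have -> : (fun y => - m y) = (fun y => -1 * m y).
    by apply/funext => y; rewrite mulN1r.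
  by rewrite -[N _]/(iter 1 N _) iter_trZ /= Nm// mulr0.
have [V2 [V20 hV2]] := pr_hits th01 G0 N1 transfer hm' mD' Nm'.
(* As t a = 2 l, the exponent q t (e/2) a of the tail event is 4 l. This covers the l granted to its
   variance and the required (1 + e/2) l, since e <= 1. *)
pose q := 4 / e.
have q0 : 0 < q by rewrite divr_gt0.
pose r := (Num.trunc (16 / e + 4 * q ^+ 2 * D ^+ 2 / rho)).+1.
have rR : 0 < r%:R :> R by rewrite ltr0n.
have r1 : 16 / e <= r%:R.
  apply: ltW; apply: le_lt_trans (truncnS_gt _); rewrite lerDl divr_ge0 ?(ltW rho0)//.
  by rewrite mulr_ge0 ?sqr_ge0// mulr_ge0 ?sqr_ge0.
have r2 : 4 * q ^+ 2 * D ^+ 2 / rho <= r%:R.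
  by apply: ltW; apply: le_lt_trans (truncnS_gt _); rewrite lerDr divr_ge0// ltW.
(* These are the conditions on t: [t0] for the sharp estimate, 1 and 1/q to absorb t V1 and q t V2,
   rho e / (16 (E + 1)) to keep the cubic term within a relative e/8, and 1 / (2 q D) for the
   maximal inequality. *)
pose eta := Num.min (Num.min t0 1) (Num.min (rho * e / (16 * (E + 1)))
  (Num.min (1 / (2 * q * D)) (1 / q))).
have E10 : 0 < E + 1 by rewrite ltr_wpDl.
have qD : 0 < 2 * q * D by rewrite mulr_gt0// mulr_gt0.
have re : 0 < rho * e by rewrite mulr_gt0.
have E16 : 0 < 16 * (E + 1) by rewrite mulr_gt0.
have eta0 : 0 < eta by rewrite !lt_min t00 ltr01 !divr_gt0.
have [S0 [S00 hS]] := large_scale (2 * V2 / e) rho0 eta0.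
have [k0 hk0] : exists k0, forall k, (k0 <= k)%N -> S0 <= (block r k)%:R.
  exists (Num.trunc (S0 * r%:R)).+1 => k kk.
  apply: le_trans (block_growth k (ltn0Sn _)).
  have bern : 1 + k%:R * r%:R^-1 <= (1 + r%:R^-1) ^+ k :> R.
    elim: (k) => [|j IH]; first by rewrite mul0r addr0 expr0.
    have ri : 0 <= r%:R^-1 :> R by rewrite invr_ge0 ltW.
    rewrite exprS -[j.+1%:R]natr1.
    apply: (@le_trans _ _ ((1 + r%:R^-1) * (1 + j%:R * r%:R^-1))).
      have : 0 <= r%:R^-1 * (j%:R * r%:R^-1) :> R by rewrite !mulr_ge0.
      lra.
    by rewrite ler_wpM2l// addr_ge0.
  apply: le_trans bern; rewrite ler_wpDl// ler_pdivlMr//.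
  apply: ltW; apply: lt_le_trans (truncnS_gt _) _; rewrite ler_nat.
  exact: kk.
exists r, k0, (C' * (3 * expR V1 + expR V2)); split=> //.
  by rewrite mulr_ge0 ?(ltW C0)// addr_ge0 ?mulr_ge0 ?expR_ge0.
move=> k kk; have [l1 te aL] := hS _ (hk0 _ kk).
have s0 : 0 < (block r k)%:R :> R by apply: lt_le_trans (hk0 _ kk).
set s := (block r k)%:R in s0 l1 te aL *.
set l := ln (ln s) in l1 te aL *.
split=> //.
set t := Num.sqrt _ in te; set a := Num.sqrt _ in aL.
have tt0 : 0 <= t by exact: sqrtr_ge0.
have l0 : 0 < l by lra.
have rs0 : 0 < rho * s by rewrite mulr_gt0.
have lrs : 0 <= 2 * l / (rho * s) by apply: divr_ge0; [apply: mulr_ge0 => //|]; exact: ltW.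
have eq_ta : t * a = 2 * l.
  rewrite /t /a -sqrtrM//.
  have -> : 2 * l / (rho * s) * (2 * rho * s * l) = (2 * l) ^+ 2.
    by field; rewrite !gt_eqF.
  by rewrite sqrtr_sqr ger0_norm// mulr_ge0// ltW.
have t2 : t ^+ 2 = 2 * l / (rho * s) by rewrite sqr_sqrtr.
have [tt1 t1 tE tD tq] : [/\ t <= t0, t <= 1, 16 * (E + 1) * t <= rho * e,
   q * t * D <= 1 / 2 & q * t <= 1].
  move: te; rewrite !le_min => /andP[/andP[h1 h2] /and3P[h3 h4 h5]].
  split=> //.
  - by move: h3; rewrite ler_pdivlMr// mulrC.
  - have -> : q * t * D = t * (2 * q * D) / 2 by field.
    by rewrite ler_wpM2r ?invr_ge0// -ler_pdivlMr.
  - by move: h5; rewrite ler_pdivlMr// mulrC.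
pose B1 : set SeqSpace := [set x | SA x /\ (1 + e / 2) * a < birkhoff m (block r k.+1) x].
pose d := (block r k.+1 - block r k)%N.
pose H : set SeqSpace := [set x | SA x /\ hits (fun x => - m x) (e / 2 * a) d x].
pose B2 : set SeqSpace := [set x | SA x /\ hits (fun x => - m x) (e / 2 * a) d
   (iter (block r k) shift x)].
have mB1 : measurable B1.
  exact: (measurable_birkhoff_gt th01 (block r k.+1) ((1 + e / 2) * a) hm).
have mH : measurable H.
  exact: (measurable_hits th01 (e / 2 * a) d hm').
have mB2 : measurable B2.
  apply: (@measurable_relopen K A) => [x [sx _] //|x [sx [j jd hj]]].
  have hh := hol_iter_shift th01 (block r k)
    (hol_iter_shift th01 j (hol_birkhoff th01 (d - j) hm')).
  have [i hi] := hol_lt_open th01 hh sx hj.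
  by exists i => y sy yx; split=> //; exists j => //; exact: hi.
(* If the sum at the right end does not exceed (1 + e/2) a although S_n does exceed (1 + e) a, then
   the sum from n to the right end is below -(e/2) a: a hit for -m, seen from the left end. *)
have sub : forall x, exceeds e r k x -> B1 x \/ B2 x.
  move=> x [sx [n /andP[nk nk1] hn]].
  have [h|h] := ltP ((1 + e / 2) * a) (birkhoff m (block r k.+1) x).
    by left.
  right; split=> //; exists (n - block r k)%N; first by rewrite leq_sub2r.
  have -> : (d - (n - block r k))%N = (block r k.+1 - n)%N.
    by rewrite /d subnBA ?(ltnW nk)// subnK// (ltnW (block_mono _ _)).
  rewrite -iterD subnK ?(ltnW nk)//.
  have -> : birkhoff (fun x => - m x) (block r k.+1 - n) (iter n shift x) =
     birkhoff m n x - birkhoff m (block r k.+1) x.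
    have := birkhoffD m n (block r k.+1 - n) x; rewrite subnKC// => ->.
    by rewrite [LHS]sumrN /birkhoff; ring.
  have an : a <= lil n%:R.
    have sn : s <= n%:R by rewrite ler_nat ltnW.
    have ls0 : 0 < ln s.
      by rewrite ltNge; apply/negP => /ln0 ls; move: l0; rewrite /l ls ltxx.
    have lsn : ln s <= ln n%:R by rewrite ler_ln ?posrE// (lt_le_trans s0).
    rewrite ler_wsqrtr// ler_pM ?mulr_ge0 ?(ltW rho0) ?(ltW s0) ?(ltW l0)//.
      by rewrite ler_wpM2l// mulr_ge0// ltW.
    by rewrite ler_ln ?posrE// (lt_le_trans ls0).
  have : (1 + e) * a <= (1 + e) * lil n%:R by rewrite ler_wpM2l//; lra.
  lra.
have pB1 : pr mu B1 <= C' * (3 * expR V1) * expR (- (1 + e / 2) * l).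
  have tt : 0 <= t <= t0 by rewrite tt0.
  apply: le_trans (hV1 _ _ t _ tt0 (sharp tt (block r k.+1))) _.
  rewrite -!mulrA ler_wpM2l ?(ltW C0)// mulrCA ler_wpM2l// -!expRD ler_expR.
  have b1 : t * V1 <= V1 by rewrite ler_piMl.
  have nN : (block r k.+1)%:R <= (1 + e / 8) * s.
    apply: le_trans (block_step k (ltn0Sn _)) _; rewrite ler_wpM2r ?(ltW s0)// lerD2l.
    rewrite ler_pdivrMr//; move: r1; rewrite ler_pdivrMr//; move: (r%:R) => rr; lra.
  have tsl : rho * t ^+ 2 / 2 + E * t ^+ 3 <= (1 + e / 8) * (l / s).
    have -> : rho * t ^+ 2 / 2 + E * t ^+ 3 = (1 + 2 * E * t / rho) * (l / s).
      by rewrite [t ^+ 3]exprS t2; field; rewrite !gt_eqF.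
    rewrite ler_wpM2r ?divr_ge0 ?(ltW l0) ?(ltW s0)// lerD2l ler_pdivrMr//; lra.
  have -> : t * (V1 - (1 + e / 2) * a) = t * V1 - (1 + e / 2) * (t * a) by ring.
  rewrite eq_ta.
  have : (block r k.+1)%:R * (rho * t ^+ 2 / 2 + E * t ^+ 3) <=
      ((1 + e / 8) * s) * ((1 + e / 8) * (l / s)).
    have h1 : 0 <= rho * t ^+ 2 / 2.
      by apply: divr_ge0 => //; apply: mulr_ge0; [exact: ltW|exact: sqr_ge0].
    have h2 : 0 <= E * t ^+ 3 by apply: mulr_ge0 => //; exact: exprn_ge0.
    by apply: ler_pM => //; exact: addr_ge0.
  have -> : ((1 + e / 8) * s) * ((1 + e / 8) * (l / s)) = (1 + e / 8) ^+ 2 * l.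
    by field; rewrite gt_eqF.
  (* One factor 1 + e/8 comes from the block length, the other from the cubic term. Of the gain 2 (1
     + e/2) l, exactly (1 + e/2) l remains. *)
  have : (1 + e / 8) ^+ 2 * l <= (1 + e / 2) * l.
    by rewrite ler_wpM2r ?(ltW l0)// expr2; nra.
  lra.
have pB2 : pr mu B2 <= C' * expR V2 * expR (- (1 + e / 2) * l).
  have sH := pr_iter_shift (n := block r k) mH mB2.
  apply: le_trans (sH _) _.
    by move=> x [sx hx]; split=> //; exact: SA_iter_shift.
  have qt0 : 0 <= q * t by rewrite mulr_ge0// ltW.
  have Vl : V2 <= e / 2 * a.
    by move: aL; rewrite ler_pdivrMr//; lra.
  apply: le_trans (hV2 d (e / 2 * a) (q * t) qt0 tD Vl) _.
  rewrite -[leRHS]mulrA ler_wpM2l ?(ltW C0)// -!expRD ler_expR.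
  have b2 : q * t * V2 <= V2 by rewrite ler_piMl.
  have e3 : q * t * (e / 2 * a) = 4 * l.
    have -> : q * t * (e / 2 * a) = q * e / 2 * (t * a) by field.
    by rewrite eq_ta /q; field; rewrite gt_eqF.
  have dn : d%:R <= 2 / r%:R * s.
    have := block_step (R := R) k (ltn0Sn _ : (0 < r)%N).
    rewrite /d natrB ?(ltnW (block_mono _ _))//; rewrite -/s; lra.
  have i1 : d%:R * ((q * t) ^+ 2 * D ^+ 2) <= 2 / r%:R * s * ((q * t) ^+ 2 * D ^+ 2).
    by rewrite ler_wpM2r// mulr_ge0 ?sqr_ge0.
  have e2 : 2 / r%:R * s * ((q * t) ^+ 2 * D ^+ 2) = (4 * q ^+ 2 * D ^+ 2 / rho) / r%:R * l.
    by rewrite exprMn t2; field; rewrite !gt_eqF.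
  have i2 : (4 * q ^+ 2 * D ^+ 2 / rho) / r%:R * l <= l.
    by rewrite ler_piMl ?(ltW l0)// ler_pdivrMr// mul1r.
  have i3 : e / 2 * l <= l by rewrite ler_piMl ?(ltW l0)//; lra.
  rewrite e2 in i1; rewrite mulrBr e3.
  lra.
apply: (@le_trans _ _ (\sum_(b <- [:: true; false]) pr mu (if b then B1 else B2))).
  apply: pr_le_sum; first exact: measurable_exceeds.
    by case.
  by move=> x /sub[h|h]; [exists true|exists false].
rewrite !big_cons big_nil addr0; lra.
Qed.

(** The logarithm of a block end grows linearly with its index, so the bounds on exceedances form a
    convergent series of powers with exponent 1 + e/2. The offset k0 + 1 enters the valid range and
    keeps the linear bound positive from index 0. *)
Lemma iterated_logarithm_le e : 0 < e -> e <= 1 -> exists2 Z : set SeqSpace, mu.-negligible Z &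
  forall x, SA x -> ~ Z x -> exists N0, forall n, (N0 <= n)%N ->
    birkhoff m n x <= (1 + e) * lil n%:R.
Proof.
move=> e0 e1; have [r [k0 [Q [r0 Q0 hk]]]] := pr_exceeds e0 e1.
have rR : 0 < r%:R :> R by rewrite ltr0n.
pose F k := exceeds e r (k + k0.+1).
pose c := ln (1 + r%:R^-1 : R).
have c0 : 0 < c by rewrite ln_gt0// ltrDl invr_gt0.
have Fk k : pr mu (F k) <= Q * expR (- (1 + e / 2) * ln c) *
    expR (- (1 + e / 2) * ln k.+1%:R).
  have [l1 le1] := hk (k + k0.+1)%N (leq_trans (leqnSn _) (leq_addl _ _)).
  apply: le_trans le1 _; rewrite -mulrA ler_wpM2l// -expRD ler_expR -mulrDr !mulNr lerN2.
  rewrite ler_wpM2l ?addr_ge0 ?divr_ge0 ?(ltW e0)//.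
  have k1 : 0 < k.+1%:R :> R by rewrite ltr0n.
  rewrite -lnM ?posrE//.
  have r1 : 0 < 1 + r%:R^-1 :> R by rewrite addr_gt0// invr_gt0.
  have i1 : c * k.+1%:R <= ln (block r (k + k0.+1))%:R.
    apply: (@le_trans _ _ (ln ((1 + r%:R^-1) ^+ (k + k0.+1)))).
      by rewrite lnXn// -[leRHS]mulr_natr -/c ler_wpM2l ?(ltW c0)// ler_nat -addSnnS leq_addr.
    have g := block_growth (R := R) (k + k0.+1) r0.
    have p0 := exprn_gt0 (k + k0.+1) r1.
    by rewrite ler_ln ?posrE// (lt_le_trans p0).
  by rewrite ler_ln ?posrE ?mulr_gt0// (lt_le_trans _ i1)// mulr_gt0.
have mF k : measurable (F k) by exact: measurable_exceeds.
exists (lim_sup_set F).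
  apply/(negligibleP _ (measurable_lim_sup_set mF)).
  apply: lim_sup_set_cvg0 => //.
  rewrite (eq_eseriesr (g := fun k => (pr mu (F k))%:E)); last by move=> k _; rewrite -prE.
  apply: (nneseries_lt_pinfty (M := Q * expR (- (1 + e / 2) * ln c) * (1 + (e / 2)^-1))).
    by move=> k; exact: pr_ge0.
  move=> n; apply: (@le_trans _ _ (\sum_(0 <= k < n) Q * expR (- (1 + e / 2) * ln c) *
    expR (- (1 + e / 2) * ln k.+1%:R))).
    by apply: ler_sum => k _; exact: Fk.
  rewrite -mulr_sumr ler_wpM2l ?mulr_ge0 ?expR_ge0//.
  by apply: sum_pseries_le; rewrite divr_gt0.
move=> x sx nZ.
have [K1 hK1] : exists K1, forall k, (K1 <= k)%N -> ~ F k x.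
  apply: contrapT => ne; apply: nZ => n _.
  apply: contrapT => nk; apply: ne; exists n => k nk' Fkx; apply: nk.
  by exists k.
exists (block r (K1 + k0.+1)).+1 => n hn.
have [k [kK kn nk]] := block_cover hn.
rewrite leNgt; apply/negP => lt; apply: (hK1 (k - k0.+1)%N).
  by rewrite leq_subRL ?(leq_trans _ kK) ?leq_addl// addnC.
rewrite /F subnK; last by rewrite (leq_trans _ kK)// leq_addl.
by split=> //; exists n => //; rewrite kn.
Qed.

End IteratedLogarithm.

(** * Recurrence *)

Section Returns.
Context {R : realType}.
Variables (K : nat) (A : nat -> nat -> nat) (f : Seq -> R) (P C : R).
Variable mu : probability SeqSpace R.
Notation SA := (Sigma_A K A).
Notation g := (weight f P).
Implicit Types (x y : Seq).
Hypothesis K2 : (2 <= K)%N.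
Hypothesis muSA : mu SA = 1%E.
Hypothesis C1 : 1 < C.
Hypothesis gibbs : forall x n, SA x -> (0 < n)%N ->
  C^-1 <= mu_real mu (cylx K A x n) / expR (- n%:R * P + birkhoff f n x) <= C.

Definition returns n p : set SeqSpace :=
  [set x | SA x /\ forall i, (i < p)%N -> x (n + i)%N = x i].

Lemma measurable_returns n p : measurable (returns n p).
Proof.
apply: (@measurable_loccst K A (fun x => forall i, (i < p)%N -> x (n + i)%N = x i) (n + p)).
move=> x y sx sy yx h i ip; rewrite !yx ?h ?ltn_add2l//.
by rewrite (leq_trans ip)// leq_addl.
Qed.

Lemma dist_leE n p x : dist K (iter n shift x) x <= (K%:R : R) ^- p <->
  forall i, (i < p)%N -> x (n + i)%N = x i.
Proof.
have K0 : 0 < K%:R :> R by rewrite ltr0n ltnW.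
have th01 : 0 < (K%:R^-1 : R) < 1 by rewrite invr_gt0 K0 invf_lt1// ltr1n.
split=> [|h]; last first.
  rewrite -exprVn; apply: (apow_wedge_le th01) => i ip.
  by rewrite iter_shiftE h.
rewrite /dist /wedge; case: pselect => [H|nH] /= h i ip; last first.
  by rewrite -iter_shiftE; apply/eqP/negPn/negP => ne; apply: nH; exists i.
rewrite -iter_shiftE; move: h; case: ex_minnP => k _ kmin.
rewrite -exprVn => h; apply/eqP/negPn/negP => /kmin ki.
have [t0 t1] := andP th01.
by move: h; rewrite leNgt ltr_iXn2l// (leq_ltn_trans ki ip).
Qed.

Lemma gprodD n p y : gprod g (n + p) y = gprod g n y * gprod g p (iter n shift y).
Proof.
elim: n y => [|n IH] y; first by rewrite /gprod big_ord0 mul1r.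
by rewrite addSn !gprodS IH mulrA -iterSr.
Qed.

(* On a cylinder of length [n] a return to [p] letters prescribes the first [n + p] letters,
   also when [p > n]; quasi-independence then makes each cylinder pay a factor [q]. *)
Lemma pr_returns_le n p q (B : set SeqSpace) : (0 < n)%N -> 0 <= q -> measurable B ->
  B `<=` returns n p -> (forall x, B x -> pr mu (cylx K A x p) <= q) ->
  pr mu B <= C ^+ 3 * q.
Proof.
move=> n0 q0 mB Bret Bq; have C0 : 0 < C by exact: lt_trans ltr01 C1.
have Cq : 0 <= C ^+ 3 * q by rewrite mulr_ge0// exprn_ge0// ltW.
apply: (@le_trans _ _ (\sum_(w : n.-tuple 'I_K) pr mu (B `&` cylw K A n w))).
  apply: pr_le_sum => // [w|x Bx].
    by apply: measurableI => //; exact: measurable_cylw.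
  have [sx _] := Bret _ Bx; have [w hw] := ex_word n sx.
  by exists w; [rewrite mem_index_enum|split].
rewrite -[leRHS]mulr1; apply: le_trans (ler_wpM2l Cq (sum_cylw_le1 muSA n)).
rewrite mulr_sumr; apply: ler_sum => w _.
have mcw := measurable_cylw A w.
have [[x [Bx xw]]|ne] := pselect (exists x, (B `&` cylw K A n w) x); last first.
  have -> : B `&` cylw K A n w = set0 by rewrite -subset0 => x hx; apply: ne; exists x.
  by rewrite {1}/pr measure0 mulr_ge0 ?pr_ge0.
have [sx xret] := Bret _ Bx; have [_ xw'] := xw.
have ->: pr mu (cylw K A n w) = pr mu (cylx K A x n).
  congr (pr mu _); apply/seteqP; split=> y [sy h]; split=> // k kn.
    by rewrite h// xw'.
  by rewrite h// xw'.
have snx := SA_iter_shift n sx.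
have cyl_ret : cylx K A (iter n shift x) p = cylx K A x p.
  apply/seteqP; split=> y [sy h]; split=> // k kp.
    by rewrite h// iter_shiftE xret.
  by rewrite h// iter_shiftE xret.
apply: (@le_trans _ _ (pr mu (cylx K A x (n + p)))).
  apply: le_pr; [exact: measurableI|exact: measurable_cylx|].
  move=> y [By [sy yw]]; split=> // k; have [_ yret] := Bret _ By.
  (* In y as in x, a letter at k >= n repeats the one at k - n, an earlier position because n > 0.
     No bound on p by n is involved. *)
  elim/ltn_ind: k => k IH knp.
  have [kn|nk] := ltnP k n; first by rewrite yw// -xw'.
  have kp : (k - n < p)%N by rewrite ltn_subLR.
  rewrite -(subnKC nk) yret// xret// IH//.
    by rewrite -[X in (_ < X)%N]subn0 ltn_sub2l// (leq_trans n0).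
  by rewrite (leq_trans kp)// leq_addl.
(* One Gibbs inequality for length n + p and one for each of its two pieces give C^3; the return
   identifies the cylinder of the second piece with that of x. *)
have [h1 _] := gibbs_cylx muSA C1 gibbs (n + p) sx.
have [_ h2] := gibbs_cylx muSA C1 gibbs n sx.
have [_ h3] := gibbs_cylx muSA C1 gibbs p snx.
apply: (le_trans h1); rewrite gprodD.
have gp k z : 0 <= gprod g k z by rewrite gprod_weight expR_ge0.
have h4 : gprod g n x * gprod g p (iter n shift x) <=
    (C * pr mu (cylx K A x n)) * (C * q).
  rewrite ler_pM// (le_trans h3)// cyl_ret ler_wpM2l ?Bq//; exact: ltW.
apply: le_trans (ler_wpM2l (ltW C0) h4) _.
by rewrite le_eqVlt; apply/orP; left; apply/eqP; ring.
Qed.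

End Returns.

(** * Assembling the theorem *)

Lemma hol_continuous {R : realType} K A (th : R) phi : (2 <= K)%N -> 0 < th < 1 ->
  hol K A th phi -> continuous_on_SA K A phi.
Proof.
move=> K2 th01 [C [_ h]] x sx e e0; have [t0 t1] := andP th01.
have K0 : 0 < K%:R :> R by rewrite ltr0n ltnW.
have K1 : K%:R^-1 < 1 :> R by rewrite invf_lt1// ltr1n.
have C1 : 0 < `|C| + 1 by rewrite ltr_wpDl.
have eC : 0 < e / (`|C| + 1) by rewrite divr_gt0.
have /cvgrPdist_lt /(_ _ eC) [k _ hk] : th ^+ n @[n --> \oo] --> (0 : R).
  by apply: cvg_expr; rewrite gtr0_norm.
exists (K%:R ^- k); first by rewrite invr_gt0 exprn_gt0.
move=> y sy; rewrite -exprVn => dk.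
have a : agree k x y.
  move=> i ik; apply/eqP/negPn/negP => ne; move: dk.
  rewrite /dist /wedge; case: pselect => [H|nH] /=; last by case: nH; exists i.
  case: ex_minnP => j _ /(_ i ne) ji.
  by rewrite ltr_iXn2l ?invr_gt0// ltnNge (leq_trans ji)// ltnW.
have := hk k (leqnn k) => /=; rewrite sub0r normrN ger0_norm ?exprn_ge0 ?(ltW t0)//.
rewrite ltr_pdivlMr// => l1.
apply: le_lt_trans (h k x y sx sy a) _; apply: le_lt_trans l1.
rewrite mulrC ler_wpM2l ?exprn_ge0 ?(ltW t0)// (le_trans (ler_norm C))// lerDl//.
Qed.

Lemma holder_hol {R : realType} K A (b th : R) (f : Seq -> R) : 0 < b -> 0 < th < 1 ->
  (forall x y, Sigma_A K A x -> Sigma_A K A y -> `|f x - f y| <= b * apow th (wedge x y)) ->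
  hol K A th f.
Proof.
move=> b0 th01 h; have [[x0 sx0]|ne] := pselect (exists x, Sigma_A K A x); last first.
  exists 0; split=> [x sx|k x y sx]; by exfalso; apply: ne; exists x.
have ha := holder_agree b0 th01 h; have [t0 t1] := andP th01.
exists (`|f x0| + b); split=> [x sx|k x y sx sy a].
  have := ha 0%N _ _ sx sx0 (fun i hi => ltac:(by [])); rewrite expr0 mulr1 => h0.
  by have := ler_normD (f x - f x0) (f x0); rewrite subrK; lra.
apply: le_trans (ha _ _ _ sx sy a) _.
by rewrite ler_wpM2r ?exprn_ge0 ?(ltW t0)// lerDr.
Qed.

(** The two sides can differ only where a logarithm is cut off; there the plain iterated logarithm
    is at most 0 and its square root vanishes. *)
Lemma lil_logcE {R : realType} (rho : R) n : 0 < rho ->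
  lil rho n%:R <= Num.sqrt (2 * rho * n%:R * logc (logc n%:R)).
Proof.
move=> r0; rewrite /lil; have n0 : 0 <= n%:R :> R by [].
have rn : 0 <= 2 * rho * n%:R by rewrite mulr_ge0// mulr_ge0// ltW.
apply: ler_wsqrtr; rewrite ler_wpM2l//.
rewrite /logc; case: (leP n%:R 1) => [n1|n1]; first by rewrite ler01; apply: ln_le0; exact: le_trans (ln_le0 n1) ler01.
by case: (leP (ln n%:R) 1) => // l1; exact: ln_le0.
Qed.

Theorem theorem2p1 (R : realType) (K : nat) (A : nat -> nat -> nat)
  (f : Seq -> R) (mu : probability SeqSpace R) (psi : nat -> nat) :
  (2 <= K)%N ->
  primitive01 K A ->
  holder K A f ->
  ~ cohomologous_to_const K A f ->
  mu (Sigma_A K A) = 1%E ->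
  shift_invariant mu ->
  ergodic_on K A mu ->
  is_gibbs K A f mu ->
  (forall n, (0 < n)%N -> (0 < psi n)%N) ->
  (exists2 eps : R, 0 < eps &
     (\sum_(1 <= n <oo)
        (expR (- mu_entropy K A mu * (psi n)%:R
               + (1 + eps) * Num.sqrt (2 * mu_variance K A mu f * (psi n)%:R
                                          * logc (logc (psi n)%:R))))%:E < +oo)%E) ->
  mu (@R_psi R K A psi) = 0%E.
Proof.
move=> K2 primA [b [th [b0 [th01 fhol]]]] ncoh muSA mu_inv _ [C [C1 gibbs]] psi0 [eps eps0].
set P := pressure K A f in gibbs.
have C0 : 0 < C by exact: lt_trans ltr01 C1.
have [G [C' [C'0 [G0 N1 gordin transfer]]]] :=
  ex_normalised K2 primA b0 th01 fhol muSA C1 gibbs.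
have hf := holder_hol b0 th01 fhol.
have [c [m [u [hm hu fE Nm]]]] := gordin _ hf.
have hm2 : hol K A th (fun x => m x ^+ 2).
  by apply: eq_hol (holM th01 hm hm) => x _; rewrite expr2.
have [rho [m2 [u2 [hm2' hu2 m2E Nm2]]]] := gordin _ hm2.
have Im2 := int_gordin th01 muSA mu_inv C'0 G0 N1 transfer hm2' hu2 m2E Nm2.
(* Otherwise the integral of m^2 is not positive. Cylinders have positive measure and m is
   continuous, so m vanishes on the subshift, and f = c + u o shift - u is excluded. *)
have rho0 : 0 < rho.
  rewrite ltNge; apply/negP => rho_le0; apply: ncoh; exists u, c; split.
    exact: hol_continuous hu.
  move=> x sx; rewrite fE//; suff -> : m x = 0 by ring.
  apply/eqP; rewrite -sqrf_eq0 eq_le sqr_ge0 andbT leNgt; apply/negP => mx.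
  have [n hn] := hol_lt_open th01 hm2 sx (ltac:(by rewrite ltr_pdivrMr// ltr_pMr// ltr1n) :
    m x ^+ 2 / 2 < m x ^+ 2).
  have mc := measurable_cylx K A x n.
  have cS : cylx K A x n `<=` Sigma_A K A by move=> y [].
  have cpos : 0 < pr mu (cylx K A x n).
    have [_ h] := gibbs_cylx muSA C1 gibbs n sx; rewrite -(pmulr_rgt0 _ C0).
    by apply: lt_le_trans h; rewrite gprod_weight expR_gt0.
  have := le_int mu (bmeasZ (m x ^+ 2 / 2) (indic_bmeas K A mc)) (hol_bmeas th01 hm2).
  rewrite Im2 (intZ mu _ (indic_bmeas K A mc)) (int_indic mu mc cS) => h.
  have : m x ^+ 2 / 2 * pr mu (cylx K A x n) <= rho.
    apply: h => y sy; rewrite indicE; case: (boolP (y \in _)) => [/set_mem[_ yx]|_].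
      by rewrite mulr1 ltW// hn.
    by rewrite mulr0 sqr_ge0.
  by rewrite leNgt (le_lt_trans rho_le0)// mulr_gt0// divr_gt0.
rewrite (mu_variance_gordin th01 muSA mu_inv C'0 G0 N1 transfer hf hm hu fE Nm) Im2.
rewrite (mu_entropy_gordin th01 muSA mu_inv C'0 G0 N1 transfer hf hm hu fE Nm C1 gibbs).
set h := P - c; move=> hsum.
have [D1 D10 [mD1 _]] := hol_pos th01 hm.
have [D2 D20 [uD2 _]] := hol_pos th01 hu2.
have [U U0 [uU _]] := hol_pos th01 hu.
have mD x : Sigma_A K A x -> `|m x| <= D1 + D2.
  by move=> sx; rewrite (le_trans (mD1 x sx))// lerDl ltW.
have u2D x : Sigma_A K A x -> `|u2 x| <= D1 + D2.
  by move=> sx; rewrite (le_trans (uD2 x sx))// lerDr ltW.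
have [E [t0 [E0 t00 sharp]]] := mgf_sharp G0 N1 (ltW rho0) mD u2D m2E Nm Nm2.
(* The iterated-logarithm bound is proved for parameters at most 1 only. *)
pose e := Num.min eps 1.
have e0 : 0 < e by rewrite lt_min eps0 ltr01.
have e1 : e <= 1 by rewrite ge_min lexx orbT.
have [Z Z0 hZ] := iterated_logarithm_le th01 mu_inv C'0 G0 N1 transfer hm mD Nm
  (addr_gt0 D10 D20) rho0 E0 t00 sharp e0 e1.
pose term n := expR (- h * (psi n)%:R + (1 + eps) * Num.sqrt (2 * rho * (psi n)%:R
  * logc (logc (psi n)%:R))).
(* Uniformity in N0 turns the almost sure bound into one for all cylinders of length at least N0, as
   [pr_returns_le] requires; these sets exhaust the complement of [Z] in the subshift. *)
pose Gd N0 : set SeqSpace := [set x | Sigma_A K A x /\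
  forall n, (N0 <= n)%N -> birkhoff m n x <= (1 + e) * lil rho n%:R].
have mGd N0 : measurable (Gd N0).
  pose V : set SeqSpace := [set x | Sigma_A K A x /\ exists2 n, (N0 <= n)%N &
    (1 + e) * lil rho n%:R < birkhoff m n x].
  have mV : measurable V.
    apply: (@measurable_relopen K A) => [x [sx _] //|x [sx [n nk hn]]].
    have [j hj] := hol_lt_open th01 (hol_birkhoff th01 n hm) sx hn.
    by exists j => y sy yx; split=> //; exists n => //; exact: hj.
  have -> : Gd N0 = (Sigma_A K A : set SeqSpace) `\` V.
    apply/seteqP; split=> x [sx hx]; split=> //.
      by move=> [_ [n nN]]; rewrite ltNge hx.
    by move=> n nN; rewrite leNgt; apply/negP => lt; apply: hx; split=> //; exists n.
  by apply: measurableD => //; exact: measurable_SA.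
(* Time n + 1, because the series starts at 1 and return times are positive. *)
pose F N0 n : set SeqSpace := returns K A n.+1 (psi n.+1) `&` Gd N0.
have mF N0 n : measurable (F N0 n) by apply: measurableI => //; exact: measurable_returns.
have limF0 N0 : (mu (lim_sup_set (F N0)) = 0)%E.
  apply: lim_sup_set_cvg0 => //.
  (* The first summand serves psi >= N0, with 2 U for the coboundary. For psi < N0 there is no
     control of the sum, but the cylinder has measure at most 1 <= e^(|h| N0) times the term of the
     series. *)
  pose Q := C * expR (2 * U) + expR (`|h| * N0%:R).
  have Q0 : 0 <= Q by rewrite addr_ge0 ?expR_ge0// mulr_ge0 ?expR_ge0// ltW.
  have Fle n : pr mu (F N0 n) <= C ^+ 3 * (Q * term n.+1).
    have tn0 : 0 <= term n.+1 by exact: expR_ge0.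
    apply: (pr_returns_le muSA C1 gibbs (ltn0Sn n) _ (mF N0 n)).
    - by rewrite mulr_ge0.
    - by move=> x [hx _]; exact: hx.
    move=> x [_ [sx hx]]; set p := psi n.+1.
    have sq0 : 0 <= (1 + eps) * Num.sqrt (2 * rho * p%:R * logc (logc p%:R)).
      by rewrite mulr_ge0 ?sqrtr_ge0// addr_ge0// ltW.
    have [pN|Np] := ltnP p N0.
      apply: le_trans (pr_le1 mu (measurable_cylx K A x p)) _.
      apply: (@le_trans _ _ (expR (`|h| * N0%:R) * term n.+1)); last first.
        by rewrite ler_wpM2r// lerDr mulr_ge0 ?expR_ge0// ltW.
      rewrite /term -/p -expRD -[leLHS]expR0 ler_expR.
      have : h * p%:R <= `|h| * N0%:R.
        apply: le_trans (ler_norm _) _; rewrite normrM (@ger0_norm _ p%:R)//.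
        by rewrite ler_wpM2l// ler_nat ltnW.
      by rewrite mulNr; lra.
    apply: (@le_trans _ _ ((C * expR (2 * U)) * term n.+1)); last first.
      by rewrite ler_wpM2r// lerDl expR_ge0.
    have [le1 _] := gibbs_cylx muSA C1 gibbs p sx.
    apply: (le_trans le1); rewrite -mulrA ler_wpM2l ?(ltW C0)//.
    rewrite gprod_weight /term -/p -expRD ler_expR (birkhoff_gordin fE)//.
    have := hx p Np; have := uU _ sx; have := uU _ (SA_iter_shift p sx).
    rewrite !ler_norml => /andP[_ v1] /andP[v2 _] v3.
    have : (1 + e) * lil rho p%:R <= (1 + eps) * Num.sqrt (2 * rho * p%:R * logc (logc p%:R)).
      rewrite ler_pM ?sqrtr_ge0 ?lil_logcE// ?addr_ge0 ?(ltW e0)//.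
      by rewrite lerD2l ge_min lexx.
    rewrite /h; lra.
  rewrite (eq_eseriesr (g := fun n => (pr mu (F N0 n))%:E)); last by move=> n _; rewrite -prE.
  pose M := fine (\sum_(1 <= n <oo) (term n)%:E)%E.
  have tn k : (1 <= k)%N -> true -> (0 <= (term k)%:E)%E by rewrite lee_fin expR_ge0.
  have ME : (\sum_(1 <= n <oo) (term n)%:E = M%:E)%E.
    by rewrite fineK// ge0_fin_numE// nneseries_ge0.
  apply: (nneseries_lt_pinfty (M := C ^+ 3 * (Q * M))) => [n|n]; first exact: pr_ge0.
  apply: (@le_trans _ _ (\sum_(0 <= k < n) C ^+ 3 * (Q * term k.+1))).
    by apply: ler_sum => k _; exact: Fle.
  rewrite -!mulr_sumr ler_wpM2l ?exprn_ge0 ?(ltW C0)// ler_wpM2l//.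
  rewrite -lee_fin -ME -sumEFin.
  rewrite (_ : (\sum_(0 <= i < n) (term i.+1)%:E = \sum_(1 <= i < n.+1) (term i)%:E)%E).
    exact: nneseries_lim_ge.
  by rewrite big_add1.
have RE : @R_psi R K A psi = lim_sup_set (fun n => returns K A n.+1 (psi n.+1)).
  apply/seteqP; split=> [x [sx hx] N _|x hx].
    have [[|n] [Nn dn]] := hx N; first by [].
    by exists n => //; split=> //; have [+ _] := dist_leE (R := R) K2 n.+1 (psi n.+1) x; exact.
  have sx : Sigma_A K A x by have [n _ []] := hx 0%N I.
  split=> // N; have [n /= Nn [_ hn]] := hx N I.
  by exists n.+1; split=> //; have [_ +] := dist_leE (R := R) K2 n.+1 (psi n.+1) x; exact.
have mR : measurable (@R_psi R K A psi : set SeqSpace).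
  by rewrite RE; apply: measurable_lim_sup_set => n; exact: measurable_returns.
apply: measure_negligible => //.
apply: (@negligibleS _ _ _ _ (Z `|` \bigcup_N0 lim_sup_set (F N0))).
  move=> x; rewrite RE => hx.
  have sx : Sigma_A K A x by have [n _ []] := hx 0%N I.
  have [zx|nzx] := pselect (Z x); first by left.
  right; have [N0 hN0] := hZ x sx nzx; exists N0 => // N _.
  have [n Nn rn] := hx N I; exists n => //; split=> //.
apply: negligibleU => //; apply: negligible_bigcup => N0.
apply/negligibleP; first exact: measurable_lim_sup_set.
exact: limF0.
Qed.
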